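(* Let $T$ be a regular tree and let $H$ be a bounded and spherically symmetric Schrödinger operator on $\ell^2(T)$. Then $$\sigma_{\mathrm{ess}}(H)=\bigcup_{L\in\mathcal{R}(H)}\sigma(L).$$
   Context: A regular tree is the infinite $d$-regular tree with $d>2$. All graphs are simple, undirected and connected; a graph $G$ is identified with its vertex set $V(G)$, $u\sim v$ means that $u,v$ are adjacent, and $\mathrm{dist}$ is the graph distance. A Schrödinger operator on a graph $G$ is an operator $H=\Delta+Q$ on $\ell^2(G)=\ell^2(V(G))$ acting by $(H\psi)(v)=\sum_{u\sim v}(\psi(u)-\psi(v))+Q(v)\psi(v)$, where $Q:V(G)\to\mathbb{R}$ is a bounded function. On a regular tree, $H$ is spherically symmetric if for some vertex $v_0\in T$ and some $q:\mathbb{N}\to\mathbb{R}$ one has $Q(v)=q(|v|+1)$ for all $v$, where $|v|=\mathrm{dist}(v,v_0)$. $\sigma(\cdot)$ is the spectrum; $\sigma_{\mathrm{ess}}(\cdot)$ is the essential spectrum (the spectrum minus the isolated eigenvalues of finite multiplicity). $\mathcal{R}$-limits. For $H$ a Schrödinger operator on a graph $G$ of bounded degree put $B_r(v)=\{u\in G:\mathrm{dist}(u,v)\le r\}$ and $N_{v,r}=|B_r(v)|$. For a bijection $\eta:B_r(v)\to\{1,\dots,N_{v,r}\}$ let $\mathcal{I}_\eta:\ell^2(B_r(v))\to\mathbb{C}^{N_{v,r}}$ be the unitary map $\delta_u\mapsto e_{\eta(u)}$, and let $M^{(v)}_{\eta,r}=\mathcal{I}_\eta\, H|_{B_r(v)}\,\mathcal{I}_\eta^{-1}$,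 where $H|_{B_r(v)}$ is the restriction (compression) of $H$ to $\ell^2(B_r(v))$. A sequence $\{\mathcal{I}_{\eta_r}\}_{r\ge1}$ with bijections $\eta_r:B_r(v)\to\{1,\dots,N_{v,r}\}$ is a coherent sequence at $v$ if $\eta_s(u)=\eta_r(u)$ for all $r<s$ and $u\in B_r(v)$; in this case write $M^{(v)}_r=M^{(v)}_{\eta_r,r}$. A path to infinity in $G$ is a sequence of vertices $\{v_n\}_{n\ge0}$ with $v_{n+1}\sim v_n$ for all $n$ and $\mathrm{dist}(v_n,v_0)\to\infty$. Given a graph $G'$, a vertex $v_0'\in G'$ and a Schrödinger operator $H'$ on $G'$, the triple $\{H',G',v_0'\}$ is an $\mathcal{R}$-limit of $H$ along the path to infinity $\{v_n\}$ if there is an increasing sequence of indices $\{n_j\}_{j\ge1}$ such that (i) for every $j$ there is a coherent sequence of isomorphisms at $v_{n_j}$; (ii) there is a coherent sequence of isomorphisms at $v_0'$ (for $H'$, $G'$); (iii) for every $r\in\mathbb{N}$, $N_{v_{n_j},r}=N_{v_0',r}$ for all sufficiently large $j$, and $\lim_{j\to\infty}M^{(v_{n_j})}_r=M^{(v_0')}_r$ for the matrices defined by these coherent sequences. $\mathcal{R}(H)$ denotes the set of all $\mathcal{R}$-limits of $H$ (along all paths to infinity); an element $L\in\mathcal{R}(H)$ is identified with the operator $H'$ on $\ell^2(G')$. *)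

(* Defs.v *)
From mathcomp Require Import all_boot all_order all_algebra.
From mathcomp Require Import finmap.
From mathcomp Require Import all_classical all_reals all_analysis.
From mathcomp Require Import complex.

Set Implicit Arguments.
Unset Strict Implicit.
Unset Printing Implicit Defensive.

Import Order.TTheory GRing.Theory Num.Theory.
Import numFieldNormedType.Exports.

Local Open Scope classical_set_scope.
Local Open Scope card_scope.
Local Open Scope ring_scope.

Record graph := Graph {
  vertex :> choiceType;
  adj : rel vertex;
  adj_sym : symmetric adj;
  adj_irr : irreflexive adj;
  adj_connected : forall u v : vertex, exists p, path adj u p /\ last u p = v }.

Section Graphs.
Variable G : graph.
Implicit Types u v : G.

Definition neighbours v : set G := [set u | adj v u].

Definition walk u v (n : nat) : bool :=
  `[< exists p, [/\ path (@adj G) u p, last u p = v & size p = n] >].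

Lemma walk_exists u v : exists n, walk u v n.
Proof.
by have [p [pp lp]] := adj_connected u v; exists (size p); apply/asboolP; exists p.
Qed.

Definition dist u v : nat := ex_minn (walk_exists u v).

Definition gball v (r : nat) : set G := [set u | (dist u v <= r)%N].

(* Meaningful for finite balls only: [fset_set] of an infinite set is empty. *)
Definition gball_size v (r : nat) : nat := #|` fset_set (gball v r)|.

Definition bounded_degree := exists d : nat, forall v, neighbours v #<= `I_d.

Definition acyclic := forall c : seq G, (2 < size c)%N -> ~ ucycle (@adj G) c.

Definition path_to_infinity (v : nat -> G) :=
  (forall n, adj (v n.+1) (v n)) /\ (fun n => dist (v n) (v 0%N)) @ \oo --> \oo.

End Graphs.

Definition regular_tree (d : nat) (T : graph) :=
  [/\ infinite_set [set: T], acyclic T & forall v : T, neighbours v #= `I_d].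

Section Ell2.
Variables (R : realType) (V : choiceType).
Local Notation C := R[i].
Implicit Types (psi : V -> C) (A B : (V -> C) -> V -> C) (lam : C).

Definition normc2 psi (v : V) : \bar R := (Normc.normc (psi v) ^+ 2)%:E.

Definition ell2 : set (V -> C) := [set psi | summable [set: V] (normc2 psi)].

Definition ell2_norm psi : R :=
  Num.sqrt (fine (\esum_(v in [set: V]) normc2 psi v)).

(* Operators are maps on all functions [V -> C]; only their action on [ell2]
   is ever constrained. *)
Definition bounded_operator B :=
  [/\ forall psi, ell2 psi -> ell2 (B psi),
      forall (a : C) psi phi, ell2 psi -> ell2 phi ->
        B (fun v => a * psi v + phi v) = (fun v => a * B psi v + B phi v)
    & exists M : R, forall psi, ell2 psi ->
        ell2_norm (B psi) <= M * ell2_norm psi].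

Definition shift A lam psi : V -> C := fun v => A psi v - lam * psi v.

Definition resolvent_set A : set C :=
  [set lam | exists B, [/\ bounded_operator B,
     forall psi, ell2 psi -> B (shift A lam psi) = psi
   & forall psi, ell2 psi -> shift A lam (B psi) = psi]].

Definition spectrum A : set C := ~` resolvent_set A.

Definition eigenspace A lam : set (V -> C) :=
  [set psi | ell2 psi /\ A psi = (fun v => lam * psi v)].

Definition eigenvalue A : set C :=
  [set lam | exists2 psi, eigenspace A lam psi & psi <> (fun=> 0)].

Definition finite_multiplicity A lam :=
  exists (n : nat) (b : 'I_n -> V -> C), forall psi, eigenspace A lam psi ->
    exists a : 'I_n -> C, psi = (fun v => \sum_(i < n) a i * b i v).

Definition essential_spectrum A : set C :=
  spectrum A `\` [set lam | [/\ isolated (spectrum A : set C^o) lam,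
                                eigenvalue A lam & finite_multiplicity A lam]].

End Ell2.

Record schrodinger_operator (R : realType) (G : graph) := SchrodingerOperator {
  potential : G -> R;
  potential_bounded : exists M : R, forall v, `|potential v| <= M }.

(* The sum is finitely supported when [G] has finite degrees, and is set to 0 by
   convention if infinitely many terms are nonzero. *)
Definition schrodinger_apply (R : realType) (G : graph)
    (H : schrodinger_operator R G) (psi : G -> R[i]) : G -> R[i] :=
  fun v => \sum_(u \in neighbours v) (psi u - psi v)
           + ((potential H v)%:C)%C * psi v.

Coercion schrodinger_apply : schrodinger_operator >-> Funclass.

Definition spherically_symmetric (R : realType) (T : graph)
    (H : schrodinger_operator R T) :=
  exists (v0 : T) (q : nat -> R), forall v, potential H v = q (dist v v0 + 1)%N.

Section RLimits.
Variable R : realType.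

Definition delta (G : graph) (u : G) : G -> R[i] := fun w => (w == u)%:R.

(* Labels run over 0, .., N - 1 instead of 1, .., N, to match matrix indices. *)
Definition coherent_sequence (G : graph) (v : G) (eta : nat -> G -> nat) :=
  (forall r, (0 < r)%N -> set_bij (gball v r) `I_(gball_size v r) (eta r)) /\
  (forall r s u, (0 < r < s)%N -> gball v r u -> eta s u = eta r u).

(* Entry (i, k) is <delta_a, H delta_b>, with a, b in the ball labelled i, k. *)
Definition local_matrix (G : graph) (H : schrodinger_operator R G) (v : G)
    (eta : nat -> G -> nat) (r : nat) : 'M[R[i]^o]_(gball_size v r) :=
  let label_inv := 'pinv_(fun=> v) (gball v r) (eta r) in
  \matrix_(i, k) H (delta (label_inv k)) (label_inv i).

Definition R_limit_along (G : graph) (H : schrodinger_operator R G)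
    (v : nat -> G) (G' : graph) (H' : schrodinger_operator R G') (v0' : G') :=
  exists n : nat -> nat, {homo n : i j / (i < j)%N} /\
  exists (eta : nat -> nat -> G -> nat) (eta' : nat -> G' -> nat),
  [/\ forall j, coherent_sequence (v (n j)) (eta j),
      coherent_sequence v0' eta'
    & forall r, (0 < r)%N ->
      (\forall j \near \oo, gball_size (v (n j)) r = gball_size v0' r) /\
      (fun j => conform_mx (0 : 'M[R[i]^o]_(gball_size v0' r))
                  (local_matrix H (v (n j)) (eta j) r)) @ \oo
        --> local_matrix H' v0' eta' r].

(* Bounded degree of the limit graph makes its balls finite, so that their
   sizes and the local matrices of H' are the intended ones. *)
Definition R_limit (G : graph) (H : schrodinger_operator R G)
    (G' : graph) (H' : schrodinger_operator R G') (v0' : G') :=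
  bounded_degree G' /\
  exists2 v : nat -> G, path_to_infinity v & R_limit_along H v H' v0'.
End RLimits.

(* Main.v *)
(** Splitting into real and imaginary parts, [lam] lies in the spectrum of a
    Schrödinger operator [H] on a graph of bounded degree iff it is real and
    [A = H - lam] is not bounded below on finitely supported real functions
    (Neumann series for [(H - a)^2 + b^2]). It lies in the essential spectrum iff
    moreover the almost-null functions of [A] can be chosen to vanish on any
    given finite set ([far_approx]): if they can, then an isolated [lam] gives
    [|A A x| >= delta |A x|], so that almost-null functions with disjoint
    supports are close to infinitely many independent elements of [ker A]; if
    they cannot, then [A] is bounded below modulo finitely many coordinates.

    An almost-null function of an R-limit is transplanted far away in the tree
    through the labels, which shows one inclusion. For the other one, cut an
    almost-null function of [A] on the tree by tent functions of the distance to
    the root, then split it according to the ancestor below which it lives: this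
    costs little and yields almost-null functions of bounded support. Nesting
    the construction gives, arbitrarily far from the root, points [p] about which
    there are almost-null functions at all scales. By spherical symmetry the
    operator seen from [p] only depends on the distance from [p] to the root, so
    that [p] can be moved to a fixed ray, where a cluster point of the
    potentials, transported to a tree of words, provides the R-limit. *)

Require Import Defs.
From mathcomp Require Import all_boot all_order all_algebra finmap.
From mathcomp Require Import all_classical all_reals all_analysis.
From mathcomp Require Import complex.
From mathcomp Require Import ring lra zify.

Set Implicit Arguments.
Unset Strict Implicit.
Unset Printing Implicit Defensive.

Import Order.TTheory GRing.Theory Num.Theory.
Import numFieldNormedType.Exports.

Local Open Scope classical_set_scope.
Local Open Scope ring_scope.

(** * Finitely supported and square summable real functions *)

(** Almost-null functions of better and better accuracy, each found at its own place, would only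
    give R-limits whose spectra come close to [lam], and the union of these spectra is not visibly
    closed. A single limit has to carry all accuracies at once. This dictates the order of choices
    in [localise_nested]: a radius [D k] is fixed for each accuracy [4 ^- k], and only then are
    points found, arbitrarily far out, that see a function of accuracy [4 ^- k] within [D k] for
    every [k <= n]. A cluster point of the potentials around them inherits all these functions. The
    base 4 is what one localisation loses. These points lie on no common path, whereas R-limits are
    taken along paths: this is where spherical symmetry enters. Estimates are made on finitely
    supported functions and extended by truncation, since each value of the operator involves
    finitely many coordinates. Limits occur only as pointwise limits under a uniform norm bound. *)

Lemma cvg_sum_seq (R : realType) (I : Type) (s : seq I) (f : nat -> I -> R)
    (l : I -> R) : (forall i, f ^~ i @ \oo --> l i) ->
  (fun n => \sum_(i <- s) f n i) @ \oo --> \sum_(i <- s) l i.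
Proof.
move=> fl; elim: s => [|i s IH].
  rewrite big_nil (_ : (fun n => _) = fun=> 0); first exact: cvg_cst.
  by apply/funext => n; rewrite big_nil.
rewrite big_cons (_ : (fun n => _) = fun n => f n i + \sum_(j <- s) f n j).
  exact: cvgD (fl i) IH.
by apply/funext => n; rewrite big_cons.
Qed.

Section FiniteSupport.
Variables (R : realType) (V : choiceType).
Implicit Types (x y z : V -> R) (s : seq V).

Definition fsupp x := exists s, forall v, v \notin s -> x v = 0.

(** A finitely supported sum: meaningful as soon as one argument has finite support, and 0 by
    convention when infinitely many products are nonzero. *)
Definition dot x y : R := \sum_(v \in [set: V]) x v * y v.

Definition cutoff s x : V -> R := fun v => if v \in s then x v else 0.

Lemma fsupp_uniq x : fsupp x ->
  exists2 s, uniq s & forall v, v \notin s -> x v = 0.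
Proof.
move=> [s sx]; exists (undup s); first exact: undup_uniq.
by move=> v; rewrite mem_undup; exact: sx.
Qed.

Lemma dotE s x y : uniq s -> (forall v, v \notin s -> x v = 0) ->
  dot x y = \sum_(v <- s) x v * y v.
Proof.
move=> us sx; rewrite /dot (fsbigE s) //; last by move=> v _ /sx ->; rewrite mul0r.
by apply: eq_bigl => v; rewrite in_setT.
Qed.

Lemma dotC x y : dot x y = dot y x.
Proof. by apply: eq_fsbigr => v _; rewrite mulrC. Qed.

Lemma dotDr x y z : fsupp x -> dot x (y \+ z) = dot x y + dot x z.
Proof.
case/fsupp_uniq=> s us sx; rewrite !(dotE _ us sx) -big_split/=.
by apply: eq_bigr => v _; rewrite mulrDr.
Qed.

Lemma dotBr x y z : fsupp x -> dot x (y \- z) = dot x y - dot x z.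
Proof.
case/fsupp_uniq=> s us sx; rewrite !(dotE _ us sx) -sumrB/=.
by apply: eq_bigr => v _; rewrite mulrBr.
Qed.

Lemma dotZr a x y : fsupp x -> dot x (a \*o y) = a * dot x y.
Proof.
case/fsupp_uniq=> s us sx; rewrite !(dotE _ us sx) mulr_sumr/=.
by apply: eq_bigr => v _; rewrite mulrCA.
Qed.

Lemma fsuppD x y : fsupp x -> fsupp y -> fsupp (x \+ y).
Proof.
move=> [s sx] [t ty]; exists (s ++ t) => v; rewrite mem_cat negb_or.
by move=> /andP[/sx + /ty] /= => -> ->; rewrite addr0.
Qed.

Lemma fsuppB x y : fsupp x -> fsupp y -> fsupp (x \- y).
Proof.
move=> [s sx] [t ty]; exists (s ++ t) => v; rewrite mem_cat negb_or.
by move=> /andP[/sx + /ty] /= => -> ->; rewrite subr0.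
Qed.

Lemma fsuppZ a x : fsupp x -> fsupp (a \*o x).
Proof. by move=> [s sx]; exists s => v /sx /= ->; rewrite mulr0. Qed.

Lemma fsupp_cutoff s x : fsupp (cutoff s x).
Proof. by exists s => v; rewrite /cutoff => /negbTE ->. Qed.

Lemma dotDl x y z : fsupp x -> fsupp y -> dot (x \+ y) z = dot x z + dot y z.
Proof.
move=> [s sx] [t ty]; have sv v : v \notin undup (s ++ t) -> x v = 0 /\ y v = 0.
  by rewrite mem_undup mem_cat negb_or => /andP[/sx + /ty] /=.
rewrite (@dotE (undup (s ++ t))) ?undup_uniq//; last by move=> v /sv[/= -> ->]; rewrite addr0.
rewrite (@dotE (undup (s ++ t)) x) ?undup_uniq//; last by move=> v /sv[].
rewrite (@dotE (undup (s ++ t)) y) ?undup_uniq//; last by move=> v /sv[].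
by rewrite -big_split; apply: eq_bigr => v _ /=; rewrite mulrDl.
Qed.

Lemma dotZl a x z : dot (a \*o x) z = a * dot x z.
Proof.
rewrite /dot mulr_fsumr; apply: eq_fsbigr => v _ /=; exact/esym/mulrA.
Qed.

Lemma dotBl x y z : fsupp x -> fsupp y -> dot (x \- y) z = dot x z - dot y z.
Proof.
move=> fx fy; have -> : x \- y = x \+ (-1 \*o y).
  by apply/funext => v /=; rewrite mulN1r.
by rewrite dotDl ?dotZl ?mulN1r//; exact: fsuppZ.
Qed.

Lemma dot_ge0 x : 0 <= dot x x.
Proof. by apply: fsumr_ge0 => v _; rewrite -expr2 sqr_ge0. Qed.

Lemma sumsq_le_dot s x : fsupp x -> uniq s -> \sum_(v <- s) x v ^+ 2 <= dot x x.
Proof.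
move=> [t tx] us; pose r := undup (t ++ s).
rewrite (@dotE r) ?undup_uniq//; last first.
  by move=> v; rewrite mem_undup mem_cat negb_or => /andP[/tx].
have sr : {subset s <= r} by move=> v vs; rewrite mem_undup mem_cat vs orbT.
under eq_bigr do rewrite expr2.
rewrite [leRHS](bigID (mem s))/= -[X in _ <= X + _]big_filter.
rewrite (@perm_big _ _ _ _ [seq v <- r | v \in s] s); last first.
  apply: uniq_perm => //; first by rewrite filter_uniq ?undup_uniq.
  by move=> v; rewrite mem_filter; case vs : (v \in s) => //=; exact: sr.
by rewrite lerDl sumr_ge0// => v _; rewrite -expr2 sqr_ge0.
Qed.

Lemma dot_cutoff s x : uniq s ->
  dot (cutoff s x) (cutoff s x) = \sum_(v <- s) x v ^+ 2.
Proof.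
move=> us; rewrite (@dotE s)//; last by move=> v vs; rewrite /cutoff (negbTE vs).
by apply: eq_big_seq => v vs; rewrite /cutoff vs expr2.
Qed.

Lemma dot_expand_sub x y : fsupp x -> fsupp y ->
  dot (x \- y) (x \- y) = dot x x - 2 * dot x y + dot y y.
Proof.
move=> fx fy; have fxy := fsuppB fx fy.
rewrite dotBr// dotBl// (dotC _ y) dotBr// (dotC y x); ring.
Qed.

Lemma dot_expand_add x y : fsupp x -> fsupp y ->
  dot (x \+ y) (x \+ y) = dot x x + 2 * dot x y + dot y y.
Proof.
move=> fx fy; have fxy := fsuppD fx fy.
rewrite dotDr// dotDl// (dotC _ y) dotDr// (dotC y x); ring.
Qed.

(* [norm_le x a] says that [x] is square summable with norm at most [a]. *)
Definition norm_le x (a : R) :=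
  0 <= a /\ forall s, uniq s -> \sum_(v <- s) x v ^+ 2 <= a ^+ 2.

Lemma norm_leW x a b : norm_le x a -> a <= b -> norm_le x b.
Proof.
move=> [a0 xa] ab; split; first exact: le_trans ab.
by move=> s us; apply: le_trans (xa _ us) _; rewrite lerXn2r ?nnegrE// (le_trans a0).
Qed.

Lemma norm_le_abs x a v : norm_le x a -> `|x v| <= a.
Proof.
move=> [a0 /(_ [:: v] isT)]; rewrite big_seq1 => h.
by rewrite -(@ler_pXn2r _ 2)// ?nnegrE// -normrX ger0_norm ?sqr_ge0.
Qed.

Lemma norm_le0 x v : norm_le x 0 -> x v = 0.
Proof. by move=> /norm_le_abs => /(_ v); rewrite normr_le0 => /eqP. Qed.

Lemma norm_le_zero a : 0 <= a -> norm_le (fun=> 0) a.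
Proof. by move=> a0; split=> // s _; rewrite big1 ?sqr_ge0// => v _; rewrite expr0n. Qed.

(** Minkowski's inequality through [(x + y)^2 <= (1 + b/a) x^2 + (1 + a/b) y^2], whose weights are
    tuned so that the bounds [a^2] and [b^2] add up to exactly [(a + b)^2]. The cases [a = 0] and
    [b = 0] are split off because of the quotients. *)
Lemma norm_leD x y a b : norm_le x a -> norm_le y b -> norm_le (x \+ y) (a + b).
Proof.
move=> xa yb; have [a0 xs] := xa; have [b0 ys] := yb.
split=> [|s us]; first exact: addr_ge0.
have [az|an] := eqVneq a 0.
  rewrite az add0r; have x0 v : x v = 0 by apply: norm_le0; rewrite -az.
  by under eq_bigr do rewrite /= x0 add0r; exact: ys.
have [bz|bn] := eqVneq b 0.
  rewrite bz addr0; have y0 v : y v = 0 by apply: norm_le0; rewrite -bz.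
  by under eq_bigr do rewrite /= y0 addr0; exact: xs.
have ap : 0 < a by rewrite lt_neqAle eq_sym an.
have bp : 0 < b by rewrite lt_neqAle eq_sym bn.
have h v : (x v + y v) ^+ 2 <= (1 + b / a) * x v ^+ 2 + (1 + a / b) * y v ^+ 2.
  rewrite -subr_ge0.
  have -> : (1 + b / a) * x v ^+ 2 + (1 + a / b) * y v ^+ 2 - (x v + y v) ^+ 2 =
      (b * x v - a * y v) ^+ 2 / (a * b) by field; rewrite an bn.
  by rewrite divr_ge0 ?sqr_ge0 ?mulr_ge0.
apply: (@le_trans _ _ (\sum_(v <- s) ((1 + b / a) * x v ^+ 2 + (1 + a / b) * y v ^+ 2))).
  by apply: ler_sum => v _; exact: h.
rewrite big_split/= -!mulr_sumr.
have -> : (a + b) ^+ 2 = (1 + b / a) * a ^+ 2 + (1 + a / b) * b ^+ 2.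
  by field; rewrite an bn.
by apply: lerD; apply: ler_wpM2l; rewrite ?xs ?ys ?addr_ge0 ?divr_ge0.
Qed.

Lemma norm_leZ x a c : norm_le x a -> norm_le (c \*o x) (`|c| * a).
Proof.
move=> [a0 xs]; split=> [|s us]; first exact: mulr_ge0.
under eq_bigr do rewrite /= exprMn; rewrite -mulr_sumr exprMn real_normK ?num_real//.
by apply: ler_wpM2l; rewrite ?sqr_ge0 ?xs.
Qed.

Lemma norm_leN x a : norm_le x a -> norm_le (\- x) a.
Proof.
move=> [a0 xs]; split=> // s us; under eq_bigr do rewrite /= sqrrN; exact: xs.
Qed.

Lemma norm_leB x y a b : norm_le x a -> norm_le y b -> norm_le (x \- y) (a + b).
Proof. by move=> xa yb; apply: (norm_leD xa); exact: norm_leN. Qed.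

Lemma norm_le_fsupp x a : fsupp x -> 0 <= a ->
  norm_le x a <-> dot x x <= a ^+ 2.
Proof.
move=> fx a0; split=> [[_ xs]|xa].
  case/fsupp_uniq: fx => s us sx; rewrite (dotE _ us sx).
  by under eq_bigr do rewrite -expr2; exact: xs.
by split=> // s us; exact: le_trans (sumsq_le_dot fx us) xa.
Qed.

Lemma norm_le_sqrt_dot x : fsupp x -> norm_le x (Num.sqrt (dot x x)).
Proof.
by move=> fx; apply/norm_le_fsupp; rewrite ?sqrtr_ge0 ?sqr_sqrtr ?dot_ge0.
Qed.

Lemma norm_le_cutoff s x a : norm_le x a -> norm_le (cutoff s x) a.
Proof.
move=> [a0 xs]; split=> // t ut; apply: le_trans (xs _ ut).
by apply: ler_sum => v _; rewrite /cutoff; case: ifP => // _; rewrite expr0n sqr_ge0.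
Qed.

Lemma norm_le_lim (p : nat -> V -> R) x a :
  (forall n, norm_le (p n) a) -> (forall v, p ^~ v @ \oo --> x v) -> norm_le x a.
Proof.
move=> pa px; split=> [|s us]; first by have [] := pa 0%N.
have : (fun n => \sum_(v <- s) p n v ^+ 2) @ \oo --> \sum_(v <- s) x v ^+ 2.
  apply: cvg_sum_seq => v; rewrite expr2 (_ : (fun n => _) = fun n => p n v * p n v).
    exact: cvgM (px v) (px v).
  by apply/funext => n; rewrite expr2.
move=> cv; apply: (cvgr_to_le cv).
by near=> n; have [_] := pa n; apply.
Unshelve. all: by end_near. Qed.

End FiniteSupport.

(** * Symmetric operators of finite range *)

Section SymmetricLocal.
Variables (R : realType) (V : choiceType).
Implicit Types (x y z g f : V -> R) (s : seq V) (A B S : (V -> R) -> V -> R).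

(** Finite rows let [A] act on every function and make it continuous for pointwise convergence.
    Symmetry needs only one finitely supported argument, so that it may be used against a square
    summable one. *)
Record sym_local A : Prop := SymLocal {
  kernel_of : forall v, exists l : seq (V * R),
    forall x, A x v = \sum_(p <- l) p.2 * x p.1;
  fsupp_of : forall x, fsupp x -> fsupp (A x);
  sym_of : forall x y, fsupp x -> dot (A x) y = dot x (A y);
  bound_of : exists2 M, 0 < M &
    forall x, fsupp x -> dot (A x) (A x) <= M ^+ 2 * dot x x }.

Section Basic.
Variables (A : (V -> R) -> V -> R) (hA : sym_local A).

Lemma sym_localD x y : A (x \+ y) = A x \+ A y.
Proof.
apply/funext => v; have [l Al] := kernel_of hA v.
by rewrite /= !Al -big_split; apply: eq_bigr => p _ /=; rewrite mulrDr.
Qed.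

Lemma sym_localZ a x : A (a \*o x) = a \*o A x.
Proof.
apply/funext => v; have [l Al] := kernel_of hA v.
by rewrite /= !Al mulr_sumr; apply: eq_bigr => p _ /=; rewrite mulrCA.
Qed.

Lemma sym_localB x y : A (x \- y) = A x \- A y.
Proof.
apply/funext => v; have [l Al] := kernel_of hA v.
by rewrite /= !Al -sumrB; apply: eq_bigr => p _ /=; rewrite mulrBr.
Qed.

Lemma sym_local0 : A (fun=> 0) = fun=> 0.
Proof.
apply/funext => v; have [l ->] := kernel_of hA v.
by rewrite big1// => p _; rewrite mulr0.
Qed.

Lemma sym_local_near v : exists s : seq V,
  forall x y, (forall u, u \in s -> x u = y u) -> A x v = A y v.
Proof.
have [l Al] := kernel_of hA v; exists [seq p.1 | p <- l] => x y xy.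
by rewrite !Al; apply: eq_big_seq => p pl; rewrite xy// map_f.
Qed.

Lemma sym_local_near_seq s : exists r : seq V,
  forall x y, (forall u, u \in r -> x u = y u) -> forall v, v \in s -> A x v = A y v.
Proof.
elim: s => [|v s [r IH]]; first by exists [::].
have [t tv] := sym_local_near v; exists (t ++ r) => x y xy u.
rewrite inE => /predU1P[->|us].
  by apply: tv => w wt; apply: xy; rewrite mem_cat wt.
by apply: (IH _ _ _ _ us) => w wr; apply: xy; rewrite mem_cat wr orbT.
Qed.

Lemma sym_local_cvg (p : nat -> V -> R) g v :
  (forall u, p ^~ u @ \oo --> g u) -> (fun n => A (p n) v) @ \oo --> A g v.
Proof.
move=> pg; have [l Al] := kernel_of hA v.
rewrite Al (_ : (fun n => _) = fun n => \sum_(q <- l) q.2 * p n q.1).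
  by apply: cvg_sum_seq => q; apply: cvgM (pg _); exact: cvg_cst.
by apply/funext => n; rewrite Al.
Qed.

(** Finitely many values of [A x] depend only on a finite truncation of [x], which has no larger
    norm; so a bound on finitely supported functions passes to all square summable ones. *)
Lemma sym_local_norm_le theta x a : 0 <= theta ->
  (forall z, fsupp z -> dot (A z) (A z) <= theta ^+ 2 * dot z z) ->
  norm_le x a -> norm_le (A x) (theta * a).
Proof.
move=> t0 Az [a0 xa]; split=> [|s us]; first exact: mulr_ge0.
have [r rs] := sym_local_near_seq s; pose z := cutoff (undup r) x.
have fz : fsupp z by exact: fsupp_cutoff.
have Axz v : v \in s -> A x v = A z v.
  by apply: rs => u ur; rewrite /z /cutoff mem_undup ur.
rewrite (eq_big_seq _ (fun v vs => congr1 (fun t => t ^+ 2) (Axz v vs))).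
apply: le_trans (sumsq_le_dot (fsupp_of hA fz) us) _.
apply: le_trans (Az _ fz) _; rewrite exprMn ler_wpM2l ?sqr_ge0//.
by rewrite dot_cutoff ?undup_uniq ?xa ?undup_uniq.
Qed.

Lemma sym_local_bounded : exists2 M, 0 < M &
  forall x a, norm_le x a -> norm_le (A x) (M * a).
Proof.
have [M M0 AM] := bound_of hA; exists M => // x a.
by apply: sym_local_norm_le => //; exact: ltW.
Qed.

End Basic.

Lemma sym_local_comp A : sym_local A -> sym_local (fun x => A (A x)).
Proof.
move=> hA; split.
- move=> v; have [l Al] := kernel_of hA v.
  have [k Ak] : exists k : V -> seq (V * R),
      forall u x, A x u = \sum_(q <- k u) q.2 * x q.1.
    by have [k hk] := choice (kernel_of hA); exists k.
  exists (flatten [seq [seq (q.1, p.2 * q.2) | q <- k p.1] | p <- l]) => x.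
  rewrite Al big_flatten big_map; apply: eq_bigr => p _.
  by rewrite Ak big_map mulr_sumr; apply: eq_bigr => q _ /=; rewrite mulrA.
- by move=> x /(fsupp_of hA) /(fsupp_of hA).
- by move=> x y fx; rewrite !(sym_of hA)//; exact: (fsupp_of hA).
- have [M M0 AM] := bound_of hA; exists (M ^+ 2); first exact: exprn_gt0.
  move=> x fx; apply: le_trans (AM _ (fsupp_of hA fx)) _.
  by rewrite [in leRHS]expr2 -mulrA ler_wpM2l ?sqr_ge0 ?AM.
Qed.

Lemma sym_local_id : sym_local (fun x => x).
Proof.
split=> //; first by move=> v; exists [:: (v, 1)] => x; rewrite big_seq1 mul1r.
by exists 1 => // x _; rewrite expr1n mul1r.
Qed.

Lemma sym_local_addZ A B c : sym_local A -> sym_local B ->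
  sym_local (fun x => A x \+ (c \*o B x)).
Proof.
move=> hA hB; split.
- move=> v; have [l Al] := kernel_of hA v; have [k Bk] := kernel_of hB v.
  exists (l ++ [seq (q.1, c * q.2) | q <- k]) => x.
  rewrite big_cat big_map /= Al Bk mulr_sumr; congr (_ + _).
  by apply: eq_bigr => q _ /=; rewrite mulrA.
- move=> x fx; apply: fsuppD; first exact: (fsupp_of hA).
  by apply: fsuppZ; exact: (fsupp_of hB).
- move=> x y fx; have fA := fsupp_of hA fx; have fB := fsupp_of hB fx.
  rewrite dotDl//; last exact: fsuppZ.
  by rewrite dotDr// dotZl dotZr// (sym_of hA)// (sym_of hB).
- have [M M0 AM] := bound_of hA; have [N N0 BN] := bound_of hB.
  have K0 : 0 <= `|c| * N by rewrite mulr_ge0// ltW.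
  exists (M + `|c| * N); first exact: ltr_wpDr.
  move=> x fx; have nx := norm_le_sqrt_dot fx.
  have nA := sym_local_norm_le hA (ltW M0) AM nx.
  have nB := norm_leZ c (sym_local_norm_le hB (ltW N0) BN nx).
  have := norm_leD nA nB; rewrite mulrA -mulrDl norm_le_fsupp.
  + by rewrite exprMn sqr_sqrtr ?dot_ge0.
  + apply: fsuppD; first exact: (fsupp_of hA).
    by apply: fsuppZ; exact: (fsupp_of hB).
  + by rewrite mulr_ge0 ?sqrtr_ge0// addr_ge0// ltW.
Qed.

(** Convergence of Neumann series: the partial sums have norm at most
    [a (1 - theta^n) / (1 - theta)], and the bound survives the pointwise limit. *)
Lemma norm_le_series (u : nat -> V -> R) theta a :
  0 <= theta < 1 -> (forall n, norm_le (u n) (theta ^+ n * a)) ->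
  exists2 g, norm_le g (a / (1 - theta)) &
    forall v, (fun n => \sum_(k < n) u k v) @ \oo --> g v.
Proof.
move=> /andP[t0 t1] ua.
have a0 : 0 <= a by have [] := ua 0%N; rewrite expr0 mul1r.
have cv v : cvgn (fun n => \sum_(k < n) u k v).
  have -> : (fun n => \sum_(k < n) u k v) = series (fun k => u k v).
    by apply/funext => n; rewrite /series /= big_mkord.
  apply: normed_cvg; apply: (series_le_cvg (v_ := geometric a theta)) => n //=.
  - by rewrite mulr_ge0// exprn_ge0.
  - by rewrite mulrC; exact: norm_le_abs (ua n).
  - by apply: is_cvg_geometric_series; rewrite ger0_norm.
exists (fun v => lim ((fun n => \sum_(k < n) u k v) @ \oo)); last exact: cv.
apply: (norm_le_lim (p := fun n v => \sum_(k < n) u k v)); last exact: cv.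
have t10 : 1 - theta != 0 by rewrite subr_eq0 eq_sym lt_eqF.
have psum n : norm_le (fun v => \sum_(k < n) u k v)
    (a * (1 - theta ^+ n) / (1 - theta)).
  elim: n => [|n IH].
    under eq_fun do rewrite big_ord0; apply: norm_le_zero.
    by rewrite expr0 subrr mulr0 mul0r.
  under eq_fun do rewrite big_ord_recr.
  have := norm_leD IH (ua n).
  have -> : a * (1 - theta ^+ n) / (1 - theta) + theta ^+ n * a =
            a * (1 - theta ^+ n.+1) / (1 - theta) by rewrite exprS; field.
  by [].
move=> n; apply: norm_leW (psum n) _.
apply: ler_wpM2r; first by rewrite invr_ge0 subr_ge0 ltW.
by apply: ler_piMr => //; rewrite lerBlDr lerDl exprn_ge0.
Qed.

(* Richardson iteration [z -> z - t S z] contracts where [S] is coercive. *)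
Lemma richardson_contracts (S : (V -> R) -> V -> R) : sym_local S ->
  forall c, 0 < c -> exists2 t, 0 < t & exists2 theta, 0 <= theta < 1 &
  forall z, fsupp z -> c * dot z z <= dot z (S z) ->
    dot (z \- (t \*o S z)) (z \- (t \*o S z)) <= theta ^+ 2 * dot z z.
Proof.
move=> hS c c0; have [M0 M00 SM0] := bound_of hS.
(* Enlarging the bound by [c] ensures [c < M], so that [1 - (c/M)^2] is positive. *)
pose M := M0 + c; have M1 : 0 < M by exact: addr_gt0.
have SM z : fsupp z -> dot (S z) (S z) <= M ^+ 2 * dot z z.
  move=> fz; apply: le_trans (SM0 _ fz) _; rewrite ler_wpM2r ?dot_ge0//.
  by apply: lerXn2r; rewrite ?nnegrE ?ltW// /M ltrDl.
have cM : c / M < 1 by rewrite ltr_pdivrMr// mul1r /M ltrDr.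
have cM0 : 0 < c / M by exact: divr_gt0.
have cM2 : (c / M) ^+ 2 < 1 by rewrite expr_lt1// ltW.
have d0 : 0 <= 1 - (c / M) ^+ 2 by rewrite subr_ge0 ltW.
exists (c / M ^+ 2); first by rewrite divr_gt0 ?exprn_gt0.
exists (Num.sqrt (1 - (c / M) ^+ 2)).
  rewrite sqrtr_ge0 /= -[X in _ < X]sqrtr1 ltr_sqrt ?ltr01//.
  by rewrite ltrBlDr ltrDl exprn_gt0.
move=> z fz zS; rewrite sqr_sqrtr//.
have fS := fsupp_of hS fz.
rewrite dot_expand_sub//; last exact: fsuppZ.
rewrite dotZr// dotZl dotZr//.
have -> : (1 - (c / M) ^+ 2) * dot z z =
  dot z z - 2 * (c / M ^+ 2 * (c * dot z z)) +
  (c / M ^+ 2) * (c / M ^+ 2 * (M ^+ 2 * dot z z)).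
  by field; rewrite gt_eqF.
have t0 : 0 < c / M ^+ 2 by rewrite divr_gt0 ?exprn_gt0.
apply: lerD; last by rewrite !ler_pM2l// SM.
by rewrite lerD2l lerN2 ler_pM2l// ler_pM2l.
Qed.

(** The solution is the sum of [t K^n f] with [K = 1 - t S]: applying [S] to a partial sum
    telescopes to [f - K^n f], which tends to [f]. *)
Lemma coercive_surjective S c : sym_local S -> 0 < c ->
  (forall z, fsupp z -> c * dot z z <= dot z (S z)) ->
  exists2 C, 0 <= C & forall f a, norm_le f a -> exists2 g, norm_le g (C * a) & S g = f.
Proof.
move=> hS c0 Sc; have [t t0 [theta th hK]] := richardson_contracts hS c0.
pose K x := x \- (t \*o S x).
have hK' : sym_local K.
  have := sym_local_addZ (- t) sym_local_id hS.
  by congr sym_local; apply/funext => x; apply/funext => v; rewrite /K /= mulNr.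
have /andP[th0 th1] := th.
exists (t / (1 - theta)); first by rewrite divr_ge0 ?subr_ge0 ?ltW.
move=> f a fa.
have a0 : 0 <= a by have [] := fa.
have Kn n : norm_le (iter n K f) (theta ^+ n * a).
  elim: n => [|n IH]; first by rewrite expr0 mul1r.
  rewrite iterS exprS -mulrA; apply: sym_local_norm_le IH => //.
  by move=> z fz; apply: hK => //; exact: Sc.
have Ktn n : norm_le (t \*o iter n K f) (theta ^+ n * (t * a)).
  have := norm_leZ t (Kn n); rewrite gtr0_norm// => h.
  by rewrite mulrCA.
have [g ga cg] := norm_le_series th Ktn.
exists g; first by rewrite mulrAC.
apply/funext => v.
have c1 := sym_local_cvg (v := v) hS cg.
have Sp n : S (fun u => \sum_(k < n) t * iter k K f u) v = f v - iter n K f v.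
  elim: n => [|n IH].
    under eq_fun do rewrite big_ord0.
    by rewrite (sym_local0 hS) /= subrr.
  under eq_fun do rewrite big_ord_recr.
  rewrite (sym_localD hS (fun u => \sum_(k < n) t * iter k K f u) (t \*o iter n K f)) /=.
  rewrite IH (sym_localZ hS) /=.
  have -> : K (iter n K f) v = iter n K f v - t * S (iter n K f) v by [].
  ring.
have c2 : (fun n => S (fun u => \sum_(k < n) t * iter k K f u) v) @ \oo --> f v.
  under eq_fun do rewrite Sp.
  suff K0 : (fun n => iter n K f v) @ \oo --> (0 : R).
    by have := cvgB (cvg_cst (f v)) K0; rewrite subr0; apply.
  apply/norm_cvg0P; apply: (squeeze_cvgr (f := fun=> 0) (h := geometric a theta)).
  - near=> n; rewrite normr_ge0 /= mulrC; exact: norm_le_abs (Kn n).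
  - exact: cvg_cst.
  - by apply: cvg_geometric; rewrite ger0_norm.
exact: cvg_unique c1 c2.
Unshelve. all: by end_near. Qed.

(** A null function of [S] is a fixed point of the contraction [1 - t S], hence has norm at most
    [theta^n a] for all [n]. *)
Lemma coercive_injective S c g a : sym_local S -> 0 < c ->
  (forall z, fsupp z -> c * dot z z <= dot z (S z)) ->
  norm_le g a -> S g = (fun=> 0) -> g = fun=> 0.
Proof.
move=> hS c0 Sc ga Sg; have [t t0 [theta th hK]] := richardson_contracts hS c0.
pose K x := x \- (t \*o S x).
have hK' : sym_local K.
  have := sym_local_addZ (- t) sym_local_id hS.
  by congr sym_local; apply/funext => x; apply/funext => v; rewrite /K /= mulNr.
have /andP[th0 th1] := th.
have Kg : K g = g by apply/funext => v; rewrite /K Sg /= mulr0 subr0.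
have gn n : norm_le g (theta ^+ n * a).
  elim: n => [|n IH]; first by rewrite expr0 mul1r.
  rewrite -Kg exprS -mulrA; apply: sym_local_norm_le IH => //.
  by move=> z fz; apply: hK => //; exact: Sc.
apply/funext => v; apply/eqP; rewrite -normr_le0.
have := @cvg_geometric R a theta; rewrite ger0_norm// => /(_ th1) cg.
apply: (cvgr_to_ge cg); near=> n; rewrite /= mulrC; exact: norm_le_abs (gn n).
Unshelve. all: by end_near. Qed.

End SymmetricLocal.

(** * Spectral gaps and approximation by kernel functions *)

Section SpectralGap.
Variables (R : realType) (V : choiceType).
Implicit Types (x y z g f k : V -> R) (s : seq V) (A B S : (V -> R) -> V -> R).

Definition shiftr A (c : R) : (V -> R) -> V -> R := fun x => A x \+ (- c \*o x).

Lemma sym_local_shiftr A c : sym_local A -> sym_local (shiftr A c).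
Proof. by move=> hA; exact: sym_local_addZ hA (sym_local_id _ _). Qed.

Lemma shiftrD A c e x : shiftr (shiftr A c) e x = shiftr A (c + e) x.
Proof. by apply/funext => v; rewrite /shiftr /=; ring. Qed.

Definition bdd_below A := exists2 kappa : R, 0 < kappa &
  forall x, fsupp x -> kappa * dot x x <= dot (A x) (A x).

Lemma dot_shiftr A c x : sym_local A -> fsupp x ->
  dot (shiftr A c x) (shiftr A c x) =
  dot (A x) (A x) - 2 * c * dot x (A x) + c ^+ 2 * dot x x.
Proof.
move=> hA fx; have fA := fsupp_of hA fx.
rewrite /shiftr dot_expand_add//; last exact: fsuppZ.
rewrite dotZr// dotZl dotZr// (dotC _ x); ring.
Qed.

(** Evaluate the nonnegative form at [x - S x / M]: the cross term gives [-2 |S x|^2 / M], and the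
    last term costs at most [|S x|^2 / M], because [<u, S u> <= M |u|^2] by expanding
    [|M u - S u|^2 >= 0]. *)
Lemma psd_sqr_le S : sym_local S ->
  (forall z, fsupp z -> 0 <= dot z (S z)) ->
  exists2 M, 0 < M & forall x, fsupp x -> dot (S x) (S x) <= M * dot x (S x).
Proof.
move=> hS S0; have [M M0 SM] := bound_of hS; exists M => // x fx.
have fS := fsupp_of hS fx; have fSS := fsupp_of hS fS.
have CS u : fsupp u -> dot u (S u) <= M * dot u u.
  move=> fu; have fSu := fsupp_of hS fu.
  have := dot_ge0 ((M \*o u) \- S u).
  rewrite dot_expand_sub//; last exact: fsuppZ.
  rewrite !dotZl dotZr// => h; have {}h := le_trans h (lerD (lexx _) (SM _ fu)).
  have {}h : 0 <= 2 * M * (M * dot u u - dot u (S u)) by move: h; lra.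
  by rewrite -subr_ge0 -(pmulr_rge0 _ (_ : 0 < 2 * M))// mulr_gt0.
have fx' := fsuppZ M^-1 fS.
have := S0 _ (fsuppB fx fx').
rewrite (sym_localB hS) (sym_localZ hS) dotBr; last exact: fsuppB.
rewrite !dotBl// !dotZl !dotZr// -(sym_of hS (S x) fx).
move: (CS _ fS) => h1 h2.
have h3 : M^-1 * (M^-1 * dot (S x) (S (S x))) <= M^-1 * dot (S x) (S x).
  rewrite ler_pM2l ?invr_gt0// -(ler_pM2l M0) mulrA mulfV ?mul1r//; exact: lt0r_neq0.
have {h2}h3 : M^-1 * dot (S x) (S x) <= dot x (S x).
  by move: h2 h3; lra.
by rewrite -(ler_pM2l (_ : 0 < M^-1)) ?invr_gt0// mulrA mulVf ?mul1r//; exact: lt0r_neq0.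
Qed.

(* If [m ^ 2] is the bottom of [A ^ 2] then the nonnegative operator
   [A ^ 2 - m ^ 2 = (A - m) (A + m)] is not bounded below, so one of the two
   factors is not either. *)
Lemma spectral_gap A (r : R) : sym_local A -> 0 < r ->
  (forall c, `|c| < r -> bdd_below (shiftr A c)) ->
  forall x, fsupp x -> r ^+ 2 * dot x x <= dot (A x) (A x).
Proof.
move=> hA r0 gap x0 fx0; rewrite leNgt; apply/negP => x0r.
pose E := [set t : R | forall x, fsupp x -> t * dot x x <= dot (A x) (A x)].
have Ex0 (t : R) : E t -> t < r ^+ 2.
  move=> /(_ _ fx0) /le_lt_trans /(_ x0r) h.
  have : 0 < dot x0 x0.
    rewrite lt_neqAle dot_ge0 andbT; apply/eqP => d0.
    by move: h; rewrite -d0 !mulr0 ltxx.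
  by move=> /ltr_pM2r <-.
have E0 : E 0 by move=> x fx; rewrite mul0r dot_ge0.
have supE : has_sup E by split; [exists 0 | exists (r ^+ 2) => t /Ex0 /ltW].
pose m2 := sup E; have m20 : 0 <= m2 by exact: ub_le_sup supE.2 _ E0.
have Em : E m2.
  move=> x fx; have [d0|d0] := eqVneq (dot x x) 0; first by rewrite d0 mulr0 dot_ge0.
  have dp : 0 < dot x x by rewrite lt_neqAle eq_sym d0 dot_ge0.
  rewrite -ler_pdivlMr//; apply: ge_sup; first by exists 0.
  by move=> t /(_ _ fx); rewrite ler_pdivlMr.
pose m := Num.sqrt m2.
have mr : m < r by rewrite -[r](@ger0_norm _ r) ?ltW// -sqrtr_sqr ltr_sqrt ?exprn_gt0 ?Ex0.
have m0 : 0 <= m by exact: sqrtr_ge0.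
have [k1 k10 h1] : bdd_below (shiftr A m) by apply: gap; rewrite ger0_norm.
have [k2 k20 h2] : bdd_below (shiftr A (- m)) by apply: gap; rewrite normrN ger0_norm.
pose S x := A (A x) \+ (- m2 \*o x).
have hS : sym_local S.
  by exact: sym_local_addZ (sym_local_comp hA) (sym_local_id _ _).
have S1 x : S x = shiftr A m (shiftr A (- m) x).
  apply/funext => v; rewrite /S /shiftr (sym_localD hA) (sym_localZ hA) /=.
  by rewrite opprK -[in LHS](sqr_sqrtr m20) -/m; ring.
have dS x : fsupp x -> dot x (S x) = dot (A x) (A x) - m2 * dot x x.
  by move=> fx; rewrite /S dotDr// dotZr// -(sym_of hA)// mulNr.
have [M M0 SM] : exists2 M, 0 < M &
    forall x, fsupp x -> dot (S x) (S x) <= M * dot x (S x).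
  by apply: psd_sqr_le => // z fz; rewrite dS// subr_ge0; exact: Em.
(* With both factors bounded below, [|S x|^2 >= k1 k2 |x|^2]; by [psd_sqr_le] the form of [S] is
   then at least [k1 k2 / M], which would raise the supremum [m2]. *)
have : E (m2 + k1 * k2 / M).
  move=> x fx; rewrite mulrDl -lerBrDl -dS// -(ler_pM2l M0).
  apply: le_trans (SM _ fx); rewrite mulrA mulrCA mulfV ?mulr1 ?lt0r_neq0//.
  rewrite S1 -mulrA; have fx' := fsupp_of (sym_local_shiftr (- m) hA) fx.
  by apply: le_trans (h1 _ fx'); rewrite ler_pM2l// h2.
move=> /(ub_le_sup supE.2); rewrite -/m2 gerDl leNgt => /negP; apply.
by rewrite divr_gt0 ?mulr_gt0.
Qed.

(* The gap around [0] gives [|<x, A x>| <= |A x|^2 / delta]; polarising this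
   form bound at the pair [x], [A x] gives the estimate. *)
Lemma isolated_zero_lower A (delta : R) : sym_local A -> 0 < delta ->
  (forall c, 0 < `|c| < delta -> bdd_below (shiftr A c)) ->
  forall x, fsupp x -> delta ^+ 2 * dot (A x) (A x) <= dot (A (A x)) (A (A x)).
Proof.
move=> hA d0 gap.
have d2 : 0 < delta / 2 by rewrite divr_gt0.
(* The shift by [e = ± delta/2] has a gap of radius [delta/2] that just misses 0. Expanding
   [|(A - e) u|^2 >= e^2 |u|^2] cancels the terms in [e^2]. *)
have form e : `|e| = delta / 2 ->
    forall u, fsupp u -> 2 * e * dot u (A u) <= dot (A u) (A u).
  move=> he u fu.
  have := @spectral_gap (shiftr A e) (delta / 2) (sym_local_shiftr e hA) d2 _ u fu.
  rewrite dot_shiftr// -[e ^+ 2]real_normK ?num_real// he => h.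
  suff /h : forall c, `|c| < delta / 2 -> bdd_below (shiftr (shiftr A e) c) by lra.
  move=> c cd; have [k k0 hk] : bdd_below (shiftr A (e + c)).
    apply: gap; apply/andP; split.
      rewrite normr_gt0 addr_eq0; apply/eqP => ec; move: cd.
      by rewrite -he ec normrN ltxx.
    by rewrite (splitr delta); apply: le_lt_trans (ler_normD _ _) _; rewrite he ltrD2l.
  by exists k => // z fz; rewrite !shiftrD; exact: hk.
move=> x fx; have fA := fsupp_of hA fx; have fAA := fsupp_of hA fA.
(* The scale [1/delta] balances the two sides: adding the bounds for [x + A x / delta] and
   [x - A x / delta] yields [4 |A x|^2 <= 2 |A x|^2 + 2 |A A x|^2 / delta^2]. *)
have fs := fsuppZ delta^-1 fA; have fsA := fsuppZ delta^-1 fAA.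
have h1 := form (delta / 2) (gtr0_norm d2) _ (fsuppD fx fs).
have h2 : 2 * (- (delta / 2)) * _ <= _ :=
  form (- (delta / 2)) (etrans (normrN _) (gtr0_norm d2)) _ (fsuppB fx fs).
move: h1 h2.
rewrite (sym_localD hA) (sym_localB hA) (sym_localZ hA).
rewrite dot_expand_add// dot_expand_sub//.
rewrite (dotDr (x := x \+ _)); last exact: fsuppD.
rewrite (dotBr (x := x \- _)); last exact: fsuppB.
rewrite !dotBl// !dotDl// !dotZr// !dotZl -(sym_of hA (A x) fx).
move=> h1 h2.
have di : delta != 0 by exact: lt0r_neq0.
have {h1 h2} : 2 * delta * (delta^-1 * dot (A x) (A x)) <=
    dot (A x) (A x) + delta^-1 * (delta^-1 * dot (A (A x)) (A (A x))).
  move: h1 h2; lra.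
rewrite -(ler_pM2l (_ : 0 < delta ^+ 2)) ?exprn_gt0//.
have -> : delta ^+ 2 * (2 * delta * (delta^-1 * dot (A x) (A x))) =
  2 * (delta ^+ 2 * dot (A x) (A x)) by field.
have -> : delta ^+ 2 * (dot (A x) (A x) +
    delta^-1 * (delta^-1 * dot (A (A x)) (A (A x)))) =
  delta ^+ 2 * dot (A x) (A x) + dot (A (A x)) (A (A x)) by field.
lra.
Qed.

Definition l2 x := exists a : R, norm_le x a.

(** The equation [A g = A f] is solved by Richardson iteration for [A^2]. Its residuals [r n] stay
    in the range of [A], where the hypothesis makes [A^2] coercive. The corrections [t A (r n)] sum
    to a [g] of norm at most a multiple of [a], and [k = f - g] lies in the kernel. *)
Lemma split_kernel A (delta : R) : sym_local A -> 0 < delta ->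
  (forall x, fsupp x -> delta ^+ 2 * dot (A x) (A x) <= dot (A (A x)) (A (A x))) ->
  exists2 C, 0 <= C & forall f a, fsupp f -> norm_le (A f) a ->
    exists k, [/\ l2 k, A k = (fun=> 0) & norm_le (f \- k) (C * a)].
Proof.
move=> hA d0 Ad; have hS := sym_local_comp hA.
have d20 : 0 < delta ^+ 2 by rewrite exprn_gt0.
have [t t0 [theta th hK]] := richardson_contracts hS d20.
have [M M0 AM] := bound_of hA.
have /andP[th0 th1] := th.
pose K x := x \- (t \*o A (A x)).
have AK n f : iter n K (A f) = A (iter n K f).
  elim: n => //= n ->; rewrite /K (sym_localB hA) (sym_localZ hA) //.
have fK n f : fsupp f -> fsupp (iter n K f).
  move=> ff; elim: n => //= n IH; apply: fsuppB => //.
  by apply: fsuppZ; exact: (fsupp_of hS IH).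
exists (t * M / (1 - theta)).
  by rewrite divr_ge0 ?mulr_ge0 ?subr_ge0 ?ltW.
move=> f a ff fa; pose r n := iter n K (A f).
have frn n : fsupp (r n) by apply: fK; exact: (fsupp_of hA).
have rn n : norm_le (r n) (theta ^+ n * a).
  have a0 : 0 <= a by have [] := fa.
  elim: n => [|n IH]; first by rewrite expr0 mul1r.
  apply/norm_le_fsupp => //; first by rewrite mulr_ge0 ?exprn_ge0.
  have -> : (theta ^+ n.+1 * a) ^+ 2 = theta ^+ 2 * (theta ^+ n * a) ^+ 2.
    by rewrite [theta ^+ n.+1]exprS -mulrA exprMn.
  apply: le_trans (hK _ (frn n) _) _.
    rewrite -(sym_of hA)//; rewrite /r AK; apply: Ad; exact: fK.
  rewrite ler_wpM2l ?sqr_ge0//; apply/norm_le_fsupp => //.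
  by rewrite mulr_ge0 ?exprn_ge0.
have un n : norm_le (t \*o A (r n)) (theta ^+ n * (t * M * a)).
  have := norm_leZ t (sym_local_norm_le hA (ltW M0) AM (rn n)).
  by rewrite gtr0_norm//; congr norm_le; ring.
have [g ga cg] := norm_le_series th un.
have Ag : A g = A f.
  apply/funext => v; have c1 := sym_local_cvg (v := v) hA cg.
  have Sp n : A (fun u => \sum_(k < n) t * A (r k) u) v = A f v - r n v.
    elim: n => [|n IH].
      under eq_fun do rewrite big_ord0.
      by rewrite (sym_local0 hA) /= subrr.
    have -> : r n.+1 v = r n v - t * A (A (r n)) v by [].
    under eq_fun do rewrite big_ord_recr.
    rewrite (sym_localD hA (fun u => \sum_(k < n) t * A (r k) u) (t \*o A (r n))) /=.
    rewrite IH (sym_localZ hA) /=; ring.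
  apply: (cvg_unique _ c1) => //.
  have -> : (fun n => A (fun u => \sum_(k < n) (t \*o A (r k)) u) v) =
    fun n => A f v - r n v by apply/funext => n; exact: Sp.
  suff K0 : r ^~ v @ \oo --> (0 : R).
    by have := cvgB (cvg_cst (A f v)) K0; rewrite subr0; apply.
  apply/norm_cvg0P; apply: (squeeze_cvgr (f := fun=> 0) (h := geometric a theta)).
  - near=> n; rewrite normr_ge0 /= mulrC; exact: norm_le_abs (rn n).
  - exact: cvg_cst.
  - by apply: cvg_geometric; rewrite ger0_norm.
exists (f \- g); split.
- exists (Num.sqrt (dot f f) + t * M * a / (1 - theta)).
  by apply: norm_leB => //; exact: norm_le_sqrt_dot.
- by rewrite (sym_localB hA) Ag; apply/funext => v /=; rewrite subrr.
- have -> : f \- (f \- g) = g by apply/funext => v /=; rewrite opprB addrC subrK.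
  by rewrite mulrAC.
Unshelve. all: by end_near. Qed.

Lemma cvg_of_cauchy (u : nat -> R) D :
  (forall n m, `|u n - u m| <= D / n.+1%:R + D / m.+1%:R) -> cvgn u.
Proof.
move=> uD; apply: cauchy_cvg; apply/cauchy_ballP => e e0.
have DO : (fun n => D / n.+1%:R) @ \oo --> (0 : R).
  by have := cvgM (cvg_cst D) (@cvg_harmonic R); rewrite mulr0; apply.
have [N _ NP] : \forall n \near \oo, D / n.+1%:R < e / 2.
  by apply: (cvgr_lt _ DO); rewrite divr_gt0.
pose B := u @` [set n | (N <= n)%N]; exists (B, B) => /=.
  by split; exists N => // n Nn; exists n.
move=> [_ _] /= [[n nN <-] [m mN <-]]; apply: le_lt_trans (uD n m) _.
by rewrite (splitr e); apply: ltrD; exact: NP.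
Qed.

(* Induction on the list [F1] of coordinates that control [x] modulo [A x]:
   either some kernel element allows to normalise the first of them to zero, or
   a compactness argument shows that this coordinate is superfluous. *)
Lemma split_kernel_mod_finite A : sym_local A -> forall (F1 F0 : seq V),
  (exists2 C, 0 <= C & forall x a, l2 x -> (forall v, v \in F0 -> x v = 0) ->
     norm_le (A x) a -> norm_le x (C * (a + \sum_(i <- F1) `|x i|))) ->
  exists2 C, 0 <= C & forall x a, l2 x -> (forall v, v \in F0 -> x v = 0) ->
     norm_le (A x) a ->
     exists k, [/\ l2 k, A k = (fun=> 0) & norm_le (x \- k) (C * a)].
Proof.
move=> hA; elim=> [|i0 F1 IH] F0 [C C0 HC].
  exists C => // x a lx xF xa; exists (fun=> 0); split.
  - by exists 0; exact: norm_le_zero.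
  - exact: sym_local0.
  - have -> : x \- (fun=> 0) = x by apply/funext => v /=; rewrite subr0.
    by have := HC _ _ lx xF xa; rewrite big_nil addr0.
have [[k [lk Ak kF ki]]|nok] := pselect (exists k,
    [/\ l2 k, A k = (fun=> 0), (forall v, v \in F0 -> k v = 0) & k i0 = 1]).
  (* Subtracting [x i0] times [k] makes the coordinate [i0] vanish, so [i0] moves from the
     controlling list to the list of zeros. *)
  have [|C1 C10 HC1] := IH (i0 :: F0).
    exists C => // x a lx xF xa.
    have := HC x a lx _ xa; rewrite big_cons (xF i0) ?mem_head// normr0 add0r.
    by apply=> v vF; apply: xF; rewrite inE vF orbT.
  exists C1 => // x a lx xF xa; have lxk : l2 (x i0 \*o k).
    by have [b kb] := lk; exists (`|x i0| * b); exact: norm_leZ.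
  have [|||k' [lk' Ak' xk']] := HC1 (x \- (x i0 \*o k)) a.
  - have [b xb] := lx; have [b' kb] := lxk; exists (b + b'); exact: norm_leB.
  - move=> v; rewrite inE => /predU1P[->|vF] /=; first by rewrite ki mulr1 subrr.
    by rewrite xF// kF// mulr0 subr0.
  - rewrite (sym_localB hA) (sym_localZ hA) Ak.
    by congr norm_le : xa; apply/funext => v /=; rewrite mulr0 subr0.
  exists ((x i0 \*o k) \+ k'); split.
  - have [b kb] := lxk; have [b' kb'] := lk'; exists (b + b'); exact: norm_leD.
  - rewrite (sym_localD hA) (sym_localZ hA) Ak Ak'.
    by apply/funext => v /=; rewrite mulr0 addr0.
  - by congr norm_le : xk'; apply/funext => v /=; rewrite opprD addrA.
apply: IH; apply: contrapT => noC; apply: nok.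
(* If [i0] were needed, the constants [n + 1 + C] would all fail. Divided by their value at [i0],
   the failing functions become [z n] with value 1 there and all other control at most
   [C / (n + 1)]. By [HC] they are Cauchy, and their limit is the kernel function excluded by the
   case at hand. *)
have step n : exists z, [/\ l2 z, (forall v, v \in F0 -> z v = 0), z i0 = 1 &
    exists2 a, norm_le (A z) a & a + \sum_(i <- F1) `|z i| <= C / n.+1%:R].
  have : ~ (forall x a, l2 x -> (forall v, v \in F0 -> x v = 0) ->
     norm_le (A x) a -> norm_le x ((n.+1%:R + C) * (a + \sum_(i <- F1) `|x i|))).
    by move=> h; apply: noC; exists (n.+1%:R + C) => //; rewrite addr_ge0.
  move=> /existsNP[x /existsNP[a /not_implyP[lx /not_implyP[xF /not_implyP[xa nx]]]]].
  set e := a + _ in nx.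
  have Cx := HC _ _ lx xF xa; rewrite big_cons addrCA -/e in Cx.
  have ne : n.+1%:R * e < C * `|x i0|.
    rewrite ltNge; apply/negP => h; apply: nx; apply: norm_leW Cx _.
    by rewrite mulrDr [in leRHS]mulrDl lerD2r.
  have e0 : 0 <= e by rewrite addr_ge0 ?sumr_ge0//; have [] := xa.
  have xi0 : x i0 != 0.
    apply/eqP => xi; move: ne; rewrite xi normr0 mulr0 ltNge => /negP; apply.
    by rewrite mulr_ge0.
  exists ((x i0)^-1 \*o x); split.
  - by have [b xb] := lx; exists (`|(x i0)^-1| * b); exact: norm_leZ.
  - by move=> v vF /=; rewrite (xF v vF) mulr0.
  - by rewrite /= mulVf.
  - exists (`|(x i0)^-1| * a).
      by rewrite (sym_localZ hA); exact: norm_leZ.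
    under eq_bigr do rewrite /= normrM.
    rewrite -mulr_sumr -mulrDr -/e normrV ?unitfE// mulrC ler_pdivrMr ?normr_gt0//.
    by rewrite mulrAC ler_pdivlMr// mulrC ltW.
have [z hz] := choice step.
have zd n m : norm_le (z n \- z m) (C * (C / n.+1%:R + C / m.+1%:R)).
  have [[bn ln] nF ni [an na en]] := hz n; have [[bm lm] mF mi [am ma em]] := hz m.
  have lnm : l2 (z n \- z m) by exists (bn + bm); exact: norm_leB.
  have := HC (z n \- z m) (an + am) lnm.
  rewrite big_cons /= ni mi subrr normr0 add0r (sym_localB hA) => h.
  apply: norm_leW (h _ _) _.
  - by move=> v vF; rewrite nF// mF// subr0.
  - exact: norm_leB.
  - rewrite ler_wpM2l//; apply: le_trans _ (lerD en em).
    rewrite [leRHS]addrACA lerD2l -big_split /=; apply: ler_sum => i _.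
    exact: ler_normB.
have zc v : cvgn (fun n => z n v).
  apply: (@cvg_of_cauchy _ (C * C)) => n m; apply: le_trans (norm_le_abs v (zd n m)) _.
  by rewrite mulrDr !mulrA.
pose l v := lim ((fun n => z n v) @ \oo).
have zl v : z ^~ v @ \oo --> l v by exact: zc.
exists l; split.
- have [[b0 l0] _ _ _] := hz 0%N; exists (C * (C + C) + b0).
  apply: (norm_le_lim (p := z)) => // n.
  have -> : z n = (z n \- z 0%N) \+ z 0%N by apply/funext => v /=; rewrite subrK.
  apply: norm_leD l0; apply: norm_leW (zd n 0%N) _.
  rewrite ler_wpM2l// divr1 lerD2r ler_pdivrMr// ler_peMr//.
  by rewrite ler1n.
- apply/funext => v; have c1 := sym_local_cvg (v := v) hA zl.
  apply: (cvg_unique _ c1) => //.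
  apply/norm_cvg0P; apply: (squeeze_cvgr (f := fun=> 0) (h := fun n => C / n.+1%:R)).
  + near=> n; rewrite normr_ge0 /=; have [_ _ _ [a na ea]] := hz n.
    apply: le_trans (norm_le_abs v na) _; apply: le_trans ea.
    by rewrite lerDl sumr_ge0.
  + exact: cvg_cst.
  + by have := cvgM (cvg_cst C) (@cvg_harmonic R); rewrite mulr0; apply.
- move=> v vF; apply: (cvg_unique _ (zl v)) => //.
  have -> : z ^~ v = fun=> 0 by apply/funext => n; have [_ zF _ _] := hz n; exact: zF.
  exact: cvg_cst.
- apply: (cvg_unique _ (zl i0)) => //.
  have -> : z ^~ i0 = fun=> 1 by apply/funext => n; have [_ _ ->] := hz n.
  exact: cvg_cst.
Unshelve. all: by end_near. Qed.

End SpectralGap.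

(** * Schrödinger operators and their spectra *)

Section HopOperator.
Variables (R : realType) (V : choiceType) (nb : V -> seq V) (d : nat).
Hypotheses (nb_uniq : forall v, uniq (nb v))
  (nb_sym : forall u v, (u \in nb v) = (v \in nb u))
  (nb_size : forall v, (size (nb v) <= d)%N).
Implicit Types (x y : V -> R) (w : V -> R).

(** Adjacency operator plus multiplication by [w]. With [w] the potential minus the degree it is a
    Schrödinger operator, and shifting by a scalar only changes [w]. *)
Definition hop w x : V -> R := fun v => \sum_(u <- nb v) x u + w v * x v.

Lemma sum_nb_supp (z : V -> R) (s : seq V) v : uniq s ->
  (forall u, u \notin s -> z u = 0) ->
  \sum_(u <- nb v) z u = \sum_(u <- s | u \in nb v) z u.
Proof.
move=> us sz; rewrite [LHS](bigID (mem s)) /= [X in _ + X]big1 ?addr0//.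
rewrite -[LHS]big_filter -[RHS]big_filter; apply: perm_big.
apply: uniq_perm; rewrite ?filter_uniq// => u.
by rewrite !mem_filter /= andbC.
Qed.

Lemma hop_fsupp w x : fsupp x -> fsupp (hop w x).
Proof.
move=> [s sx]; exists (s ++ flatten [seq nb u | u <- s]) => v.
rewrite mem_cat negb_or => /andP[vs /flatten_mapP nv].
rewrite /hop sx// mulr0 addr0 big1_seq// => u /= uv.
by apply: sx; apply/negP => us; apply: nv; exists u => //; rewrite nb_sym.
Qed.

Lemma hop_sym w x y : fsupp x -> dot (hop w x) y = dot x (hop w y).
Proof.
move=> fx; have [s us sx] := fsupp_uniq fx.
pose r := undup (s ++ flatten [seq nb u | u <- s]).
have rx v : v \notin r -> v \notin s /\ forall u, u \in nb v -> u \notin s.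
  rewrite mem_undup mem_cat negb_or => /andP[vs /flatten_mapP nv]; split=> // u uv.
  by apply/negP => us'; apply: nv; exists u => //; rewrite nb_sym.
have ur : uniq r by exact: undup_uniq.
rewrite (dotE _ ur); last first.
  move=> v /rx[vs nv]; rewrite /hop sx// mulr0 addr0 big1_seq// => u /= /nv.
  exact: sx.
rewrite (dotE _ ur); last by move=> v /rx[/sx].
under eq_bigr do rewrite /hop mulrDl.
under [RHS]eq_bigr do rewrite /hop mulrDr.
rewrite !big_split /=; congr (_ + _); last by apply: eq_bigr => v _; ring.
have sum_nb (z : V -> R) v : {subset nb v <= r} ->
    \sum_(u <- nb v) z u = \sum_(u <- r | u \in nb v) z u.
  move=> nr; rewrite -[RHS]big_filter; apply: perm_big; apply: uniq_perm => //.
    by rewrite filter_uniq.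
  by move=> u; rewrite mem_filter; case uv : (u \in nb v) => //=; rewrite nr.
transitivity (\sum_(v <- r) \sum_(u <- r | u \in nb v) x u * y v).
  apply: eq_bigr => v _; rewrite mulr_suml; apply: sum_nb_supp => // u /rx[/sx -> _].
  by rewrite mul0r.
rewrite (exchange_big_dep xpredT) //=; apply: eq_big_seq => u ur'.
have [us'|us'] := boolP (u \in s); last first.
  by rewrite (sx _ us') mul0r big1// => v _; rewrite mul0r.
rewrite sum_nb ?mulr_sumr.
  by apply: eq_bigl => v; rewrite nb_sym.
move=> v vu; rewrite mem_undup mem_cat; apply/orP; right.
by apply/flatten_mapP; exists u.
Qed.

Lemma sqr_sum_le (I : Type) (s : seq I) (z : I -> R) :
  (\sum_(i <- s) z i) ^+ 2 <= (size s)%:R * \sum_(i <- s) z i ^+ 2.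
Proof.
elim: s => [|i s IH]; first by rewrite !big_nil expr0n mul0r.
rewrite !big_cons /=; set a := \sum_(j <- s) z j in IH *.
set b := \sum_(j <- s) z j ^+ 2 in IH *; set n := size s in IH *.
have [n0|n0] := posnP n.
  have s0 : s = [::] by apply/size0nil.
  by rewrite /a /b s0 !big_nil !addr0 n0 mul1r.
have np : 0 < n%:R :> R by rewrite ltr0n.
have h : 2 * (z i * a) <= n%:R * z i ^+ 2 + b.
  rewrite -(ler_pM2l np) mulrDr.
  apply: le_trans (lerD (lexx _) IH).
  rewrite -subr_ge0 (_ : _ - _ = (n%:R * z i - a) ^+ 2) ?sqr_ge0//; ring.
by rewrite -natr1; lra.
Qed.

Lemma hop_bound w M x : (forall v, `|w v| <= M) -> fsupp x ->
  dot (hop w x) (hop w x) <= 2 * ((d * d)%:R + M ^+ 2) * dot x x.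
Proof.
move=> wM fx; have [s us sx] := fsupp_uniq (hop_fsupp w fx).
rewrite (dotE _ us sx); under eq_bigr do rewrite -expr2.
have pt v : hop w x v ^+ 2 <=
    2 * (d%:R * \sum_(u <- nb v) x u ^+ 2) + 2 * (M ^+ 2 * x v ^+ 2).
  have h1 : (\sum_(u <- nb v) x u) ^+ 2 <= d%:R * \sum_(u <- nb v) x u ^+ 2.
    apply: le_trans (sqr_sum_le _ _) _; rewrite ler_wpM2r ?ler_nat//.
    by rewrite sumr_ge0// => u _; rewrite sqr_ge0.
  have h2 : (w v * x v) ^+ 2 <= M ^+ 2 * x v ^+ 2.
    rewrite exprMn ler_wpM2r ?sqr_ge0// -[w v ^+ 2]real_normK ?num_real//.
    by rewrite lerXn2r// nnegrE (le_trans _ (wM v)).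
  rewrite /hop; set a := \sum_(u <- nb v) x u in h1 *; set b := w v * x v in h2 *.
  have : (a + b) ^+ 2 <= 2 * a ^+ 2 + 2 * b ^+ 2.
    by rewrite -subr_ge0 (_ : _ - _ = (a - b) ^+ 2) ?sqr_ge0//; ring.
  lra.
apply: le_trans (ler_sum _ (fun v _ => pt v)) _.
rewrite big_split /= -!mulr_sumr.
have h3 : \sum_(v <- s) x v ^+ 2 <= dot x x by exact: sumsq_le_dot.
have h4 : \sum_(v <- s) \sum_(u <- nb v) x u ^+ 2 <= d%:R * dot x x.
  have [t ut tx] := fsupp_uniq fx.
  rewrite (dotE _ ut tx) mulr_sumr.
  have -> : \sum_(v <- s) \sum_(u <- nb v) x u ^+ 2 =
      \sum_(v <- s) \sum_(u <- t | u \in nb v) x u ^+ 2.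
    by apply: eq_bigr => v _; apply: sum_nb_supp => // u /tx ->; rewrite expr0n.
  rewrite (exchange_big_dep xpredT) //=; apply: ler_sum => u _.
  rewrite -big_filter big_const_seq count_predT iter_addr_0 -expr2 -[leLHS]mulr_natl.
  rewrite ler_wpM2r ?sqr_ge0// ler_nat; apply: leq_trans (nb_size u).
  apply: uniq_leq_size; first by rewrite filter_uniq.
  by move=> v; rewrite mem_filter nb_sym => /andP[].
rewrite natrM.
have := @ler_wpM2l _ d%:R (ler0n _ _) _ _ h4.
have := @ler_wpM2l _ (M ^+ 2) (sqr_ge0 _) _ _ h3.
lra.
Qed.

Lemma sym_local_hop w M : (forall v, `|w v| <= M) -> sym_local (hop w).
Proof.
move=> wM; split.
- move=> v; exists ((v, w v) :: [seq (u, 1) | u <- nb v]) => x.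
  rewrite big_cons big_map /= addrC; congr (_ + _).
  by apply: eq_bigr => u _; rewrite mul1r.
- exact: hop_fsupp.
- by move=> x y; exact: hop_sym.
(* The bound is required as a square; [K <= (K + 1)^2] avoids a square root. *)
- exists (2 * ((d * d)%:R + M ^+ 2) + 1).
    by rewrite ltr_wpDl// mulr_ge0// addr_ge0 ?sqr_ge0.
  move=> x fx; apply: le_trans (hop_bound wM fx) _.
  rewrite ler_wpM2r ?dot_ge0//; set K := 2 * _.
  have K0 : 0 <= K by rewrite mulr_ge0// addr_ge0 ?sqr_ge0.
  have -> : (K + 1) ^+ 2 = K + (K ^+ 2 + K + 1) by ring.
  by rewrite lerDl !addr_ge0 ?sqr_ge0.
Qed.

Lemma shiftr_hop w a : shiftr (hop w) a = hop (fun v => w v - a).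
Proof.
by apply/funext => x; apply/funext => v; rewrite /shiftr /hop /=; ring.
Qed.

End HopOperator.

(** * Complex functions as pairs of real functions *)

Section ComplexParts.
Variables (R : realType) (V : choiceType).
Local Notation C := R[i].
Implicit Types (psi phi : V -> C) (x y : V -> R).

Definition rpart psi : V -> R := fun v => complex.Re (psi v).
Definition ipart psi : V -> R := fun v => complex.Im (psi v).
Definition cplx x y : V -> C := fun v => (x v +i* y v)%C.

Lemma cplxE psi : psi = cplx (rpart psi) (ipart psi).
Proof. by apply/funext => v; rewrite /cplx /rpart /ipart; case: (psi v). Qed.

Lemma RecD (a b : C) : complex.Re (a + b) = complex.Re a + complex.Re b.
Proof. by case: a b => [? ?] [? ?]. Qed.

Lemma ImcD (a b : C) : complex.Im (a + b) = complex.Im a + complex.Im b.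
Proof. by case: a b => [? ?] [? ?]. Qed.

Lemma RecB (a b : C) : complex.Re (a - b) = complex.Re a - complex.Re b.
Proof. by case: a b => [? ?] [? ?]. Qed.

Lemma ImcB (a b : C) : complex.Im (a - b) = complex.Im a - complex.Im b.
Proof. by case: a b => [? ?] [? ?]. Qed.

Lemma RecM (a b : C) : complex.Re (a * b) =
  complex.Re a * complex.Re b - complex.Im a * complex.Im b.
Proof. by case: a b => [? ?] [? ?]. Qed.

Lemma ImcM (a b : C) : complex.Im (a * b) =
  complex.Re a * complex.Im b + complex.Im a * complex.Re b.
Proof. by case: a b => [? ?] [? ?]. Qed.

Lemma Rec_sum (I : Type) (s : seq I) (F : I -> C) :
  complex.Re (\sum_(i <- s) F i) = \sum_(i <- s) complex.Re (F i).
Proof. by elim/big_ind2: _ => // a b c e <- <-; rewrite RecD. Qed.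

Lemma Imc_sum (I : Type) (s : seq I) (F : I -> C) :
  complex.Im (\sum_(i <- s) F i) = \sum_(i <- s) complex.Im (F i).
Proof. by elim/big_ind2: _ => // a b c e <- <-; rewrite ImcD. Qed.

Lemma eq_cplx psi phi : rpart psi = rpart phi -> ipart psi = ipart phi -> psi = phi.
Proof. by move=> hr hi; rewrite (cplxE psi) (cplxE phi) hr hi. Qed.

Lemma normc2E psi v : normc2 psi v = (rpart psi v ^+ 2 + ipart psi v ^+ 2)%:E.
Proof.
rewrite /normc2 /rpart /ipart; case: (psi v) => a b /=.
by rewrite sqr_sqrtr// addr_ge0 ?sqr_ge0.
Qed.

Lemma normc2_ge0 psi v : (0 <= normc2 psi v)%E.
Proof. by rewrite normc2E lee_fin addr_ge0 ?sqr_ge0. Qed.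

Lemma ell2E psi : ell2 psi -> \esum_(v in [set: V]) normc2 psi v \is a fin_num.
Proof.
rewrite /ell2 /= summableE; congr (_ \is a fin_num).
by apply: eq_esum => v _; rewrite gee0_abs ?normc2_ge0.
Qed.

Lemma ell2_norm_ge0 psi : 0 <= ell2_norm psi.
Proof. exact: sqrtr_ge0. Qed.

Lemma sumsq_le_ell2_norm psi s : ell2 psi -> uniq s ->
  \sum_(v <- s) (rpart psi v ^+ 2 + ipart psi v ^+ 2) <= ell2_norm psi ^+ 2.
Proof.
move=> /ell2E fin us; have e0 : (0 <= \esum_(v in [set: V]) normc2 psi v)%E.
  by apply: esum_ge0 => v _; exact: normc2_ge0.
rewrite /ell2_norm sqr_sqrtr ?fine_ge0// -lee_fin fineK//.
apply: esum_ge; exists [set` s]; first by split=> //; exact: finite_seq.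
rewrite -fsbig_seq// -sumEFin le_eqVlt; apply/orP; left; apply/eqP.
by apply: eq_bigr => v _; rewrite normc2E.
Qed.

Lemma norm_le_rpart psi : ell2 psi -> norm_le (rpart psi) (ell2_norm psi).
Proof.
move=> e; split=> [|s us]; first exact: ell2_norm_ge0.
apply: le_trans (sumsq_le_ell2_norm e us); apply: ler_sum => v _.
by rewrite lerDl sqr_ge0.
Qed.

Lemma norm_le_ipart psi : ell2 psi -> norm_le (ipart psi) (ell2_norm psi).
Proof.
move=> e; split=> [|s us]; first exact: ell2_norm_ge0.
apply: le_trans (sumsq_le_ell2_norm e us); apply: ler_sum => v _.
by rewrite lerDr sqr_ge0.
Qed.

Lemma ell2_of_norm_le psi a b :
  norm_le (rpart psi) a -> norm_le (ipart psi) b ->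
  ell2 psi /\ ell2_norm psi <= a + b.
Proof.
move=> [a0 ra] [b0 ib].
have ub : (\esum_(v in [set: V]) normc2 psi v <= (a ^+ 2 + b ^+ 2)%:E)%E.
  apply: ge_ereal_sup => _ [F [finF _] <-].
  rewrite fsbig_finite//= (eq_bigr (fun v => (rpart psi v ^+ 2 + ipart psi v ^+ 2)%:E)).
    by rewrite sumEFin lee_fin big_split /= lerD ?ra ?ib.
  by move=> v _; rewrite normc2E.
have e0 : (0 <= \esum_(v in [set: V]) normc2 psi v)%E.
  by apply: esum_ge0 => v _; exact: normc2_ge0.
have fin : \esum_(v in [set: V]) normc2 psi v \is a fin_num.
  by rewrite ge0_fin_numE//; apply: le_lt_trans ub _; rewrite ltry.
split.
  rewrite /ell2 /= summableE; congr (_ \is a fin_num) : fin.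
  by apply: eq_esum => v _; rewrite gee0_abs ?normc2_ge0.
rewrite /ell2_norm -(@ler_pXn2r _ 2)// ?nnegrE ?sqrtr_ge0 ?addr_ge0//.
rewrite sqr_sqrtr ?fine_ge0//; apply: (@le_trans _ _ (a ^+ 2 + b ^+ 2)).
  by rewrite -lee_fin fineK.
rewrite -subr_ge0 (_ : _ - _ = 2 * (a * b)); last by ring.
by rewrite !mulr_ge0.
Qed.

Lemma ell2_cplx x y : l2 x -> l2 y -> ell2 (cplx x y).
Proof. by move=> [a xa] [b yb]; have [] := @ell2_of_norm_le (cplx x y) a b xa yb. Qed.

Lemma ell2_l2 psi : ell2 psi -> l2 (rpart psi) /\ l2 (ipart psi).
Proof.
by move=> e; split; exists (ell2_norm psi); [exact: norm_le_rpart|exact: norm_le_ipart].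
Qed.

Lemma ell2_norm_real x : fsupp x -> ell2_norm (cplx x (fun=> 0)) = Num.sqrt (dot x x).
Proof.
move=> fx; apply/eqP; rewrite eq_le; apply/andP; split.
  have [_] := @ell2_of_norm_le (cplx x (fun=> 0)) _ 0 (norm_le_sqrt_dot fx)
    (norm_le_zero _ (lexx 0)).
  by rewrite addr0.
have [s us sx] := fsupp_uniq fx.
rewrite -(@ler_pXn2r _ 2)// ?nnegrE ?sqrtr_ge0//.
rewrite sqr_sqrtr ?dot_ge0// (dotE _ us sx).
have e : ell2 (cplx x (fun=> 0)).
  by apply: ell2_cplx; [exists (Num.sqrt (dot x x)); exact: norm_le_sqrt_dot|
     exists 0; exact: norm_le_zero].
have [_ h] := norm_le_rpart e; under eq_bigr do rewrite -expr2; exact: h.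
Qed.

End ComplexParts.

(** * The real operator underlying a Schrödinger operator *)

Section SchrodingerParts.
Variables (R : realType) (G : graph) (hG : bounded_degree G).
Variable H : schrodinger_operator R G.
Implicit Types (psi : G -> R[i]) (x y : G -> R).

Definition nbs (v : G) : seq G := fset_set (neighbours v).

Lemma finite_neighbours v : finite_set (neighbours v : set G).
Proof. by have [d dP] := hG; apply: card_le_finite (dP v) (finite_II d). Qed.

Lemma mem_nbs u v : (u \in nbs v) = adj v u.
Proof.
rewrite /nbs in_fset_set; last exact: finite_neighbours.
by apply/idP/idP; rewrite inE.
Qed.

Lemma nbs_uniq v : uniq (nbs v).
Proof. exact: fset_uniq. Qed.

Lemma nbs_sym u v : (u \in nbs v) = (v \in nbs u).
Proof. by rewrite !mem_nbs adj_sym. Qed.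

Lemma nbs_size : exists d, forall v, (size (nbs v) <= d)%N.
Proof. by have [d dP] := hG; exists d => v; exact: geq_card_fset_set. Qed.

Definition weight (v : G) : R := potential H v - (size (nbs v))%:R.

Definition real_op : (G -> R) -> G -> R := hop nbs weight.

Lemma weight_bounded : exists M, forall v, `|weight v| <= M.
Proof.
have [M HM] := potential_bounded H; have [d dP] := nbs_size.
exists (M + d%:R) => v; apply: le_trans (ler_normB _ _) _.
by rewrite lerD// normr_nat ler_nat.
Qed.

Lemma sym_local_real_op : sym_local real_op.
Proof.
have [M wM] := weight_bounded; have [d dP] := nbs_size.
by apply: (@sym_local_hop _ _ nbs d _ _ _ _ M) => //; [exact: nbs_uniq|exact: nbs_sym].
Qed.

Lemma schrodingerE psi v : H psi v = \sum_(u <- nbs v) psi u + (weight v)%:C%C * psi v.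
Proof.
rewrite /schrodinger_apply fsbig_finite; last exact: finite_neighbours.
rewrite sumrB /weight -[fset_set _ : seq _]/(nbs v).
rewrite big_const_seq count_predT iter_addr_0 rmorphB /= mulrBl rmorph_nat mulr_natl.
ring.
Qed.

Lemma rpart_schrodinger psi : rpart (H psi) = real_op (rpart psi).
Proof.
apply/funext => v; rewrite /rpart schrodingerE RecD Rec_sum RecM /=.
by rewrite mul0r subr0.
Qed.

Lemma ipart_schrodinger psi : ipart (H psi) = real_op (ipart psi).
Proof.
apply/funext => v; rewrite /ipart schrodingerE ImcD Imc_sum ImcM /=.
by rewrite mul0r addr0.
Qed.

End SchrodingerParts.

(** * Lower bounds modulo finitely many coordinates *)

Section RealSpectralLemmas.
Variables (R : realType) (V : choiceType).
Implicit Types (x y z k : V -> R) (s F : seq V) (A : (V -> R) -> V -> R).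

(** Weyl's criterion for 0: avoiding every finite set plays the role of weak convergence to 0 in a
    singular sequence. *)
Definition far_approx A := forall (c : R) F, 0 < c ->
  exists x, [/\ fsupp x, (forall v, v \in F -> x v = 0)
    & dot (A x) (A x) < c * dot x x].

Lemma far_approx_not_bdd_below A : far_approx A -> ~ bdd_below A.
Proof.
move=> hA [c c0 cA]; have [x [fx _]] := hA c [::] c0.
by rewrite ltNge cA.
Qed.

Lemma norm_le_inf x (a K : R) : 0 <= a ->
  (forall e, 0 < e -> norm_le x (a + K * e)) -> norm_le x a.
Proof.
move=> a0 h; split=> // s us.
rewrite -(sqr_sqrtr (_ : 0 <= \sum_(v <- s) x v ^+ 2)).
  rewrite ler_pXn2r// ?nnegrE ?sqrtr_ge0//.
  have K0 : 0 < `|K| + 1 by rewrite ltr_wpDl.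
  apply/ler_addgt0Pr => e e0; have e1 : 0 < e / (`|K| + 1) by exact: divr_gt0.
  have [b0 /(_ _ us) hs] := h _ e1.
  rewrite -[leRHS]ger0_norm ?addr_ge0// ?(ltW e0)// -sqrtr_sqr ler_wsqrtr//.
  apply: le_trans hs _; rewrite ler_pXn2r// ?nnegrE ?addr_ge0 ?(ltW e0)// lerD2l.
  rewrite mulrCA ler_piMr ?(ltW e0)// ler_pdivrMr// mul1r.
  by rewrite (le_trans (ler_norm _))// lerDl.
by rewrite sumr_ge0// => v _; rewrite sqr_ge0.
Qed.

Lemma norm_le_tail x (a e : R) : norm_le x a -> 0 < e ->
  exists2 t, uniq t & norm_le (x \- cutoff t x) e.
Proof.
move=> [a0 xa] e0.
pose E := [set r : R | exists2 s, uniq s & r = \sum_(v <- s) x v ^+ 2].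
have supE : has_sup E.
  split; first by exists 0, [::]; rewrite ?big_nil.
  by exists (a ^+ 2) => _ [s us ->]; exact: xa.
have [_ [t ut ->] tE] := sup_adherent (exprn_gt0 2 e0) supE.
exists t => //; split=> [|s us]; first exact: ltW.
pose r := [seq v <- s | v \notin t].
have -> : \sum_(v <- s) (x \- cutoff t x) v ^+ 2 = \sum_(v <- r) x v ^+ 2.
  rewrite big_filter [LHS](bigID (mem t)) /= big1 ?add0r; last first.
    by move=> v vt; rewrite /cutoff vt subrr expr0n.
  by apply: eq_bigr => v /negbTE vt; rewrite /cutoff vt subr0.
have : E (\sum_(v <- t ++ r) x v ^+ 2).
  exists (t ++ r) => //; rewrite cat_uniq ut filter_uniq// andbT /=.
  by apply/hasPn => v; rewrite mem_filter => /andP[].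
move=> /(ub_le_sup supE.2); rewrite big_cat /= => h.
by move: tE h; lra.
Qed.

Lemma norm_le_cutoff_sum F x : norm_le (cutoff F x) (\sum_(i <- F) `|x i|).
Proof.
elim: F => [|i F IH].
  rewrite big_nil; have -> : cutoff [::] x = fun=> 0 by [].
  exact: norm_le_zero.
rewrite big_cons.
(* The list may contain repetitions; a repeated coordinate contributes nothing new. *)
pose e := if i \in F then (fun=> 0) else cutoff [:: i] x.
have -> : cutoff (i :: F) x = e \+ cutoff F x.
  apply/funext => v; rewrite /e /cutoff /= inE.
  have [->|vi] := eqVneq v i.
    by case: (boolP (i \in F)) => iF; rewrite /= ?inE ?eqxx ?add0r ?addr0.
  by case: (boolP (i \in F)) => iF; rewrite /= ?inE ?(negbTE vi) add0r.
apply: norm_leD IH; rewrite /e; case: ifP => _; first exact: norm_le_zero.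
apply/norm_le_fsupp; rewrite ?normr_ge0//; first exact: fsupp_cutoff.
by rewrite dot_cutoff// big_seq1 real_normK// num_real.
Qed.

Lemma sqrt_dot_le x (a : R) : fsupp x -> norm_le x a -> Num.sqrt (dot x x) <= a.
Proof.
move=> fx xa; have a0 : 0 <= a by case: xa.
rewrite -[leRHS]ger0_norm// -sqrtr_sqr ler_wsqrtr//.
exact/norm_le_fsupp.
Qed.

Lemma dot_le_norm y z (e : R) : fsupp y -> norm_le z e ->
  2 * dot y z <= dot y y + e ^+ 2.
Proof.
move=> fy [e0 ze]; have [s us sy] := fsupp_uniq fy.
rewrite !(dotE _ us sy); apply: le_trans (lerD (lexx _) (ze _ us)).
rewrite -big_split mulr_sumr; apply: ler_sum => v _ /=.
rewrite -subr_ge0 (_ : _ - _ = (y v - z v) ^+ 2) ?sqr_ge0//; ring.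
Qed.

Lemma norm_le_sum (I : Type) (r : seq I) (f : I -> V -> R) (a : I -> R) :
  (forall i, norm_le (f i) (a i)) ->
  norm_le (fun v => \sum_(i <- r) f i v) (\sum_(i <- r) a i).
Proof.
move=> fa; elim: r => [|i r IH].
  by under eq_fun do rewrite big_nil; rewrite big_nil; exact: norm_le_zero.
by under eq_fun do rewrite big_cons; rewrite big_cons; exact: norm_leD.
Qed.

(** Two truncations: cutting a small tail passes from finite support to square summable functions
    vanishing on [F]; then [x] minus its restriction to [F] is such a function, and applying [A] to
    that restriction costs at most [M] times the sum of the values on [F]. *)
Lemma lower_bound_l2 A (c : R) F : sym_local A -> 0 < c ->
  (forall x, fsupp x -> (forall v, v \in F -> x v = 0) ->
     c * dot x x <= dot (A x) (A x)) ->
  exists2 C, 0 <= C & forall x a, l2 x ->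
     norm_le (A x) a -> norm_le x (C * (a + \sum_(i <- F) `|x i|)).
Proof.
move=> hA c0 cA; have [M M0 AM] := sym_local_bounded hA.
pose q := Num.sqrt c^-1.
have q0 : 0 < q by rewrite sqrtr_gt0 invr_gt0.
have fin x a : fsupp x -> (forall v, v \in F -> x v = 0) ->
    norm_le (A x) a -> norm_le x (q * a).
  move=> fx xF xa; have a0 : 0 <= a by case: xa.
  apply/norm_le_fsupp => //; first by rewrite mulr_ge0// ltW.
  rewrite exprMn sqr_sqrtr; last by rewrite invr_ge0 ltW.
  rewrite -(ler_pM2l c0) mulrA mulfV ?gt_eqF//.
  rewrite mul1r; apply: le_trans (cA _ fx xF) _; apply/norm_le_fsupp => //.
  exact: (fsupp_of hA).
have vanish x a : l2 x -> (forall v, v \in F -> x v = 0) ->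
    norm_le (A x) a -> norm_le x (q * a).
  move=> [b xb] xF xa; have a0 : 0 <= a by case: xa.
  apply: (@norm_le_inf _ _ (q * M + 1)) => [|e e0]; first by rewrite mulr_ge0// ltW.
  have [t ut xt] := norm_le_tail xb e0.
  have -> : x = cutoff t x \+ (x \- cutoff t x).
    by apply/funext => v /=; rewrite addrC subrK.
  have -> : q * a + (q * M + 1) * e = q * (a + M * e) + e by ring.
  apply: norm_leD => //; apply: fin; first exact: fsupp_cutoff.
    by move=> v vF; rewrite /cutoff xF// if_same.
  have -> : cutoff t x = x \- (x \- cutoff t x).
    by apply/funext => v /=; rewrite opprB addrC subrK.
  by rewrite (sym_localB hA); apply: norm_leB => //; exact: AM.
exists (q + q * M + 1); first by rewrite !addr_ge0// ?mulr_ge0// ltW.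
move=> x a [b xb] xa; have a0 : 0 <= a by case: xa.
set S := \sum_(i <- F) `|x i|.
have S0 : 0 <= S by rewrite sumr_ge0.
have xF : norm_le (cutoff F x) S by exact: norm_le_cutoff_sum.
have -> : x = (x \- cutoff F x) \+ cutoff F x.
  by apply/funext => v /=; rewrite subrK.
have h : norm_le (x \- cutoff F x) (q * (a + M * S)).
  apply: vanish.
  - by exists (b + b); apply: norm_leB => //; exact: norm_le_cutoff.
  - by move=> v vF; rewrite /cutoff /= vF subrr.
  - by rewrite (sym_localB hA); apply: norm_leB => //; exact: AM.
apply: norm_leW (norm_leD h xF) _; rewrite -subr_ge0.
have -> : (q + q * M + 1) * (a + S) - (q * (a + M * S) + S) =
  q * M * a + a + q * S by ring.
by rewrite !addr_ge0// !mulr_ge0// ?ltW.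
Qed.

(** Apply the splitting to [A x] itself: by symmetry [A x] is orthogonal to the kernel function [k],
    so [|A x|^2 = <A x, A x - k>], where the second factor has norm at most [C |A A x|]. *)
Lemma range_lower A (C : R) : sym_local A -> 0 <= C ->
  (forall x a, l2 x -> norm_le (A x) a ->
     exists k, [/\ l2 k, A k = (fun=> 0) & norm_le (x \- k) (C * a)]) ->
  forall x, fsupp x -> dot (A x) (A x) <= C ^+ 2 * dot (A (A x)) (A (A x)).
Proof.
move=> hA C0 hC x fx; have fA := fsupp_of hA fx; have fAA := fsupp_of hA fA.
have lA : l2 (A x) by eexists; exact: norm_le_sqrt_dot.
have [k [lk Ak xk]] := hC _ _ lA (norm_le_sqrt_dot fAA).
have := dot_le_norm fA xk.
rewrite dotBr// exprMn sqr_sqrtr ?dot_ge0// (sym_of hA k fx) Ak.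
have -> : dot x (fun=> 0) = 0 by rewrite /dot fsbig1// => v _; rewrite mulr0.
lra.
Qed.

(** This isolates 0. With [z = (A - mu) x], the identity [A A x = A z + mu A x] and [C |mu| < 1]
    bound [A x] by a multiple of [z]; then [mu x = A x - z] bounds [x]. *)
Lemma shiftr_bdd_below_near0 A (C mu : R) : sym_local A -> 0 < C ->
  (forall x, fsupp x -> dot (A x) (A x) <= C ^+ 2 * dot (A (A x)) (A (A x))) ->
  0 < `|mu| -> C * `|mu| < 1 -> bdd_below (shiftr A mu).
Proof.
move=> hA C0 AC mu0 Cmu; have [M M0 AM] := sym_local_bounded hA.
pose K := (C * M / (1 - C * `|mu|) + 1) / `|mu|.
have d0 : 0 < 1 - C * `|mu| by rewrite subr_gt0.
have K0 : 0 < K by rewrite divr_gt0// ltr_wpDl// divr_ge0 ?mulr_ge0// ltW.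
exists (K ^+ 2)^-1; first by rewrite invr_gt0 exprn_gt0.
move=> x fx; have fA := fsupp_of hA fx; have fAA := fsupp_of hA fA.
have fz := fsupp_of (sym_local_shiftr mu hA) fx.
set z := shiftr A mu x in fz *.
pose N y := Num.sqrt (dot y y).
have Nz := norm_le_sqrt_dot fz.
have AAE : A (A x) = A z \+ (mu \*o A x).
  rewrite /z /shiftr (sym_localD hA) (sym_localZ hA).
  by apply/funext => v /=; rewrite mulNr subrK.
have h1 : N (A (A x)) <= M * N z + `|mu| * N (A x).
  apply: sqrt_dot_le => //; rewrite AAE; apply: norm_leD; first exact: AM.
  by apply: norm_leZ; exact: norm_le_sqrt_dot.
have h2 : N (A x) <= C * N (A (A x)).
  apply: sqrt_dot_le => //; apply/norm_le_fsupp => //.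
    by rewrite mulr_ge0 ?sqrtr_ge0// ltW.
  by rewrite exprMn sqr_sqrtr ?dot_ge0// AC.
have h3 : N (A x) <= C * M / (1 - C * `|mu|) * N z.
  rewrite mulrAC ler_pdivlMr//.
  have := ler_wpM2l (ltW C0) h1; lra.
have h4 : `|mu| * N x <= N (A x) + N z.
  have : norm_le (mu \*o x) (N (A x) + N z).
    have -> : mu \*o x = A x \- z.
      by apply/funext => v; rewrite /z /shiftr /=; ring.
    by apply: norm_leB; exact: norm_le_sqrt_dot.
  move=> /(norm_leZ mu^-1); have -> : mu^-1 \*o (mu \*o x) = x.
    by apply/funext => v /=; rewrite mulKf// -normr_gt0.
  by move=> /(sqrt_dot_le fx); rewrite normfV mulrC ler_pdivlMr// mulrC.
have h5 : N x <= K * N z.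
  rewrite /K mulrAC ler_pdivlMr// mulrC mulrDl mul1r.
  by apply: le_trans h4 _; rewrite lerD2r.
have : N x ^+ 2 <= (K * N z) ^+ 2.
  by rewrite ler_pXn2r//// nnegrE ?sqrtr_ge0// (le_trans _ h5)// sqrtr_ge0.
rewrite exprMn !sqr_sqrtr ?dot_ge0// => h6.
by rewrite ler_pdivrMl// exprn_gt0.
Qed.

End RealSpectralLemmas.

(** Gaussian elimination on coordinates: a member of [E] that is nonzero at [v0] serves as pivot,
    and what remains after subtracting its multiples vanishes at [v0]. *)
Lemma spanned_by_values (K : fieldType) (V : choiceType) (F : seq V)
    (E : set (V -> K)) :
  (forall a f g, E f -> E g -> E (fun v => f v - a * g v)) ->
  (forall f, E f -> (forall v, v \in F -> f v = 0) -> f = fun=> 0) ->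
  exists n (b : 'I_n -> V -> K), forall f, E f ->
    exists a : 'I_n -> K, f = fun v => \sum_(i < n) a i * b i v.
Proof.
elim: F E => [|v0 F IH] E lin det.
  exists 0%N, (fun _ _ => 0) => f Ef; exists (fun=> 0).
  by rewrite (det _ Ef)//; apply/funext => v; rewrite big_ord0.
have [[g Eg gv]|nog] := pselect (exists2 g, E g & g v0 != 0); last first.
  apply: IH => // f Ef fF; apply: det => // v; rewrite inE => /predU1P[->|]; last exact: fF.
  by apply/eqP; apply: contrapT => /negP fv; apply: nog; exists f.
have [||n [b hb]] := IH [set f | E f /\ f v0 = 0].
- move=> a f h [Ef f0] [Eh h0]; split; first exact: lin.
  by rewrite f0 h0 mulr0 subr0.
- move=> f [Ef f0] fF; apply: det => // v; rewrite inE => /predU1P[->//|]; exact: fF.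
exists n.+1, (fun i => if unlift ord0 i is Some j then b j else g) => f Ef.
have [|a ha] := hb (fun v => f v - f v0 / g v0 * g v).
  by split; [exact: lin | rewrite divfK ?subrr].
exists (fun i => if unlift ord0 i is Some j then a j else f v0 / g v0).
apply/funext => v; rewrite big_ord_recl unlift_none /=.
under eq_bigr do rewrite liftK.
by have := congr1 (fun h => h v) ha; rewrite /= => <-; rewrite addrC subrK.
Qed.

(** * The spectrum in terms of lower bounds *)

Section Spectrum.
Variables (R : realType) (G : graph) (hG : bounded_degree G).
Variable H : schrodinger_operator R G.
Local Notation C := R[i].
Local Notation A := (real_op H).
Implicit Types (psi phi : G -> C) (x y : G -> R) (lam : C).

Let hA : sym_local A := sym_local_real_op hG H.

Lemma rpart_shift psi lam : rpart (Defs.shift H lam psi) =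
  shiftr A (complex.Re lam) (rpart psi) \+ (complex.Im lam \*o ipart psi).
Proof.
apply/funext => v; have := congr1 (fun f => f v) (@rpart_schrodinger _ _ hG H psi).
rewrite /rpart /ipart /Defs.shift /shiftr /= RecB RecM => ->; ring.
Qed.

Lemma ipart_shift psi lam : ipart (Defs.shift H lam psi) =
  shiftr A (complex.Re lam) (ipart psi) \- (complex.Im lam \*o rpart psi).
Proof.
apply/funext => v; have := congr1 (fun f => f v) (@ipart_schrodinger _ _ hG H psi).
rewrite /rpart /ipart /Defs.shift /shiftr /= ImcB ImcM => ->; ring.
Qed.

Lemma rpart_lin (a : C) psi phi : rpart (fun v => a * psi v + phi v) =
  (complex.Re a \*o rpart psi) \- (complex.Im a \*o ipart psi) \+ rpart phi.
Proof. by apply/funext => v; rewrite /rpart /ipart /= RecD RecM. Qed.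

Lemma ipart_lin (a : C) psi phi : ipart (fun v => a * psi v + phi v) =
  (complex.Re a \*o ipart psi) \+ (complex.Im a \*o rpart psi) \+ ipart phi.
Proof. by apply/funext => v; rewrite /rpart /ipart /= ImcD ImcM. Qed.

Lemma ell2_lin (a : C) psi phi : ell2 psi -> ell2 phi ->
  ell2 (fun v => a * psi v + phi v).
Proof.
move=> /ell2_l2[[r rb] [i ib]] /ell2_l2[[r' rb'] [i' ib']].
have [] := @ell2_of_norm_le _ _ (fun v => a * psi v + phi v)
  (`|complex.Re a| * r + `|complex.Im a| * i + r')
  (`|complex.Re a| * i + `|complex.Im a| * r + i') => //.
- rewrite rpart_lin; apply: norm_leD => //.
  by apply: norm_leB; exact: norm_leZ.
- rewrite ipart_lin; apply: norm_leD => //.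
  by apply: norm_leD; exact: norm_leZ.
Qed.

Lemma shift_lin lam (a : C) psi phi :
  Defs.shift H lam (fun v => a * psi v + phi v) =
  (fun v => a * Defs.shift H lam psi v + Defs.shift H lam phi v).
Proof.
apply/funext => v; rewrite /Defs.shift !(schrodingerE hG).
rewrite big_split /= -mulr_sumr; ring.
Qed.

(* With [S = (A - a)^2 + b^2 = (H - lam) (H - conj lam)], the inverse of
   [H - lam] is [(H - conj lam) S^-1]. *)
Lemma resolvent_of_lower lam (c : R) : 0 < c ->
  (forall x, fsupp x -> c * dot x x <=
     dot (shiftr A (complex.Re lam) x) (shiftr A (complex.Re lam) x) +
     complex.Im lam ^+ 2 * dot x x) ->
  resolvent_set H lam.
Proof.
set a := complex.Re lam; set b := complex.Im lam => c0 hc.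
pose Aa := shiftr A a; have hAa : sym_local Aa := sym_local_shiftr a hA.
pose S x := Aa (Aa x) \+ (b ^+ 2 \*o x).
have hS : sym_local S.
  by exact: sym_local_addZ (sym_local_comp hAa) (sym_local_id _ _).
have Sc x : fsupp x -> c * dot x x <= dot x (S x).
  move=> fx; rewrite /S dotDr// dotZr// -(sym_of hAa _ fx); exact: hc.
have [K K0 surj] := coercive_surjective hS c0 Sc.
have [M M0 AM] := sym_local_bounded hAa.
(* The two parts of a null function satisfy [Aa (Im psi) = b Re psi] and [Aa (Re psi) = - b Im psi],
   so both are killed by [S]. *)
have inj psi : ell2 psi -> Defs.shift H lam psi = (fun=> 0) -> psi = fun=> 0.
  move=> e s0; have [[r rb] [i ib]] := ell2_l2 e.
  have := rpart_shift psi lam; have := ipart_shift psi lam.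
  rewrite s0 -/a -/b -/Aa => hi hr.
  have hi' : Aa (ipart psi) = b \*o rpart psi.
    by apply/funext => v; have /(congr1 (fun f => f v)) := hi;
      rewrite /ipart /= => /esym/subr0_eq.
  have hr' : Aa (rpart psi) = (- b) \*o ipart psi.
    apply/funext => v; have /(congr1 (fun f => f v)) := hr.
    by rewrite /rpart /= mulNr => /esym/eqP; rewrite addr_eq0 => /eqP.
  apply: eq_cplx.
  - rewrite [LHS](coercive_injective (a := r) hS c0 Sc)// /S hr' (sym_localZ hAa) hi'.
    by apply/funext => v /=; ring.
  - rewrite [LHS](coercive_injective (a := i) hS c0 Sc)// /S hi' (sym_localZ hAa) hr'.
    by apply/funext => v /=; ring.
pose D := 2 * (M + `|b|) * K.
have D0 : 0 <= D by rewrite !mulr_ge0// addr_ge0// ltW.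
have inv psi : exists phi, ell2 psi ->
    [/\ ell2 phi, Defs.shift H lam phi = psi & ell2_norm phi <= D * ell2_norm psi].
  have [e|ne] := pselect (ell2 psi); last by exists psi.
  have [g1 g1b S1] := surj _ _ (norm_le_rpart e).
  have [g2 g2b S2] := surj _ _ (norm_le_ipart e).
  (* These are the parts of [(Aa + i b) (g1 + i g2)], where [S] maps [g1] and [g2] to the parts of
     [psi]. *)
  pose phi := cplx (Aa g1 \- (b \*o g2)) (Aa g2 \+ (b \*o g1)).
  exists phi => _.
  have [||e' ne'] := @ell2_of_norm_le _ _ phi
    (M * (K * ell2_norm psi) + `|b| * (K * ell2_norm psi))
    (M * (K * ell2_norm psi) + `|b| * (K * ell2_norm psi)).
  - by apply: norm_leB; [exact: AM | exact: norm_leZ].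
  - by apply: norm_leD; [exact: AM | exact: norm_leZ].
  split => //; last by apply: le_trans ne' _; rewrite le_eqVlt /D; apply/orP; left; apply/eqP; ring.
  apply: eq_cplx.
  - rewrite rpart_shift -/a -/b -/Aa -S1 /S.
    rewrite -[rpart phi]/(Aa g1 \- (b \*o g2)) -[ipart phi]/(Aa g2 \+ (b \*o g1)).
    rewrite (sym_localB hAa) (sym_localZ hAa).
    by apply/funext => v /=; ring.
  - rewrite ipart_shift -/a -/b -/Aa -S2 /S.
    rewrite -[rpart phi]/(Aa g1 \- (b \*o g2)) -[ipart phi]/(Aa g2 \+ (b \*o g1)).
    rewrite (sym_localD hAa) (sym_localZ hAa).
    by apply/funext => v /=; ring.
have [B hB] := choice inv.
(* [B] comes from the axiom of choice, one function at a time; its linearity and the left inverse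
   property follow from injectivity of the shift. *)
have shift_inj psi phi : ell2 psi -> ell2 phi ->
    Defs.shift H lam psi = Defs.shift H lam phi -> psi = phi.
  move=> epsi ephi sE.
  have : (fun v => -1 * psi v + phi v) = fun=> 0.
    apply: inj; first exact: ell2_lin.
    by rewrite shift_lin sE; apply/funext => v; rewrite mulN1r addNr.
  move=> h; apply/funext => v; have /(congr1 (fun f => f v)) := h.
  by rewrite /= mulN1r addrC => /subr0_eq.
have ell2_shift psi : ell2 psi -> ell2 (Defs.shift H lam psi).
  move=> /ell2_l2[[r rb] [i ib]].
  have [] := @ell2_of_norm_le _ _ (Defs.shift H lam psi)
    (M * r + `|b| * i) (M * i + `|b| * r) => //.
  - by rewrite rpart_shift; apply: norm_leD; [exact: AM | exact: norm_leZ].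
  - by rewrite ipart_shift; apply: norm_leB; [exact: AM | exact: norm_leZ].
exists B; split; [split| |].
- by move=> psi /hB[].
- move=> k psi phi epsi ephi.
  have [e1 s1 _] := hB _ epsi; have [e2 s2 _] := hB _ ephi.
  have [e3 s3 _] := hB _ (ell2_lin k epsi ephi).
  apply: shift_inj => //; first exact: ell2_lin.
  by rewrite s3 shift_lin s1 s2.
- by exists D => psi /hB[].
- move=> psi e; have [e1 s1 _] := hB _ (ell2_shift _ e).
  exact: shift_inj.
- by move=> psi /hB[].
Qed.

Lemma bdd_below_of_resolvent (a : R) :
  resolvent_set H (a%:C)%C -> bdd_below (shiftr A a).
Proof.
move=> [B [[Bell Blin [M BM]] Bl Br]].
(* The constant of a bounded operator carries no sign; this replacement is positive. *)
pose K := `|M| + 1; have K0 : 0 < K by rewrite ltr_wpDl.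
exists (K ^+ 2)^-1; first by rewrite invr_gt0 exprn_gt0.
move=> x fx; have fA := fsupp_of (sym_local_shiftr a hA) fx.
pose psi := cplx x (fun=> 0).
have l20 : l2 (fun=> 0 : R) by exists 0; exact: norm_le_zero.
have e : ell2 psi by apply: ell2_cplx => //; eexists; exact: norm_le_sqrt_dot.
have sE : Defs.shift H (a%:C)%C psi = cplx (shiftr A a x) (fun=> 0).
  apply: eq_cplx.
    rewrite rpart_shift; apply/funext => v /=; rewrite mul0r addr0.
    by rewrite /rpart.
  rewrite ipart_shift; apply/funext => v /=; rewrite mul0r subr0.
  rewrite -[ipart psi]/(fun=> 0 : R).
  by rewrite (sym_local0 (sym_local_shiftr a hA)).
have es : ell2 (Defs.shift H (a%:C)%C psi).
  by rewrite sE; apply: ell2_cplx => //; eexists; exact: norm_le_sqrt_dot.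
have := BM _ es; rewrite Bl// sE !ell2_norm_real// => h.
have {}h : Num.sqrt (dot x x) <= K * Num.sqrt (dot (shiftr A a x) (shiftr A a x)).
  apply: le_trans h _; rewrite ler_wpM2r ?sqrtr_ge0//.
  by rewrite (le_trans (ler_norm _))// lerDl.
rewrite ler_pdivrMl ?exprn_gt0//.
rewrite -(sqr_sqrtr (dot_ge0 x)) -(sqr_sqrtr (dot_ge0 (shiftr A a x))) -exprMn.
by rewrite ler_pXn2r// nnegrE ?sqrtr_ge0// mulr_ge0 ?sqrtr_ge0// ltW.
Qed.

Lemma spectrumP lam : spectrum H lam <->
  complex.Im lam = 0 /\ ~ bdd_below (shiftr A (complex.Re lam)).
Proof.
split=> [sl|[li nb] rl]; last first.
  apply: nb; apply: bdd_below_of_resolvent.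
  by have -> : ((complex.Re lam)%:C)%C = lam by move: li; case: lam {rl} => p q /= ->.
split.
  apply/eqP; apply: contrapT => /negP l0; apply: sl.
  apply: (@resolvent_of_lower _ (complex.Im lam ^+ 2)).
    by rewrite lt_neqAle eq_sym sqrf_eq0 l0 sqr_ge0.
  by move=> x fx; rewrite lerDr dot_ge0.
move=> [c c0 hc]; apply: sl; apply: (resolvent_of_lower c0) => x fx.
by apply: le_trans (hc _ fx) _; rewrite lerDl mulr_ge0 ?sqr_ge0 ?dot_ge0.
Qed.

End Spectrum.

(** * Kernel functions near disjointly supported unit vectors *)

Section KernelFamily.
Variables (R : realType) (V : choiceType).
Implicit Types (x y z k : V -> R) (s F : seq V) (A : (V -> R) -> V -> R).

Lemma far_approx_kernel_family A (C eta : R) : sym_local A -> 0 <= C -> 0 < eta ->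
  far_approx A ->
  (forall f a, fsupp f -> norm_le (A f) a ->
     exists k, [/\ l2 k, A k = (fun=> 0) & norm_le (f \- k) (C * a)]) ->
  forall m, exists (Y K : nat -> V -> R),
    (forall i, (i < m)%N -> [/\ fsupp (Y i), dot (Y i) (Y i) = 1, l2 (K i),
       A (K i) = (fun=> 0) & norm_le (Y i \- K i) eta]) /\
    (forall i j v, (i < j < m)%N -> Y i v = 0 \/ Y j v = 0).
Proof.
move=> hA C0 eta0 far split m.
suff [Y [K [F [YK _ dis]]]] : exists (Y K : nat -> V -> R) (F : seq V),
    [/\ forall i, (i < m)%N -> [/\ fsupp (Y i), dot (Y i) (Y i) = 1, l2 (K i),
       A (K i) = (fun=> 0) & norm_le (Y i \- K i) eta],
     forall i v, (i < m)%N -> v \notin F -> Y i v = 0 &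
     forall i j v, (i < j < m)%N -> Y i v = 0 \/ Y j v = 0] by exists Y, K.
elim: m => [|m [Y [K [F [YK YF dis]]]]].
  by exists (fun _ _ => 0), (fun _ _ => 0), [::]; split=> // i j v; rewrite andbC.
(* Accuracy [q] makes the distance [C q] to the kernel at most [eta]; the [+ 1] covers [C = 0]. *)
pose q := eta / (C + 1); have C1 : 0 < C + 1 by rewrite ltr_wpDl.
have q0 : 0 < q by exact: divr_gt0.
have [x [fx xF xq]] := far (q ^+ 2) F (exprn_gt0 2 q0).
have fA := fsupp_of hA fx.
have dx : 0 < dot x x.
  rewrite lt_neqAle dot_ge0 andbT; apply/eqP => d0.
  by move: xq; rewrite -d0 mulr0 ltNge dot_ge0.
pose r := (Num.sqrt (dot x x))^-1; pose y := r \*o x.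
have r2 : r ^+ 2 * dot x x = 1.
  by rewrite exprVn sqr_sqrtr ?dot_ge0// mulVf// gt_eqF.
have fy : fsupp y by exact: fsuppZ.
have dy : dot y y = 1 by rewrite dotZl dotZr// mulrA -expr2.
have Ay : norm_le (A y) q.
  apply/norm_le_fsupp; [exact: (fsupp_of hA)|exact: ltW|].
  rewrite (sym_localZ hA) dotZl dotZr// mulrA -expr2.
  have r0 : 0 < r ^+ 2 by rewrite exprn_gt0// invr_gt0 sqrtr_gt0.
  apply: ltW; rewrite -(ltr_pM2l r0) in xq; apply: lt_le_trans xq _.
  by rewrite mulrCA r2 mulr1.
have [k [lk Ak yk]] := split _ _ fy Ay.
have {}yk : norm_le (y \- k) eta.
  apply: norm_leW yk _; rewrite /q mulrCA ler_piMr ?(ltW eta0)//.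
  by rewrite ler_pdivrMr// mul1r lerDl.
have [t ty] := fy.
exists (fun i => if i == m then y else Y i), (fun i => if i == m then k else K i), (t ++ F).
split.
- move=> i; rewrite ltnS leq_eqVlt; case: eqVneq => //= _; exact: YK.
- move=> i v; rewrite ltnS leq_eqVlt mem_cat negb_or; case: eqVneq => /= _ im /andP[vt vF].
    exact: ty.
  exact: YF.
- move=> i j v /andP[ij]; rewrite ltnS leq_eqVlt => jm.
  have im : (i < m)%N by case/orP: jm ij => [/eqP ->//|jm ij]; exact: ltn_trans jm.
  rewrite (ltn_eqF im); case: eqVneq jm => [_ _|_ /= jm]; last by apply: dis; rewrite ij.
  case: (boolP (v \in F)) => vF; last by left; exact: YF.
  by right; rewrite /y /= xF// mulr0.
Qed.

(** Take [i0] with [|t i0|] maximal. On the support of [Y i0] the other [Y i] vanish, so the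
    relation reads [Y i0 = sum (t i / t i0) (Y i - K i)] there, with ratios at most 1: the unit
    vector [Y i0] would have norm at most [m eta < 1]. *)
Lemma near_orthonormal_free m (Y K : nat -> V -> R) (eta : R) (t : 'I_m -> R) :
  0 < eta -> m%:R * eta < 1 ->
  (forall i, (i < m)%N -> [/\ fsupp (Y i), dot (Y i) (Y i) = 1 &
     norm_le (Y i \- K i) eta]) ->
  (forall i j v, (i < j < m)%N -> Y i v = 0 \/ Y j v = 0) ->
  (forall v, \sum_(i < m) t i * K i v = 0) -> forall i, t i = 0.
Proof.
move=> eta0 meta YK dis tK i1; apply/eqP; apply: contrapT => /negP ti1.
have [i0 _ imax] := @arg_maxP _ _ _ i1 xpredT (fun i => `|t i|) isT.
have ti0 : t i0 != 0.
  by rewrite -normr_gt0; apply: lt_le_trans (imax i1 isT); rewrite normr_gt0.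
have [fY dY _] := YK i0 (ltn_ord i0).
have [s us sY] := fsupp_uniq fY.
pose r := [seq v <- s | Y i0 v != 0].
have YE : Y i0 = cutoff r (fun v => \sum_(i < m) (t i / t i0) * (Y i v - K i v)).
  apply/funext => v; rewrite /cutoff mem_filter.
  have [Yv|Yv] := eqVneq (Y i0 v) 0 => //=.
  have -> /= : v \in s by apply: contraNT Yv => /sY ->.
  under eq_bigr do rewrite mulrBr.
  rewrite sumrB [X in _ - X](_ : _ = (t i0)^-1 * \sum_(i < m) t i * K i v); last first.
    by rewrite mulr_sumr; apply: eq_bigr => i _; rewrite mulrA [(t i0)^-1 * _]mulrC.
  rewrite tK mulr0 subr0 (bigD1 i0)//= divff// mul1r big1 ?addr0// => i ii0.
  suff -> : Y i v = 0 by rewrite mulr0.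
  have Y0 : Y i0 v = 0 -> Y i v = 0 by move/eqP: Yv.
  have := ii0; rewrite -val_eqE neq_ltn => /orP[]/= lt.
    by have [//|/Y0] := dis i i0 v (introT andP (conj lt (ltn_ord i0))).
  by have [/Y0|//] := dis i0 i v (introT andP (conj lt (ltn_ord i))).
have Yn : norm_le (Y i0) (m%:R * eta).
  rewrite YE; apply: norm_le_cutoff.
  have -> : m%:R * eta = \sum_(i < m) eta by rewrite sumr_const card_ord mulr_natl.
  apply: (@norm_le_sum _ _ _ _ (fun i v => (t i / t i0) * (Y i v - K i v))) => i.
  have [_ _ /(norm_leZ (t i / t i0)) h] := YK i (ltn_ord i).
  apply: norm_leW h _; rewrite ler_piMl ?(ltW eta0)// normrM normfV.
  by rewrite ler_pdivrMr ?normr_gt0// mul1r; exact: imax.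
have m0 : 0 <= m%:R * eta by rewrite mulr_ge0// ltW.
move: Yn => /(norm_le_fsupp fY m0); rewrite dY leNgt => /negP; apply.
by rewrite expr_lt1.
Qed.

End KernelFamily.

(** * Weyl's criterion for the essential spectrum *)

Section EssentialSpectrum.
Variables (R : realType) (G : graph) (hG : bounded_degree G).
Variable H : schrodinger_operator R G.
Local Notation C := R[i].
Local Notation A := (real_op H).
Implicit Types (psi phi : G -> C) (x y : G -> R) (lam : C).

Let hA : sym_local A := sym_local_real_op hG H.

Lemma eigenspaceP psi (a : R) : Defs.eigenspace H (a%:C)%C psi <->
  ell2 psi /\ shiftr A a (rpart psi) = (fun=> 0) /\ shiftr A a (ipart psi) = (fun=> 0).
Proof.
have re v : rpart (fun v => (a%:C)%C * psi v) v = a * rpart psi v.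
  by rewrite /rpart RecM /= mul0r subr0.
have im v : ipart (fun v => (a%:C)%C * psi v) v = a * ipart psi v.
  by rewrite /ipart ImcM /= mul0r addr0.
split=> [[e He]|[e [r0 i0]]]; split => //.
  have := @rpart_schrodinger _ _ hG H psi; have := @ipart_schrodinger _ _ hG H psi.
  rewrite He => hi hr; rewrite /shiftr -hi -hr; split; apply/funext => v /=.
    by rewrite re mulNr subrr.
  by rewrite im mulNr subrr.
apply: eq_cplx; apply/funext => v.
  rewrite rpart_schrodinger// re; have := congr1 (fun f => f v) r0.
  by rewrite /shiftr /= mulNr => /subr0_eq.
rewrite ipart_schrodinger// im; have := congr1 (fun f => f v) i0.
by rewrite /shiftr /= mulNr => /subr0_eq.
Qed.

Lemma eigenspace_real x (a : R) : l2 x -> shiftr A a x = (fun=> 0) ->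
  Defs.eigenspace H (a%:C)%C (cplx x (fun=> 0)).
Proof.
move=> lx Ax; apply/eigenspaceP; split; last split => //.
  by apply: ell2_cplx => //; exists 0; exact: norm_le_zero.
exact: sym_local0 (sym_local_shiftr a hA).
Qed.

Lemma norm_complex_real (t : R) : `|(t%:C)%C : C| = (`|t|%:C)%C.
Proof. by rewrite normc_def /= expr0n addr0 sqrtr_sqr. Qed.

Lemma essential_of_far_approx (a : R) :
  far_approx (shiftr A a) -> essential_spectrum H (a%:C)%C.
Proof.
move=> far; have hAa := sym_local_shiftr a hA.
have spec : spectrum H (a%:C)%C.
  by apply/(spectrumP hG); split=> //; exact: far_approx_not_bdd_below.
split=> // -[iso _ [n [b bP]]].
case: iso => _ [U /nbhs_ballP[e e0 eU] US].
(* Radii of balls in [R[i]] are complex numbers; a positive one is real. *)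
have [delta d0 eE] : exists2 delta : R, 0 < delta & e = (delta%:C)%C.
  move: e0; case: (e) => p q; rewrite /= ltcE /= => /andP[/eqP -> p0].
  by exists p.
have gap c : 0 < `|c| < delta -> bdd_below (shiftr (shiftr A a) c).
  move=> /andP[c0 cd]; apply: contrapT => nb.
  have sc : spectrum H ((a + c)%:C)%C.
    apply/(spectrumP hG); split=> //= -[k k0 hk]; apply: nb; exists k => // x fx.
    by rewrite !shiftrD; exact: hk.
  have : (U `&` (spectrum H : set C^o)) ((a + c)%:C)%C.
    split=> //; apply: eU; rewrite /ball /= eE.
    rewrite -rmorphB opprD addNKr norm_complex_real normrN.
    by rewrite ltcR.
  rewrite US => -[] /eqP; rewrite addrC -subr_eq0 addrK => /eqP c00.
  by move: c0; rewrite c00 normr0 ltxx.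
have low := isolated_zero_lower hAa d0 gap.
have [D D0 split] := split_kernel hAa d0 low.
(* Chosen for [n + 1] kernel functions, one more than the [n] functions assumed to span the
   eigenspace. *)
pose eta : R := (n.+2%:R)^-1.
have eta0 : 0 < eta by rewrite invr_gt0.
have meta : n.+1%:R * eta < 1 by rewrite ltr_pdivrMr// mul1r ltr_nat.
have [Y [K [YK dis]]] := far_approx_kernel_family hAa D0 eta0 far split n.+1.
have coef (i : 'I_n.+1) : exists c : 'I_n -> C,
    cplx (K i) (fun=> 0) = (fun v => \sum_(j < n) c j * b j v).
  have [_ _ lK AK _] := YK i (ltn_ord i).
  by apply: bP; exact: eigenspace_real.
have [c cP] := choice coef.
pose M : 'M[C]_(n.+1, n) := \matrix_(i, j) c i j.
(* The coefficient matrix has more rows than columns, so the kernel functions satisfy a nontrivial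
   complex relation [u]. As they are real, its real and imaginary parts are relations too, both
   excluded by [near_orthonormal_free]. *)
have /rowV0Pn[u /sub_kermxP uM u0] : kermx M != 0.
  rewrite -mxrank_eq0 mxrank_ker -lt0n subn_gt0.
  exact: leq_ltn_trans (rank_leq_col M) (ltnSn n).
have uK v : \sum_(i < n.+1) u 0 i * cplx (K i) (fun=> 0) v = 0.
  under eq_bigr do rewrite cP mulr_sumr.
  rewrite exchange_big /= big1// => j _.
  under eq_bigr do rewrite mulrA.
  rewrite -mulr_suml (_ : \sum_(i < n.+1) _ = (u *m M) 0 j).
    by rewrite uM mxE mul0r.
  by rewrite mxE; apply: eq_bigr => i _; rewrite mxE.
have YK' i : (i < n.+1)%N -> [/\ fsupp (Y i), dot (Y i) (Y i) = 1 &
    norm_le (Y i \- K i) eta] by move=> /YK[].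
have ur i : complex.Re (u 0 i) = 0.
  apply: (near_orthonormal_free (t := fun i => complex.Re (u 0 i)) eta0 meta YK' dis) => v.
  have := congr1 (@complex.Re R) (uK v); rewrite Rec_sum /= => h.
  by rewrite -[RHS]h; apply: eq_bigr => j _; rewrite RecM /= mulr0 subr0.
have ui i : complex.Im (u 0 i) = 0.
  apply: (near_orthonormal_free (t := fun i => complex.Im (u 0 i)) eta0 meta YK' dis) => v.
  have := congr1 (@complex.Im R) (uK v); rewrite Imc_sum /= => h.
  by rewrite -[RHS]h; apply: eq_bigr => j _; rewrite ImcM /= mulr0 add0r.
move/eqP: u0; apply; apply/rowP => i; rewrite mxE.
by move: (ur i) (ui i); case: (u 0 i) => p q /= -> ->.
Qed.

(** A lower bound off a finite [F] yields the three properties of a discrete eigenvalue. Every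
    function is close to the kernel in proportion to its image, so [range_lower] isolates [lam];
    with a trivial kernel the same estimate would bound [A] below; and kernel functions are
    determined by their values on [F]. *)
Lemma far_approx_of_essential lam : essential_spectrum H lam ->
  complex.Im lam = 0 /\ far_approx (shiftr A (complex.Re lam)).
Proof.
move=> [sl nl]; have [li nb] := (spectrumP hG H lam).1 sl.
split=> //; apply: contrapT => nfar; apply: nl.
have lE : lam = ((complex.Re lam)%:C)%C.
  by move: li; case: lam {sl nb nfar} => p q /= ->.
set a := complex.Re lam in nb nfar lE *.
have hAa := sym_local_shiftr a hA.
move: nfar => /existsNP[c /existsNP[F /not_implyP[c0 nx]]].
have cA x : fsupp x -> (forall v, v \in F -> x v = 0) ->
    c * dot x x <= dot (shiftr A a x) (shiftr A a x).
  move=> fx xF; rewrite leNgt; apply/negP => lt; apply: nx; by exists x.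
have [D D0 hD] := lower_bound_l2 hAa c0 cA.
have [E E0 hE] : exists2 E, 0 <= E & forall x b, l2 x -> norm_le (shiftr A a x) b ->
    exists k, [/\ l2 k, shiftr A a k = (fun=> 0) & norm_le (x \- k) (E * b)].
  have [|E E0 hE] := split_kernel_mod_finite hAa (F1 := F) (F0 := [::]).
    by exists D => // x b lx _; exact: hD.
  by exists E => // x b lx; exact: hE.
have det x : l2 x -> shiftr A a x = (fun=> 0) -> (forall v, v \in F -> x v = 0) ->
    x = fun=> 0.
  move=> lx Ax xF; apply/funext => v; apply: norm_le0.
  have := hD x 0 lx; rewrite Ax big1_seq ?addr0 ?mulr0; last first.
    by move=> i /= /xF ->; rewrite normr0.
  by apply; exact: norm_le_zero.
split.
- split; first by rewrite inE.
  pose K := E + 1; have K0 : 0 < K by rewrite ltr_wpDl.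
  have low x : fsupp x -> dot (shiftr A a x) (shiftr A a x) <= K ^+ 2 *
      dot (shiftr A a (shiftr A a x)) (shiftr A a (shiftr A a x)).
    move=> fx; apply: le_trans (range_lower hAa E0 hE fx) _.
    rewrite ler_wpM2r ?dot_ge0// ler_pXn2r// ?nnegrE// ?(ltW K0)//.
    by rewrite lerDl.
  exists (ball (lam : C^o) ((K^-1)%:C)%C).
    apply: nbhsx_ballx; rewrite ltcR invr_gt0; exact: K0.
  apply/seteqP; split=> [z [bz /(spectrumP hG)[zi znb]]|_ ->]; last first.
    split=> //; apply: ballxx; rewrite ltcR invr_gt0; exact: K0.
  have zE : z = ((complex.Re z)%:C)%C by move: zi; case: (z) => p q /= ->.
  apply: contrapT => zl; apply: znb.
  pose mu := complex.Re z - a.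
  have mu0 : 0 < `|mu|.
    rewrite normr_gt0 subr_eq0; apply/eqP => h; apply: zl.
    by rewrite zE h -lE.
  have muK : K * `|mu| < 1.
    move: bz; rewrite /ball /= lE zE /= -rmorphB norm_complex_real ltcR distrC => h.
    by rewrite mulrC -ltr_pdivlMr// div1r.
  have [k k0 hk] := shiftr_bdd_below_near0 hAa K0 low mu0 muK.
  exists k => // x fx; have := hk x fx.
  by rewrite !shiftrD /mu addrC subrK.
- apply: contrapT => noeig; apply: nb.
  pose K := E + 1; have K0 : 0 < K by rewrite ltr_wpDl.
  exists (K ^+ 2)^-1; first by rewrite invr_gt0 exprn_gt0.
  move=> x fx; have fA := fsupp_of hAa fx.
  have [k [lk Ak xk]] := hE x _ (ex_intro _ _ (norm_le_sqrt_dot fx)) (norm_le_sqrt_dot fA).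
  have k0 : k = fun=> 0.
    apply: contrapT => kn; apply: noeig; exists (cplx k (fun=> 0)).
      by rewrite lE; exact: eigenspace_real.
    by move=> h; apply: kn; apply/funext => v; have := congr1 (fun f => complex.Re (f v)) h.
  move: xk; rewrite k0 (_ : x \- _ = x); last by apply/funext => v /=; rewrite subr0.
  rewrite norm_le_fsupp// ?mulr_ge0 ?sqrtr_ge0// exprMn sqr_sqrtr ?dot_ge0// => h.
  rewrite ler_pdivrMl ?exprn_gt0//; apply: le_trans h _.
  rewrite ler_wpM2r ?dot_ge0// ler_pXn2r// ?nnegrE// ?(ltW K0)//.
  by rewrite lerDl.
- apply: (@spanned_by_values _ _ F (Defs.eigenspace H lam)).
  + move=> r psi phi; rewrite lE => /eigenspaceP[e [r0 i0]] /eigenspaceP[e' [r0' i0']].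
    have -> : (fun v => psi v - r * phi v) = (fun v => (- r) * phi v + psi v).
      by apply/funext => v; rewrite mulNr addrC.
    apply/eigenspaceP; split; first exact: ell2_lin.
    rewrite rpart_lin ipart_lin (sym_localD hAa (_ \- _)) (sym_localB hAa) !(sym_localD hAa).
    rewrite !(sym_localZ hAa) r0 i0 r0' i0'.
    by split; apply/funext => v /=; rewrite !mulr0 ?subr0 ?addr0.
  + move=> psi; rewrite lE => /eigenspaceP[e [r0 i0]] pF.
    have [lr li'] := ell2_l2 e.
    apply: eq_cplx; apply/funext => v.
    * by rewrite (det _ lr r0)// => u uF; rewrite /rpart pF.
    * by rewrite (det _ li' i0)// => u uF; rewrite /ipart pF.
Qed.

End EssentialSpectrum.

(** * From R-limits to the essential spectrum *)

Section Distance.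
Variable G : graph.
Implicit Types (u v w : G).

Lemma walkP u v n : reflect
  (exists p, [/\ path (@adj G) u p, last u p = v & size p = n]) (walk u v n).
Proof. exact: asboolP. Qed.

Lemma dist_walk u v : exists p, [/\ path (@adj G) u p, last u p = v & size p = dist u v].
Proof. by rewrite /dist; case: ex_minnP => n /walkP. Qed.

Lemma dist_path u p : path (@adj G) u p -> (dist u (last u p) <= size p)%N.
Proof.
by move=> pp; rewrite /dist; case: ex_minnP => n _; apply; apply/walkP; exists p.
Qed.

Lemma distxx u : dist u u = 0%N.
Proof. by apply/eqP; rewrite -leqn0; exact: (@dist_path u [::]). Qed.

Lemma dist_eq0 u v : dist u v = 0%N -> u = v.
Proof. by have [p [_ lp <-]] := dist_walk u v => /size0nil p0; rewrite -lp p0. Qed.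

Lemma dist_triangle u v w : (dist u w <= dist u v + dist v w)%N.
Proof.
have [p [pp lp <-]] := dist_walk u v; have [q [pq <- <-]] := dist_walk v w.
rewrite -size_cat -lp -last_cat; apply: dist_path.
by rewrite cat_path pp lp.
Qed.

Lemma distC u v : dist u v = dist v u.
Proof.
suff le (x y : G) : (dist y x <= dist x y)%N by apply/eqP; rewrite eqn_leq !le.
have [p [pp lp <-]] := dist_walk x y.
have lx : last y (rev (belast x p)) = x.
  by case: p pp lp => [_ /= -> //|w p _ _]; rewrite /= rev_cons last_rcons.
rewrite -[leqRHS](size_belast x) -size_rev -{1}lx; apply: dist_path.
by rewrite -lp rev_path (eq_path (e' := @adj G)) // => z w; exact: adj_sym.
Qed.

Lemma dist_adj u v w : adj v w -> (dist u w <= (dist u v).+1)%N.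
Proof.
move=> vw; apply: leq_trans (dist_triangle u v w) _.
rewrite -addn1 leq_add2l; apply: (@dist_path v [:: w]).
by rewrite /= vw.
Qed.

Lemma adj_dist1 v w : adj v w -> dist v w = 1%N.
Proof.
move=> vw; apply/eqP; rewrite eqn_leq; apply/andP; split.
  by have := dist_adj v vw; rewrite distxx.
by rewrite lt0n; apply/eqP => /dist_eq0 h; move: vw; rewrite h adj_irr.
Qed.

Lemma dist_pred u v n : dist u v = n.+1 -> exists2 w, adj w v & dist u w = n.
Proof.
move=> dn; have [p [pp lp sp]] := dist_walk u v.
case/lastP: p pp lp sp => [|p w]; first by rewrite dn.
rewrite rcons_path last_rcons size_rcons => /andP[pp aw] wv sp.
exists (last u p); first by rewrite -wv.
apply/eqP; rewrite eqn_leq; apply/andP; split.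
  by have := dist_path pp; rewrite -ltnS sp dn.
by rewrite -ltnS -dn -wv; exact: dist_adj.
Qed.

Lemma gball_finite v r : bounded_degree G -> finite_set (gball v r).
Proof.
move=> hG; elim: r => [|r IH].
  apply: (@sub_finite_set _ _ [set v]); last exact: finite_set1.
  by move=> u; rewrite /gball /= leqn0 => /eqP /dist_eq0.
pose B := gball v r `|` \bigcup_(w in gball v r) neighbours w.
apply: (@sub_finite_set _ _ B).
  move=> u; rewrite /gball /= leq_eqVlt => /orP[/eqP|]; last by left.
  rewrite distC => /dist_pred[w wu dw]; right; exists w => //; rewrite /gball /=.
  by rewrite distC dw.
rewrite finite_setU; split=> //; apply: bigcup_finite => // w _.
exact: finite_neighbours.
Qed.

Lemma bounded_gball (s : seq G) v : exists2 r, (0 < r)%N & forall u, u \in s -> gball v r u.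
Proof.
elim: s => [|u s [r r0 IH]]; first by exists 1%N.
exists (maxn r (dist u v)); first by rewrite leq_max r0.
move=> w; rewrite inE => /predU1P[->|/IH]; rewrite /gball /=.
  by rewrite leq_maxr.
by move=> h; apply: leq_trans h _; rewrite leq_maxl.
Qed.

Lemma gball_adj v r u w : gball v r u -> adj u w -> gball v r.+1 w.
Proof.
rewrite /gball /= => uv uw; rewrite distC; apply: leq_trans (dist_adj v uw) _.
by rewrite distC ltnS.
Qed.

End Distance.

(** * Labels, matrix entries and transplanted functions *)

Section Transplant.
Variable R : realType.

Lemma conform_mx_nat (N N' : nat) (f : nat -> nat -> R[i]^o) (B : 'M[R[i]^o]_N') :
  N = N' -> conform_mx B (\matrix_(i < N, k < N) f i k) = \matrix_(i < N', k < N') f i k.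
Proof. by move=> e; case: _ / e B => B; rewrite conform_mx_id. Qed.

Lemma mx_cvg_entry (N : nat) (M : nat -> 'M[R[i]^o]_N) (M' : 'M[R[i]^o]_N) i k :
  M @ \oo --> M' ->
  (fun j => complex.Re (M j i k)) @ \oo --> (complex.Re (M' i k) : R).
Proof.
move=> /cvg_ballP cM; apply/cvgrPdist_lt => e e0.
have e0' : 0 < (e%:C)%C :> R[i] by rewrite ltcR.
have := cM _ e0'; apply: filterS => j [_ /(_ i k)] /=.
rewrite /ball /= -RecB; case: (M' i k - M j i k) => p q /=.
rewrite normc_def ltcR; apply: le_lt_trans.
by rewrite -sqrtr_sqr ler_wsqrtr// lerDl sqr_ge0.
Qed.

End Transplant.

Lemma sym_local_sum (R : realType) (V : choiceType) (A : (V -> R) -> V -> R)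
    (I : Type) (s : seq I) (c : I -> R) (f : I -> V -> R) v : sym_local A ->
  A (fun u => \sum_(i <- s) c i * f i u) v = \sum_(i <- s) c i * A (f i) v.
Proof.
move=> hA; elim: s => [|i s IH].
  by under eq_fun do rewrite big_nil; rewrite big_nil (sym_local0 hA).
rewrite big_cons -IH; under eq_fun do rewrite big_cons.
by rewrite (sym_localD hA (c i \*o f i)) (sym_localZ hA).
Qed.

Section Labelling.
Variables (R : realType) (G : graph) (v : G) (eta : nat -> G -> nat) (r : nat).
Hypotheses (ceta : coherent_sequence v eta) (r0 : (0 < r)%N).
Implicit Types (x y : G -> R).

Definition label_inv : nat -> G := 'pinv_(fun=> v) (gball v r) (eta r).
Local Notation N := (gball_size v r).

Let bij : set_bij (gball v r) `I_N (eta r). Proof. exact: ceta.1. Qed.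

Lemma label_lt u : gball v r u -> (eta r u < N)%N.
Proof. by have [fn _ _] := bij; exact: fn. Qed.

Lemma label_invK u : gball v r u -> label_inv (eta r u) = u.
Proof.
by have [_ inj _] := bij => hu; apply: (pinvKV (fun=> v) inj); rewrite inE.
Qed.

Lemma label_inv_gball k : (k < N)%N -> gball v r (label_inv k).
Proof. by have [fn _ _] := bijpinv_bij (fun=> v) bij => kN; exact: fn. Qed.

Lemma label_of_inv k : (k < N)%N -> eta r (label_inv k) = k.
Proof.
have [_ _ surj] := bij => kN; apply: (pinvK (fun=> v)).
by rewrite inE; exact: surj.
Qed.

Definition label_seq := [seq label_inv i | i <- iota 0 N].

Lemma label_seq_uniq : uniq label_seq.
Proof.
rewrite map_inj_in_uniq ?iota_uniq// => i j.
rewrite !mem_iota /= !add0n => iN jN h.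
by rewrite -(label_of_inv iN) h label_of_inv.
Qed.

Lemma mem_label_seq u : (u \in label_seq) = (dist v u <= r)%N.
Proof.
apply/mapP/idP => [[k]|].
  by rewrite mem_iota /= add0n => kN ->; rewrite distC; exact: label_inv_gball.
rewrite distC => h; exists (eta r u); last by rewrite label_invK.
by rewrite mem_iota /= add0n; exact: label_lt.
Qed.

Lemma dot_label x y : (forall u, ~ gball v r u -> x u = 0) ->
  dot x y = \sum_(i < N) x (label_inv i) * y (label_inv i).
Proof.
move=> x0; rewrite (dotE _ label_seq_uniq).
  by rewrite big_map -(big_mkord xpredT (fun i => x (label_inv i) * y (label_inv i)))
    /index_iota subn0.
by move=> u; rewrite mem_label_seq distC => /negP; exact: x0.
Qed.

Definition real_delta (u : G) : G -> R := fun w => (w == u)%:R.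

Lemma delta_expansion x u : (forall u, ~ gball v r u -> x u = 0) ->
  x u = \sum_(i <- iota 0 N) x (label_inv i) * real_delta (label_inv i) u.
Proof.
move=> x0; have [ub|unb] := pselect (gball v r u).
  rewrite (bigD1_seq (eta r u)) ?iota_uniq ?mem_iota ?add0n ?label_lt//=.
  rewrite label_invK// /real_delta eqxx mulr1 big_seq_cond big1 ?addr0// => i.
  rewrite mem_iota /= add0n => /andP[iN ne].
  case: eqVneq => [h|_]; last by rewrite mulr0.
  by move: ne; rewrite h label_of_inv ?eqxx.
rewrite x0// big_seq_cond big1// => i; rewrite mem_iota /= add0n => /andP[iN _].
rewrite /real_delta; case: eqVneq => [h|_]; last by rewrite mulr0.
by case: unb; rewrite h; exact: label_inv_gball.
Qed.

Lemma apply_label (A : (G -> R) -> G -> R) x u : sym_local A ->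
  (forall u, ~ gball v r u -> x u = 0) ->
  A x u = \sum_(i < N) x (label_inv i) * A (real_delta (label_inv i)) u.
Proof.
move=> hA x0.
have xE : x = fun u => \sum_(i <- iota 0 N) x (label_inv i) * real_delta (label_inv i) u.
  by apply/funext => w; exact: delta_expansion.
rewrite {1}xE sym_local_sum//.
rewrite -(big_mkord xpredT (fun i => x (label_inv i) * A (real_delta (label_inv i)) u)).
by rewrite /index_iota subn0.
Qed.

End Labelling.

Section RLimitFarApprox.
Variables (R : realType) (T G' : graph) (hT : bounded_degree T).
Variables (H : schrodinger_operator R T) (H' : schrodinger_operator R G').

Lemma rpart_delta (G : graph) (u : G) : rpart (delta R u) = real_delta R u.
Proof. by apply/funext => w; rewrite /rpart /delta /real_delta; case: eqP. Qed.

Lemma local_matrix_conform v eta r N (B : 'M[R[i]^o]_N) : gball_size v r = N ->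
  conform_mx B (local_matrix H v eta r) = \matrix_(i < N, k < N)
    H (delta R (label_inv v eta r k)) (label_inv v eta r i).
Proof.
move=> e; exact: (conform_mx_nat (fun i k : nat =>
  H (delta R (label_inv v eta r k)) (label_inv v eta r i))).
Qed.

Lemma real_op_vanish (G : graph) (hG : bounded_degree G) (K : schrodinger_operator R G)
    (a : R) (v : G) r (x : G -> R) : (forall u, ~ gball v r u -> x u = 0) ->
  forall u, ~ gball v r.+1 u -> shiftr (real_op K) a x u = 0.
Proof.
move=> x0 u ub; rewrite /shiftr /real_op /hop /= x0; last first.
  by apply: contra_not ub; rewrite /gball /= => h; exact: leqW.
rewrite !mulr0 !addr0 big1_seq// => w /=; rewrite mem_nbs// => uw.
by apply: x0; apply: contra_not ub => wb; apply: gball_adj wb _; rewrite adj_sym.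
Qed.

Lemma far_approx_of_R_limit (v0' : G') (a : R) : R_limit H H' v0' ->
  ~ bdd_below (shiftr (real_op H') a) -> far_approx (shiftr (real_op H) a).
Proof.
move=> [hG' [v [vadj vinf] [n [ninc [eta [eta' [ceta ceta' conv]]]]]]] nb c F c0.
have [x [fx xlt]] : exists x, fsupp x /\ dot (shiftr (real_op H') a x)
    (shiftr (real_op H') a x) < c * dot x x.
  apply: contrapT => nx; apply: nb; exists c => // x fx.
  by rewrite leNgt; apply/negP => lt; apply: nx; exists x.
have hA := sym_local_real_op hT H; have hA' := sym_local_real_op hG' H'.
have [s sx] := fx; have [r r0 sr] := bounded_gball s v0'.
have x0 u : ~ gball v0' r u -> x u = 0.
  by move=> ub; apply: sx; apply/negP => /sr.
have x01 u : ~ gball v0' r.+1 u -> x u = 0.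
  by move=> ub; apply: x0; apply: contra_not ub; rewrite /gball /= => /leqW.
pose N := gball_size v0' r.+1.
pose P j := label_inv (v (n j)) (eta j) r.+1.
pose P' := label_inv v0' eta' r.+1.
(* Each vertex receives the value of [x] at the vertex with the same label. Radius [r + 1] is used
   because [H] spreads a function supported in the ball of radius [r] by one step. *)
pose y j u := if (dist u (v (n j)) <= r.+1)%N then x (P' (eta j r.+1 u)) else 0.
have [size_r _] := conv r r0; have [size_r1 convM] := conv r.+1 isT.
pose Mc j := conform_mx (0 : 'M[R[i]^o]_N) (local_matrix H (v (n j)) (eta j) r.+1).
(* This is the squared norm of the shifted operator applied to [y j], written in matrix entries;
   being a finite polynomial expression it passes to the limit. *)
pose E j := \sum_(i < N) (\sum_(k < N) x (P' k) * complex.Re (Mc j i k)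
   - a * x (P' i)) ^+ 2.
have dE : dot (shiftr (real_op H') a x) (shiftr (real_op H') a x) =
    \sum_(i < N) (\sum_(k < N) x (P' k) *
      complex.Re (local_matrix H' v0' eta' r.+1 i k) - a * x (P' i)) ^+ 2.
  rewrite (dot_label (r := r.+1) ceta')//; last exact: real_op_vanish.
  apply: eq_bigr => i _; rewrite -expr2; congr (_ ^+ 2).
  rewrite /shiftr /= mulNr (apply_label (r := r.+1) ceta')//; congr (_ - _).
  apply: eq_bigr => k _; rewrite mxE -/(label_inv v0' eta' r.+1).
  rewrite -rpart_delta -rpart_schrodinger//.
have Elim : E @ \oo --> dot (shiftr (real_op H') a x) (shiftr (real_op H') a x).
  rewrite dE; apply: cvg_sum_seq => i; rewrite expr2.
  have Sc : (fun j => \sum_(k < N) x (P' k) * complex.Re (Mc j i k) - a * x (P' i)) @ \oo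
      --> \sum_(k < N) x (P' k) * complex.Re (local_matrix H' v0' eta' r.+1 i k)
          - a * x (P' i).
    apply: cvgB; last exact: cvg_cst.
    apply: cvg_sum_seq => k; apply: cvgM; first exact: cvg_cst.
    exact: mx_cvg_entry convM.
  by have := cvgM Sc Sc; apply.
have far : \forall j \near \oo, forall u, u \in F -> ~ gball (v (n j)) r u.
  have [D _ FD] := bounded_gball F (v 0%N).
  have [m _ hm] := (cvgnyPge _).1 vinf (D + r).+1.
  have nge j : (j <= n j)%N.
    elim: j => // j IH; apply: leq_ltn_trans IH _; exact: ninc.
  exists m => // j /= mj u /FD; rewrite /gball /= => uD ur.
  have := hm (n j) (leq_trans mj (nge j)); rewrite /= ltnNge => /negP; apply.
  apply: leq_trans (dist_triangle _ u _) _.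
  by rewrite addnC leq_add// distC.
have dyy j : gball_size (v (n j)) r = gball_size v0' r ->
    gball_size (v (n j)) r.+1 = N ->
    [/\ forall u, ~ gball (v (n j)) r u -> y j u = 0,
        dot (y j) (y j) = dot x x &
        dot (shiftr (real_op H) a (y j)) (shiftr (real_op H) a (y j)) = E j].
  move=> sr_ sr1_.
  have yP k : (k < N)%N -> y j (P j k) = x (P' k).
    move=> kN; rewrite /y; have := label_inv_gball (ceta j) (ltn0Sn r) (k := k).
    rewrite sr1_ => /(_ kN); rewrite /gball /= => ->.
    by rewrite label_of_inv// ?sr1_.
  (* Coherence at radii [r] and [r + 1] and equality of the sizes at radius [r] show that the labels
     below that size mark exactly the smaller ball on both sides; so [y j] does not leak out of
     it. *)
  have y0 u : ~ gball (v (n j)) r u -> y j u = 0.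
    move=> ur; rewrite /y; case: ifP => // ur1; apply: x0 => Pr.
    apply: ur; set k := eta j r.+1 u in Pr.
    have kN : (k < N)%N by rewrite -sr1_; exact: label_lt.
    have eP : eta' r (P' k) = k.
      by rewrite -[RHS](label_of_inv ceta' (ltn0Sn r) kN) (ceta'.2 r r.+1)// r0 /=.
    have kr : (k < gball_size (v (n j)) r)%N.
      by rewrite sr_ -eP; exact: label_lt.
    have wb := label_inv_gball (ceta j) r0 kr.
    have : eta j r.+1 (label_inv (v (n j)) (eta j) r k) = k.
      rewrite ((ceta j).2 r r.+1)//; last by rewrite r0 /=.
      exact: label_of_inv.
    move=> /(congr1 (label_inv (v (n j)) (eta j) r.+1)).
    rewrite label_invK//; last by rewrite /gball /= leqW.
    by rewrite /k label_invK// => <-.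
  have y01 u : ~ gball (v (n j)) r.+1 u -> y j u = 0.
    by move=> ub; apply: y0; apply: contra_not ub; rewrite /gball /= => /leqW.
  split => //.
    rewrite (dot_label (r := r.+1) (ceta j))// (dot_label (r := r.+1) ceta')//.
    rewrite -/(P j) -/P' sr1_ -/N.
    by apply: eq_bigr => i _; rewrite yP.
  rewrite (dot_label (r := r.+1) (ceta j))//; last exact: real_op_vanish.
  rewrite sr1_ -/(P j); apply: eq_bigr => i _; rewrite -expr2; congr (_ ^+ 2).
  rewrite /shiftr /= mulNr yP// (apply_label (r := r.+1) (ceta j))//; congr (_ - _).
  rewrite sr1_ -/(P j); apply: eq_bigr => k _; rewrite yP// /Mc local_matrix_conform// mxE.
  by rewrite -rpart_delta -rpart_schrodinger.
near \oo => j.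
have sr_ : gball_size (v (n j)) r = gball_size v0' r by near: j.
have sr1_ : gball_size (v (n j)) r.+1 = N by near: j.
have farj : forall u, u \in F -> ~ gball (v (n j)) r u by near: j.
have [y0 yx yE] := dyy j sr_ sr1_.
exists (y j); split.
- exists (label_seq (v (n j)) (eta j) r) => u.
  by rewrite mem_label_seq// distC => /negP; exact: y0.
- by move=> u /farj; exact: y0.
- rewrite yx yE; near: j; exact: cvgr_lt Elim _ xlt.
Unshelve. all: by end_near. Qed.

End RLimitFarApprox.

(** * Regular trees *)

Section Tree.
Variables (T : graph) (d : nat).
Hypothesis hT : regular_tree d T.
Implicit Types (o p u v : T) (w : seq nat).

Lemma regular_tree_bounded : bounded_degree T.
Proof. by have [_ _ hn] := hT; exists d => v; move: (hn v); rewrite card_eq_le => /andP[]. Qed.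

Let hG := regular_tree_bounded.

Lemma size_nbs v : size (nbs v) = d.
Proof. by have [_ _ hn] := hT; exact: card_fset_set (hn v). Qed.

(** The strict decrease of the distance is what keeps such a path away from a vertex at least as far
    from [p] as [u]. *)
Lemma path_to_base p u : exists q, [/\ path (@adj T) u q, last u q = p &
  forall z, z \in q -> (dist p z < dist p u)%N].
Proof.
move en : (dist p u) => n; elim: n u en => [|n IH] u en.
  by exists [::]; split=> //=; rewrite (dist_eq0 en).
have [w wu dw] := dist_pred en; have [q [pq lq hq]] := IH w dw.
exists (w :: q); split=> //=; first by rewrite adj_sym wu.
by move=> z; rewrite inE => /predU1P[->|/hq /ltnW]; rewrite ?dw ltnS.
Qed.

(* Two neighbours of [v] not farther from [p] than [v] are joined by a walk
   through [p] that avoids [v], which would close up to a cycle. *)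
Lemma unique_parent p v u u' : adj v u -> adj v u' ->
  (dist p u <= dist p v)%N -> (dist p u' <= dist p v)%N -> u = u'.
Proof.
move=> vu vu' du du'; have [//|uu'] := eqVneq u u'; exfalso.
have [_ acyc _] := hT.
have [q [pq lq hq]] := path_to_base p u.
have [q' [pq' lq' hq']] := path_to_base p u'.
pose z := rev (belast u' q').
have pz : path (@adj T) p z.
  by rewrite -lq' rev_path (eq_path (e' := @adj T)) // => a b; exact: adj_sym.
have lz : last p z = u'.
  by rewrite /z; case: (q') lq' => [|w r] //= _; rewrite rev_cons last_rcons.
have vq : v \notin u :: (q ++ z).
  have vN x y : adj v x -> (dist p x <= dist p v)%N -> last x y = p ->
      (forall t, t \in y -> (dist p t < dist p x)%N) -> v \notin x :: y.
    move=> vx dx _ hy; rewrite inE negb_or; apply/andP; split.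
      by apply/eqP => h; move: vx; rewrite h adj_irr.
    by apply/negP => /hy; rewrite ltnNge dx.
  have := vN u q vu du lq hq; have := vN u' q' vu' du' lq' hq'.
  rewrite !inE mem_cat !negb_or => /andP[a b] /andP[-> ->] /=.
  rewrite /z mem_rev; apply/negP => /mem_belast.
  by rewrite inE (negbTE a) (negbTE b).
have puz : path (@adj T) u (q ++ z) by rewrite cat_path pq lq.
have luz : last u (q ++ z) = u' by rewrite last_cat lq.
case/shortenP: puz luz => s ps us sub ls.
apply: (acyc (v :: u :: s)).
  by rewrite /= !ltnS; case: s ps us sub ls => //= _ _ _ /esym/eqP; rewrite eq_sym (negbTE uu').
rewrite /ucycle /cycle; apply/andP; split.
  by rewrite rcons_cons /= vu rcons_path ps ls adj_sym.
rewrite cons_uniq us andbT; apply: contra vq.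
rewrite !inE => /predU1P[->|vs]; first by rewrite eqxx.
by rewrite mem_cat; apply/orP; right; have := sub _ vs; rewrite mem_cat.
Qed.

(** Trees are bipartite: a neighbour at equal distance would be a second neighbour of [v] not
    farther from [p], besides the one on the way to [p]. *)
Lemma adj_dist p v u : adj v u ->
  (dist p u == (dist p v).+1) || (dist p v == (dist p u).+1).
Proof.
move=> vu; have uv : adj u v by rewrite adj_sym.
have h1 := dist_adj p vu; have h2 := dist_adj p uv.
have [e|] := eqVneq (dist p u) (dist p v); last by lia.
exfalso; case dv : (dist p v) => [|n].
  have pv := dist_eq0 dv; have pu := dist_eq0 (etrans e dv).
  by move: vu; rewrite -pv -pu adj_irr.
have [w wv dw] := dist_pred dv; rewrite adj_sym in wv.
have uw : u = w by apply: (unique_parent vu wv (p := p)); lia.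
by move: e; rewrite uw dw dv; lia.
Qed.

(** The default value makes the base point its own parent, so that ancestors can be taken by plain
    iteration. *)
Definition parent p v : T := head v [seq u <- nbs v | (dist p u < dist p v)%N].

Lemma parentP p v : v != p -> adj v (parent p v) /\ dist p v = (dist p (parent p v)).+1.
Proof.
move=> vp; case dv : (dist p v) => [|n]; first by rewrite (dist_eq0 dv) eqxx in vp.
have [w wv dw] := dist_pred dv; rewrite /parent dv.
have : w \in [seq u <- nbs v | (dist p u < n.+1)%N].
  by rewrite mem_filter dw ltnSn mem_nbs// adj_sym.
case E : [seq u <- nbs v | _] => [//|x s] _ /=.
have : x \in [seq u <- nbs v | (dist p u < n.+1)%N] by rewrite E mem_head.
rewrite mem_filter mem_nbs// => /andP[xn vx]; split=> //.
by have := dist_adj p (_ : adj x v); rewrite adj_sym => /(_ vx); rewrite dv; lia.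
Qed.

Lemma parent_unique p v u : adj v u -> (dist p u < dist p v)%N -> u = parent p v.
Proof.
move=> vu uv; have vp : v != p by apply/eqP => h; move: uv; rewrite h distxx.
have [a b] := parentP vp; apply: (unique_parent vu a (p := p)); lia.
Qed.

Lemma parent_id p : parent p p = p.
Proof.
rewrite /parent (_ : [seq _ <- _ | _] = [::])//.
by apply/eqP; rewrite -size_eq0 size_filter eqn0Ngt -has_count; apply/hasPn => u _; rewrite distxx.
Qed.

Definition children p v : seq T := [seq u <- nbs v | (dist p v < dist p u)%N].

Lemma mem_children p v u : (u \in children p v) = adj v u && (dist p v < dist p u)%N.
Proof. by rewrite mem_filter mem_nbs// andbC. Qed.

Lemma children_uniq p v : uniq (children p v).
Proof. by rewrite filter_uniq// nbs_uniq. Qed.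

Lemma size_children p v : size (children p v) = if v == p then d else d.-1.
Proof.
case: eqVneq => [->|vp].
  rewrite -(size_nbs p) /children (eq_in_filter (a2 := predT)) ?filter_predT//.
  by move=> u; rewrite mem_nbs// distxx => /adj_dist1 ->.
have [a b] := parentP vp.
have : perm_eq (nbs v) (parent p v :: children p v).
  apply: uniq_perm; first exact: nbs_uniq.
    by rewrite cons_uniq children_uniq andbT mem_children b; lia.
  move=> u; rewrite inE mem_children mem_nbs//.
  have [->|up] := eqVneq u (parent p v); first by rewrite a.
  case vu : (adj v u) => //=; apply/esym/negbNE/negP => h; move/eqP: up; apply.
  apply: parent_unique => //; have := adj_dist p vu; lia.
by move=> /perm_size; rewrite size_nbs /= => ->.
Qed.

(* The children of [v] as seen from [p], the one on the way to [o] first. *)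
Definition ochildren o p v : seq T :=
  if parent o v \in children p v then parent o v :: rem (parent o v) (children p v)
  else children p v.

Lemma perm_ochildren o p v : perm_eq (ochildren o p v) (children p v).
Proof.
by rewrite /ochildren; case: ifP => // h; rewrite perm_sym; exact: perm_to_rem.
Qed.

Lemma ochildren_uniq o p v : uniq (ochildren o p v).
Proof. by rewrite (perm_uniq (perm_ochildren o p v)) children_uniq. Qed.

Lemma size_ochildren o p v : size (ochildren o p v) = if v == p then d else d.-1.
Proof. by rewrite (perm_size (perm_ochildren o p v)) size_children. Qed.

Lemma mem_ochildren o p v u : (u \in ochildren o p v) = adj v u && (dist p v < dist p u)%N.
Proof. by rewrite (perm_mem (perm_ochildren o p v)) mem_children. Qed.

(** The base point has [d] children and every other vertex [d - 1], one neighbour being the way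
    back; hence the separate bound for the earliest step, the last letter. *)
Fixpoint valid (w : seq nat) : bool :=
  if w is i :: w' then (i < (if w' is [::] then d else d.-1))%N && valid w' else true.

(* Vertices of [T] addressed by words from the base point [p]; the most recent
   step is the head of the word. *)
Fixpoint addr o p (w : seq nat) : T :=
  if w is i :: w' then nth (addr o p w') (ochildren o p (addr o p w')) i else p.

Lemma addr_child o p i w : valid (i :: w) -> dist p (addr o p w) = size w ->
  addr o p (i :: w) \in ochildren o p (addr o p w).
Proof.
move=> /= /andP[iw vw] dw; apply: mem_nth; rewrite size_ochildren.
case: w iw vw dw => [|j w] iw vw dw; first by rewrite eqxx.
by case: eqVneq => // h; move: dw; rewrite h distxx.
Qed.

Lemma dist_addr o p w : valid w -> dist p (addr o p w) = size w.
Proof.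
elim: w => [|i w IH] vw; first by rewrite distxx.
have vw' : valid w by case/andP: vw.
have := addr_child vw (IH vw'); rewrite mem_ochildren => /andP[a].
by have := dist_adj p a; rewrite (IH vw') -[size (i :: w)]/(size w).+1; lia.
Qed.

Lemma adj_addr o p i w : valid (i :: w) -> adj (addr o p w) (addr o p (i :: w)).
Proof.
move=> vw; have vw' : valid w by case/andP: vw.
by have := addr_child vw (dist_addr o p vw'); rewrite mem_ochildren => /andP[].
Qed.

Lemma addr_parent o p i w : valid (i :: w) -> parent p (addr o p (i :: w)) = addr o p w.
Proof.
move=> vw; have vw' : valid w by case/andP: vw.
apply/esym/parent_unique; first by rewrite adj_sym; exact: adj_addr.
by rewrite (dist_addr o p vw) (dist_addr o p vw').
Qed.

Lemma addr_inj o p w w' : valid w -> valid w' -> addr o p w = addr o p w' -> w = w'.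
Proof.
elim: w w' => [|i w IH] [|j w'] vw vw' // e.
- by have := dist_addr o p vw'; rewrite -e distxx.
- by have := dist_addr o p vw; rewrite e distxx.
have v1 : valid w by case/andP: vw.
have v2 : valid w' by case/andP: vw'.
have ww : w = w'.
  by apply: IH => //; rewrite -(addr_parent o p vw) -(addr_parent o p vw') e.
subst w'; congr (_ :: _).
have s1 : size (ochildren o p (addr o p w)) = if w is [::] then d else d.-1.
  rewrite size_ochildren; case: (w) v1 => [|k u] vu; first by rewrite eqxx.
  by case: eqVneq => // h; have := dist_addr o p vu; rewrite h distxx.
apply/eqP; rewrite -(nth_uniq (addr o p w) _ _ (ochildren_uniq o p (addr o p w))) ?s1.
- by apply/eqP.
- by case/andP: vw.
- by case/andP: vw'.
Qed.

Lemma addr_surj o p v : exists2 w, valid w & addr o p w = v.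
Proof.
move en : (dist p v) => n; elim: n v en => [|n IH] v en.
  by exists [::] => //=; exact: dist_eq0.
have vp : v != p by apply/eqP => h; move: en; rewrite h distxx.
have [a b] := parentP vp.
have [|w vw wv] := IH (parent p v); first by lia.
have vc : v \in ochildren o p (addr o p w).
  by rewrite wv mem_ochildren adj_sym a b ltnSn.
have iw : (index v (ochildren o p (addr o p w)) < size (ochildren o p (addr o p w)))%N.
  by rewrite index_mem.
exists (index v (ochildren o p (addr o p w)) :: w) => /=; last exact: nth_index.
rewrite vw andbT; move: iw; rewrite size_ochildren.
case: (w) vw => [|k u] vu; first by rewrite eqxx.
by case: eqVneq => // h; have := dist_addr o p vu; rewrite h distxx.
Qed.

(** Since [ochildren] lists the way to [o] first, such a word walks straight towards [o] until it
    gets there. *)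
Definition ups (w : seq nat) := all (pred1 0%N) w.

(* Distance to [o] of the vertex with address [w] from a point at distance [m],
   as long as [size w <= m]. *)
Fixpoint level (m : nat) (w : seq nat) : nat :=
  if w is i :: w' then
    if ups w then (level m w').-1 else (level m w').+1
  else m.

Lemma level_ups m w : ups w -> (size w <= m)%N -> level m w = (m - size w)%N.
Proof.
elim: w => [|i w IH] uw sw; first by rewrite subn0.
rewrite /level -/level uw IH ?(ltnW sw)//; last by case/andP: uw.
by move: sw => /=; lia.
Qed.

(** The claims about parents make the induction work. While climbing, the vertex just left is
    farther from [o], so the next step towards [o] is still a child. After the first turn the
    parents seen from [p] and from [o] agree, so every later step leads away from [o]. *)
Lemma dist_addr_level_parent o p w : valid w -> (size w <= dist o p)%N ->
  [/\ dist o (addr o p w) = level (dist o p) w,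
      ups w -> addr o p w != p ->
        (dist o (addr o p w) < dist o (parent p (addr o p w)))%N &
      ~~ ups w -> parent p (addr o p w) = parent o (addr o p w)].
Proof.
elim: w => [|i w IH] vw sw; first by split=> //=; rewrite eqxx.
have vw' : valid w by case/andP: vw.
have sw' : (size w <= dist o p)%N := ltnW sw.
have [l1 l2 l3] := IH vw' sw'.
have a := adj_addr o p vw; have pa := addr_parent o p vw.
have dpa := dist_addr o p vw'; have dpa' := dist_addr o p vw.
have other : addr o p (i :: w) <> parent o (addr o p w) ->
    dist o (addr o p (i :: w)) = (dist o (addr o p w)).+1 /\
    parent p (addr o p (i :: w)) = parent o (addr o p (i :: w)).
  move=> h; suff e : dist o (addr o p (i :: w)) = (dist o (addr o p w)).+1.
    by split=> //; rewrite pa; apply: parent_unique; rewrite ?e// adj_sym.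
  have /orP[/eqP //|/eqP e] := adj_dist o a.
  by case: h; apply: parent_unique => //; lia.
rewrite pa; have [uw|nuw] := boolP (ups w); last first.
  have e := l3 nuw.
  have ap : addr o p w != p.
    apply/eqP => h; move: dpa nuw; rewrite h distxx.
    by case: (w).
  have [] := other.
    move=> h; have [_ b] := parentP ap.
    by move: b dpa'; rewrite e -h dpa /= => ->; lia.
  move=> d1 d2; have nui : ups (i :: w) = false.
    by rewrite /ups /= -/(ups w) (negbTE nuw) andbF.
  by split; [rewrite /level -/level nui d1 l1 | rewrite nui | rewrite -pa].
have lw : dist o (addr o p w) = (dist o p - size w)%N by rewrite l1 level_ups.
have wo : addr o p w != o.
  by apply/eqP => e; move: lw sw; rewrite e distxx /=; lia.
have [apar dpar] := parentP wo.
(* If the step towards [o] were not a child seen from [p], it would be the parent seen from [p],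
   which is farther from [o]. *)
have pc : parent o (addr o p w) \in children p (addr o p w).
  rewrite mem_children apar /= ltnNge; apply/negP => le.
  have lt : (dist p (parent o (addr o p w)) < dist p (addr o p w))%N.
    by have := adj_dist p apar; lia.
  have pp := parent_unique apar lt.
  have ap : addr o p w != p by apply/eqP => h; move: lt; rewrite {2}h distxx.
  by have := l2 uw ap; rewrite -pp dpar; lia.
have och : ochildren o p (addr o p w) =
    parent o (addr o p w) :: rem (parent o (addr o p w)) (children p (addr o p w)).
  by rewrite /ochildren pc.
case: i vw sw a pa dpa' other => [|i] vw sw a pa dpa' other.
  have e : addr o p (0%N :: w) = parent o (addr o p w) by rewrite /= och.
  have u0 : ups (0%N :: w) by rewrite /ups /= -/(ups w) uw.
  split; rewrite ?u0//; last by move=> _ _; rewrite e dpar.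
  by rewrite /level -/level u0 e -l1 dpar.
have ui : ups (i.+1 :: w) = false by [].
have [] := other.
  set P := parent o _ in och *; set s := rem _ _ in och => h.
  have si : (i < size s)%N.
    have := size_ochildren o p (addr o p w); rewrite och /= => sz.
    case/andP: vw => iw _; rewrite -ltnS sz.
    case: (w) dpa iw => [|k u] dpa iw; first by rewrite eqxx.
    by case: eqVneq => // h'; move: dpa; rewrite h' distxx.
  have : addr o p (i.+1 :: w) = nth (addr o p w) s i by rewrite /= och.
  rewrite h => e; have := ochildren_uniq o p (addr o p w).
  by rewrite och /= e mem_nth.
move=> d1 d2; split; rewrite ?ui//.
  by rewrite /level -/level ui d1 l1.
by move=> _; rewrite -pa.
Qed.

Lemma dist_addr_level o p w : valid w -> (size w <= dist o p)%N ->
  dist o (addr o p w) = level (dist o p) w.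
Proof. by move=> vw sw; have [] := dist_addr_level_parent vw sw. Qed.

End Tree.

(** * Graph isomorphisms, coherent labels and R-limits *)

Section GraphIso.
Variables (G G' : graph) (f : G' -> G) (g : G -> G').
Hypotheses (fK : cancel f g) (gK : cancel g f)
  (fadj : forall u v, adj (f u) (f v) = adj u v).

Lemma dist_iso u v : dist (f u) (f v) = dist u v.
Proof.
apply/eqP; rewrite eqn_leq; apply/andP; split.
  have [p [pp <- <-]] := dist_walk u v.
  rewrite -(size_map f) -last_map; apply: dist_path.
  by rewrite path_map (eq_path (e' := @adj G')) // => x y /=; rewrite fadj.
have [p [pp lp <-]] := dist_walk (f u) (f v).
have -> : v = last u (map g p) by rewrite -{1}(fK u) last_map lp fK.
rewrite -(size_map g); apply: dist_path.
rewrite -{1}(fK u) path_map (eq_path (e' := @adj G)) // => x y /=.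
by rewrite -fadj !gK.
Qed.

Lemma gball_bij v r : set_bij (gball (f v) r) (gball v r) g.
Proof.
split.
- by move=> u; rewrite /gball /= -{1}(gK u) dist_iso.
- by move=> x y _ _ h; rewrite -(gK x) h gK.
- by move=> u uv; exists (f u); rewrite ?fK// /gball /= dist_iso.
Qed.

End GraphIso.

Section Enumeration.
Variables (G : graph) (hG : bounded_degree G) (v : G).

(** Each ball is listed as an extension of the previous one, so that the index of a vertex is the
    same at every radius that contains it: this is coherence. *)
Fixpoint ball_seq r : seq G :=
  if r is r'.+1 then
    ball_seq r' ++ [seq u <- fset_set (gball v r) | u \notin ball_seq r']
  else fset_set (gball v 0).

Lemma mem_ball_seq r u : (u \in ball_seq r) = (dist u v <= r)%N.
Proof.
have mem s : (u \in (fset_set (gball v s) : seq G)) = (dist u v <= s)%N.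
  rewrite in_fset_set; last exact: gball_finite.
  by apply/idP/idP; rewrite inE.
elim: r => [|r IH]; rewrite ?[ball_seq _.+1]/= ?mem //.
rewrite mem_cat mem_filter mem IH; case: leqP => //= h.
by rewrite leqW.
Qed.

Lemma ball_seq_uniq r : uniq (ball_seq r).
Proof.
elim: r => [|r IH]; first exact: fset_uniq.
rewrite /= cat_uniq IH filter_uniq ?fset_uniq// andbT.
by apply/hasPn => u; rewrite mem_filter => /andP[].
Qed.

Lemma size_ball_seq r : size (ball_seq r) = gball_size v r.
Proof.
apply: perm_size; apply: uniq_perm; [exact: ball_seq_uniq|exact: fset_uniq|].
move=> u; rewrite mem_ball_seq in_fset_set; last exact: gball_finite.
by apply/idP/idP; rewrite inE.
Qed.

Definition ball_index u := index u (ball_seq (dist u v)).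

Lemma ball_indexE r u : (dist u v <= r)%N -> ball_index u = index u (ball_seq r).
Proof.
elim: r => [|r IH]; rewrite /ball_index; first by rewrite leqn0 => /eqP ->.
rewrite leq_eqVlt => /orP[/eqP -> //|h].
by rewrite -/(ball_index u) IH// /= index_cat mem_ball_seq -ltnS h.
Qed.

Lemma ball_index_bij r : set_bij (gball v r) `I_(gball_size v r) ball_index.
Proof.
split.
- move=> u; rewrite /gball /= => ur.
  by rewrite (ball_indexE ur) -size_ball_seq index_mem mem_ball_seq.
- move=> x y; rewrite !inE /gball /= => xr yr.
  rewrite (ball_indexE xr) (ball_indexE yr) => h.
  have xm : x \in ball_seq r by rewrite mem_ball_seq.
  have ym : y \in ball_seq r by rewrite mem_ball_seq.
  by rewrite -(nth_index v xm) h nth_index.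
- move=> k /=; rewrite -size_ball_seq => kr; exists (nth v (ball_seq r) k).
    by rewrite /gball /= -mem_ball_seq mem_nth.
  rewrite (@ball_indexE r) ?index_uniq ?ball_seq_uniq// -mem_ball_seq.
  exact: mem_nth.
Qed.

Lemma coherent_ball_index : coherent_sequence v (fun=> ball_index).
Proof. by split=> // r _; exact: ball_index_bij. Qed.

End Enumeration.

Section RLimitOfIso.
Variables (R : realType) (T G' : graph) (hT : bounded_degree T) (hG' : bounded_degree G').
Variables (H : schrodinger_operator R T) (H' : schrodinger_operator R G').

Lemma entryE (G : graph) (hG : bounded_degree G) (K : schrodinger_operator R G) (u w : G) :
  K (delta R u) w = (adj w u)%:R + ((weight K w)%:C)%C * (w == u)%:R.
Proof.
rewrite schrodingerE//; congr (_ + _).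
have [wu|wu] := boolP (adj w u); last first.
  rewrite big1_seq// => z /=; rewrite mem_nbs// => wz; rewrite /delta.
  by case: eqVneq => // zu; move: wu; rewrite -zu wz.
rewrite (bigD1_seq u) ?nbs_uniq ?mem_nbs//= /delta eqxx big1 ?addr0// => z zu.
by rewrite (negbTE zu).
Qed.

Lemma perm_nbs_iso (f : G' -> T) (g : T -> G') : cancel f g -> cancel g f ->
  (forall u v, adj (f u) (f v) = adj u v) ->
  forall w, perm_eq (nbs (f w)) (map f (nbs w)).
Proof.
move=> fK gK fadj w; apply: uniq_perm; first exact: nbs_uniq.
  by rewrite map_inj_uniq ?nbs_uniq//; exact: can_inj fK.
move=> u; rewrite mem_nbs//; apply/idP/mapP => [wu|[x]].
  by exists (g u); rewrite ?gK// mem_nbs// -fadj gK.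
by rewrite mem_nbs// => wx ->; rewrite fadj.
Qed.

Lemma size_nbs_iso (f : G' -> T) (g : T -> G') : cancel f g -> cancel g f ->
  (forall u v, adj (f u) (f v) = adj u v) ->
  forall w, size (nbs (f w)) = size (nbs w).
Proof.
by move=> fK gK fadj w; rewrite (perm_size (perm_nbs_iso fK gK fadj w)) size_map.
Qed.

(** Labels are pulled back from one enumeration around [v0'] through the isomorphisms. The local
    matrices then differ from the limit only by potentials on the diagonal, and a ball has finitely
    many vertices. *)
Lemma R_limit_of_iso (v : nat -> T) (n : nat -> nat) (v0' : G')
    (f : nat -> G' -> T) (g : nat -> T -> G') :
  path_to_infinity v -> {homo n : i j / (i < j)%N} ->
  (forall j, cancel (f j) (g j)) -> (forall j, cancel (g j) (f j)) ->
  (forall j u w, adj (f j u) (f j w) = adj u w) ->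
  (forall j, f j v0' = v (n j)) ->
  (forall w, (fun j => potential H (f j w)) @ \oo --> potential H' w) ->
  R_limit H H' v0'.
Proof.
move=> vinf ninc fK gK fadj f0 pot; split=> //; exists v => //; exists n; split=> //.
pose e := ball_index v0'.
have bij j r : set_bij (gball (v (n j)) r) `I_(gball_size v0' r) (e \o g j).
  rewrite -f0; apply: set_bij_comp; last exact: ball_index_bij.
  exact: gball_bij.
have szE j r : gball_size (v (n j)) r = gball_size v0' r.
  by apply: card_fset_set; apply/card_set_bijP; exists (e \o g j).
exists (fun j _ => e \o g j), (fun=> e).
have coh j : coherent_sequence (v (n j)) (fun=> e \o g j).
  by split=> // r _; rewrite szE; exact: bij.
have coh' : coherent_sequence v0' (fun=> e) by exact: coherent_ball_index.
split=> // r r0; split; first by near=> j; exact: szE.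
apply/cvg_ballP => eps eps0.
have [del del0 epsE] : exists2 del : R, 0 < del & eps = (del%:C)%C.
  move: eps0; case: (eps) => p q; rewrite ltcE /= => /andP[/eqP -> p0].
  by exists p.
pose P' := label_inv v0' (fun=> e) r.
have : \forall j \near \oo, forall i : 'I_(gball_size v0' r),
    `|potential H' (P' i) - potential H (f j (P' i))| < del.
  apply: filter_forall => i.
  exact: ((cvgrPdist_lt _ _).1 (pot (P' i)) _ del0).
apply: filterS => j close; split=> // i k.
rewrite local_matrix_conform// !mxE -!/(label_inv _ _ _) -/(P' i) -/(P' k).
have PE (l : 'I_(gball_size v0' r)) :
    label_inv (v (n j)) (fun=> e \o g j) r l = f j (P' l).
  have lN : (l < gball_size (v (n j)) r)%N by rewrite szE.
  have gb := label_inv_gball (coh j) r0 lN.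
  have := label_of_inv (coh j) r0 lN; rewrite /= => h.
  apply: (can_inj (gK j)); rewrite fK /P' -{2}h; symmetry.
  apply: (label_invK coh' r0).
  by rewrite /gball /= -(dist_iso (fK j) (gK j) (fadj j)) gK f0.
rewrite !PE !entryE// fadj (can_eq (fK j)) /ball /=.
rewrite epsE opprD addrACA subrr add0r -mulrBl -rmorphB /weight.
rewrite (size_nbs_iso (fK j) (gK j) (fadj j)) opprB addrA subrK.
rewrite normrM norm_complex_real; case: (_ == _); last by rewrite normr0 mulr0 ltcR.
by rewrite normr1 mulr1 ltcR.
Unshelve. all: by end_near. Qed.

End RLimitOfIso.

(** * The tree of words as a common model *)

Section WordGraph.
Variables (T : graph) (d : nat).
Hypothesis hT : regular_tree d T.
Variable o0 : T.

(** The vertex set depends on [d] alone: every base point of [T] identifies [T] with it, so that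
    potentials seen from different points become functions on one fixed set. *)
Definition word := {w : seq nat | valid d w}.

Definition word_adj : rel word := fun u w =>
  ((sval w != [::]) && (behead (sval w) == sval u)) ||
  ((sval u != [::]) && (behead (sval u) == sval w)).

Lemma word_adj_sym : symmetric word_adj.
Proof. by move=> u w; rewrite /word_adj orbC. Qed.

Lemma word_adj_irr : irreflexive word_adj.
Proof.
move=> [[|i w] vw]; rewrite /word_adj //= orbb; apply/eqP => h.
by have /eqP := congr1 size h; rewrite /= ltn_eqF.
Qed.

Definition word_addr o p (w : word) : T := addr o p (sval w).

Lemma word_addr_inj o p : injective (word_addr o p).
Proof.
by move=> [u vu] [w vw] h; apply: val_inj => /=; exact: (addr_inj hT vu vw h).
Qed.

Lemma word_addr_adj o p u w : adj (word_addr o p u) (word_addr o p w) = word_adj u w.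
Proof.
have imp (a b : word) : sval b != [::] -> behead (sval b) = sval a ->
    adj (word_addr o p a) (word_addr o p b).
  case: a b => [a va] [[|i b] vb] //= _ e; subst a.
  exact: (adj_addr hT _ _ vb).
have conv (a b : word) : adj (word_addr o p a) (word_addr o p b) ->
    size (sval b) = (size (sval a)).+1 -> behead (sval b) = sval a.
  case: a b => [a va] [[|i b] vb] //= ab [sab].
  have vb' : valid d b by have /andP[] : valid d (i :: b) := vb.
  apply: (addr_inj hT vb' va (o := o) (p := p)).
  rewrite -(addr_parent hT o p vb); apply/esym; apply: (parent_unique hT).
    by rewrite adj_sym.
  by rewrite -/(addr o p (i :: b)) (dist_addr hT _ _ va) (dist_addr hT _ _ vb) /= sab.
apply/idP/idP => [uw|/orP[/andP[w0 /eqP e]|/andP[u0 /eqP e]]].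
- have wu : adj (word_addr o p w) (word_addr o p u) by rewrite adj_sym.
  have := adj_dist hT p uw.
  rewrite (dist_addr hT _ _ (valP u)) (dist_addr hT _ _ (valP w)) => /orP[] /eqP e.
    have {}e : size (sval w) = (size (sval u)).+1 := e.
    by rewrite /word_adj (conv u w)// eqxx andbT -size_eq0 e.
  have {}e : size (sval u) = (size (sval w)).+1 := e.
  by rewrite /word_adj (conv w u)// eqxx andbT orbC -size_eq0 e.
- exact: imp.
- by rewrite adj_sym; exact: imp.
Qed.

Lemma word_addr_bij o p : exists g : T -> word,
  cancel (word_addr o p) g /\ cancel g (word_addr o p).
Proof.
have surj v : exists w : word, word_addr o p w = v.
  by have [w vw wv] := addr_surj hT o p v; exists (exist _ w vw).
have [g hg] := choice surj.
by exists g; split=> // w; apply: (@word_addr_inj o p); rewrite hg.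
Qed.

Lemma word_adj_connected (u v : word) : exists p, path word_adj u p /\ last u p = v.
Proof.
have [g [fK gK]] := word_addr_bij o0 o0.
have [p [pp lp]] := adj_connected (word_addr o0 o0 u) (word_addr o0 o0 v).
exists (map g p); rewrite -{1 2}(fK u) path_map last_map lp; split=> //.
rewrite (eq_path (e' := @adj T)) // => x y /=.
by rewrite -(word_addr_adj o0 o0) !gK.
Qed.

Definition word_graph : graph := Graph word_adj_sym word_adj_irr word_adj_connected.

Lemma word_graph_bounded : bounded_degree word_graph.
Proof.
have [k hk] := regular_tree_bounded hT; exists k => w.
pose f : word_graph -> T := word_addr o0 o0.
have := inj_card_eq (A := neighbours w) (f := f).
move=> /(_ _)/card_esym; rewrite card_eq_le => h.
have /andP[h1 _] := h (in2W (@word_addr_inj o0 o0)).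
apply: card_le_trans h1 _; apply: card_le_trans (hk (f w)).
by apply: subset_card_le => _ [u uw <-]; rewrite /neighbours /= word_addr_adj.
Qed.

End WordGraph.

(** * Localisation on trees *)

Section Tent.
Variables (R : realType) (D : nat).
Hypothesis D0 : (0 < D)%N.

(** Truncated subtraction makes it vanish from [2 D] on; the peak [D] is at [j = D]. *)
Definition tent (j : nat) : R := (minn j (2 * D - j))%:R.

Lemma tent0 : tent 0 = 0.
Proof. by rewrite /tent min0n. Qed.

Lemma tent_big j : (2 * D <= j)%N -> tent j = 0.
Proof. by rewrite -subn_eq0 /tent => /eqP ->; rewrite minn0. Qed.

Lemma tent_step j : (tent j.+1 - tent j) ^+ 2 <= 1.
Proof.
rewrite /tent; set a := minn _ _; set b := minn _ _.
have : a = b \/ a = b.+1 \/ b = a.+1 by rewrite /a /b; lia.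
case=> [->|[->|->]]; first by rewrite subrr expr0n ler01.
  by rewrite -natr1 addrAC subrr add0r expr1n.
by rewrite -natr1 opprD addrA subrr add0r sqrrN expr1n.
Qed.

Definition tent_mass : R := \sum_(c < 2 * D) tent (2 * D - c) ^+ 2.

(** The peak alone is enough: the mass is of order at least [D^2], against a variation of order
    [D]. *)
Lemma tent_mass_ge : (D * D)%:R <= tent_mass.
Proof.
have Dlt : (D < 2 * D)%N by lia.
rewrite /tent_mass (bigD1 (Ordinal Dlt))//= /tent.
have -> : minn (2 * D - D) (2 * D - (2 * D - D)) = D by lia.
by rewrite natrM -expr2 lerDl sumr_ge0// => c _; rewrite sqr_ge0.
Qed.

(** Squared translates form a partition of unity up to a constant that does not depend on the
    position [l]. *)
Lemma tent_partition l K : (l + 2 * D <= K)%N ->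
  \sum_(c < K) tent (l + 2 * D - c) ^+ 2 = tent_mass.
Proof.
elim: l K => [|l IH] [|K] lK.
- by rewrite /tent_mass; have -> : (2 * D = 0)%N by lia.
- rewrite add0n in lK *; rewrite /tent_mass.
  rewrite [RHS](big_ord_widen K.+1 (fun c => tent (2 * D - c) ^+ 2))//.
  rewrite [LHS](bigID (fun c : 'I_K.+1 => (c < 2 * D)%N)) /= [X in _ + X]big1 ?addr0// => c.
  rewrite -leqNgt -subn_eq0 => /eqP ->.
  by rewrite tent0 expr0n.
- by lia.
- rewrite big_ord_recl subn0 tent_big ?expr0n ?add0r; last by lia.
  rewrite -(IH K); last by lia.
  by apply: eq_bigr => c _; congr (tent _ ^+ 2); rewrite /= /bump; lia.
Qed.

(** At most [2 D + 1] translates distinguish two consecutive positions, each by at most 1. *)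
Lemma tent_variation l K :
  \sum_(c < K) (tent (l.+1 + 2 * D - c) - tent (l + 2 * D - c)) ^+ 2 <= (2 * D).+1%:R.
Proof.
elim: l K => [|l IH] [|K]; rewrite ?big_ord0//.
- suff h k : \sum_(c < k) (tent (1 + 2 * D - c) - tent (0 + 2 * D - c)) ^+ 2
      <= (minn k (2 * D).+1)%:R.
    by apply: le_trans (h _) _; rewrite ler_nat geq_minr.
  elim: k => [|k IH]; first by rewrite big_ord0.
  rewrite big_ord_recr /=; have [kD|kD] := leqP k (2 * D).
    have -> : minn k.+1 (2 * D).+1 = (minn k (2 * D).+1).+1 by lia.
    rewrite -natr1; apply: lerD IH _.
    by rewrite (_ : 1 + 2 * D - k = (0 + 2 * D - k).+1)%N ?tent_step//; lia.
  have -> : (1 + 2 * D - k = 0)%N by lia.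
  have -> : (0 + 2 * D - k = 0)%N by lia.
  rewrite subrr expr0n addr0; apply: le_trans IH _; rewrite ler_nat; lia.
- rewrite big_ord_recl !subn0 !tent_big ?subrr ?expr0n ?add0r; try lia.
  apply: le_trans (IH K); rewrite le_eqVlt; apply/orP; left; apply/eqP.
  apply: eq_bigr => c _; congr ((tent _ - tent _) ^+ 2); rewrite /= /bump; lia.
Qed.

End Tent.

Lemma pigeonhole_ltr (R : realType) (I : eqType) (s : seq I) (p q : I -> R) :
  \sum_(i <- s) p i < \sum_(i <- s) q i -> exists2 i, i \in s & p i < q i.
Proof.
move=> h; apply: contrapT => no; move: h; rewrite ltNge => /negP; apply.
rewrite big_seq [leRHS]big_seq; apply: ler_sum => i si.
by rewrite leNgt; apply/negP => lt; apply: no; exists i.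
Qed.

Section Decouple.
Variables (R : realType) (V : choiceType) (nb : V -> seq V) (w : V -> R).
Variables (A : (V -> R) -> V -> R).
Hypotheses (hA : sym_local A) (AE : A = hop nb w).

(** Where [x] vanishes at both ends of every edge joining two classes of [kappa], restriction to a
    class commutes with [A]. Both squared norms are then sums over the classes, and some class
    satisfies the inequality. *)
Lemma decouple (kappa : V -> V) (x : V -> R) (b : R) : fsupp x ->
  (forall u v, u \in nb v -> kappa u != kappa v -> x u = 0 /\ x v = 0) ->
  dot (A x) (A x) < b * dot x x ->
  exists z, let y := fun v => if kappa v == z then x v else 0 in
    dot (A y) (A y) < b * dot y y.
Proof.
move=> fx sep lt.
pose y z v := if kappa v == z then x v else 0.
have Ay z v : A (y z) v = if kappa v == z then A x v else 0.
  rewrite AE /hop /y; case: eqVneq => [<-|kz].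
    congr (_ + _); apply: eq_big_seq => u uv.
    case: eqVneq => // ku; by have [] := sep u v uv ku.
  rewrite mulr0 addr0 big1_seq// => u /= uv; case: eqVneq => // ku.
  by have [] := sep u v uv; first by rewrite ku eq_sym.
have [s us sx] := fsupp_uniq fx.
have [t ut tA] := fsupp_uniq (fsupp_of hA fx).
pose r := undup (s ++ t); have ur : uniq r by exact: undup_uniq.
have rx v : v \notin r -> x v = 0 /\ A x v = 0.
  by rewrite mem_undup mem_cat negb_or => /andP[/sx -> /tA ->].
pose Z := undup (map kappa r).
have split (f : V -> R) (g : V -> V -> R) : (forall v, v \notin r -> f v = 0) ->
    (forall z v, g z v = if kappa v == z then f v else 0) ->
    dot f f = \sum_(z <- Z) dot (g z) (g z).
  move=> rf gE; rewrite (dotE _ ur rf).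
  under [RHS]eq_bigr => z _.
    rewrite (@dotE _ _ r); [|exact: ur|by move=> v /rf fv; rewrite gE fv if_same].
    over.
  rewrite exchange_big /=; apply: eq_big_seq => v vr.
  have kZ : kappa v \in Z by rewrite mem_undup map_f.
  rewrite (bigD1_seq (kappa v)) ?undup_uniq//= !gE eqxx big1 ?addr0// => z zk.
  by rewrite gE eq_sym (negbTE zk) mul0r.
have dx := split x y (fun v vr => (rx v vr).1) (fun z v => erefl).
have dA := split (A x) (fun z => A (y z)) (fun v vr => (rx v vr).2) Ay.
move: lt; rewrite dA dx mulr_sumr => /pigeonhole_ltr[z _ hz].
by exists z.
Qed.

End Decouple.

Section Localise.
Variables (R : realType) (T : graph) (d : nat) (hT : regular_tree d T) (o : T).
Variables (w : T -> R) (A : (T -> R) -> T -> R).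
Hypotheses (hA : sym_local A) (AE : A = hop (@nbs T) w).
Implicit Types (x y : T -> R).

Let hG := regular_tree_bounded hT.

(** The window lives where [c - 2 D < dist o v < c]; the offset [2 D] gives every vertex, even the
    root, a full family of windows. *)
Definition window D c x : T -> R := fun v => tent R D (dist o v + 2 * D - c) * x v.

Lemma window_fsupp D c x : fsupp x -> fsupp (window D c x).
Proof. by move=> [s sx]; exists s => v /sx; rewrite /window => ->; rewrite mulr0. Qed.

Lemma window_commutator D c x v : A (window D c x) v =
  tent R D (dist o v + 2 * D - c) * A x v +
  \sum_(u <- nbs v) (tent R D (dist o u + 2 * D - c) -
                     tent R D (dist o v + 2 * D - c)) * x u.
Proof.
rewrite AE /hop /window mulrDr mulr_sumr addrAC -big_split /=.
congr (_ + _); last by rewrite mulrCA.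
by apply: eq_bigr => u _; rewrite -mulrDl addrC subrK.
Qed.

Lemma tent_adjacent D K u v : (0 < D)%N -> adj v u ->
  \sum_(c < K) (tent R D (dist o u + 2 * D - c) -
                tent R D (dist o v + 2 * D - c)) ^+ 2 <= (2 * D).+1%:R.
Proof.
move=> D0 vu; have /orP[/eqP ->|/eqP ->] := adj_dist hT o vu.
  exact: tent_variation.
under eq_bigr do rewrite -sqrrN opprB.
exact: tent_variation.
Qed.

(** Average over [c]. With [S] the mass, the windows have total squared norm [S |x|^2], and their
    images at most [2 S |A x|^2 + 2 d^2 (2 D + 1) |x|^2], the last term coming from the commutator.
    The factor 4 leaves half of [b S |x|^2] to each term. *)
Lemma exists_window (b : R) : 0 < b -> exists2 D, (0 < D)%N & forall x, fsupp x ->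
  4 * dot (A x) (A x) < b * dot x x ->
  exists c, dot (A (window D c x)) (A (window D c x)) <
            b * dot (window D c x) (window D c x).
Proof.
(* Large enough that [4 d^2 (2 D + 1) <= 12 d^2 D <= b D^2 <= b S]. *)
move=> b0; pose D := (Num.truncn (12 * (d * d)%:R / b)).+1.
have D0 : (0 < D)%N by [].
have bD : 12 * (d * d)%:R <= b * D%:R :> R.
  by rewrite [leRHS]mulrC -ler_pdivrMr//; apply: ltW; exact: truncnS_gt.
exists D => // x fx lt.
have [s us sx] := fsupp_uniq fx.
have [t ut tA] := fsupp_uniq (fsupp_of hA fx).
have fW c := window_fsupp D c fx.
pose r0 := undup (s ++ t).
pose r := undup (r0 ++ flatten [seq nbs v | v <- r0]).
have ur : uniq r by exact: undup_uniq.
have rx v : v \notin r -> x v = 0 /\ A x v = 0.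
  rewrite mem_undup mem_cat negb_or mem_undup mem_cat negb_or => /andP[/andP[]].
  by move=> /sx -> /tA ->.
have rW c v : v \notin r -> A (window D c x) v = 0.
  move=> vr; rewrite window_commutator (rx v vr).2 mulr0 add0r big1_seq// => u /= uv.
  rewrite [x u](_ : _ = 0) ?mulr0//; apply: sx; apply: contra vr => us'.
  rewrite mem_undup mem_cat; apply/orP; right; apply/flatten_mapP; exists u.
    by rewrite mem_undup mem_cat us'.
  by rewrite nbs_sym.
have [K0 _ K0P] := bounded_gball r o.
pose K := (K0 + 2 * D)%N.
have mass v : v \in r -> \sum_(c < K) tent R D (dist o v + 2 * D - c) ^+ 2 = tent_mass R D.
  by move=> /K0P h; apply: tent_partition => //; rewrite leq_add2r distC.
set S := tent_mass R D in mass.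
have SD : (D * D)%:R <= S := tent_mass_ge R D0.
have S0 : 0 < S by apply: lt_le_trans SD; rewrite ltr0n muln_gt0 D0.
have dW : \sum_(c < K) dot (window D c x) (window D c x) = S * dot x x.
  rewrite (dotE _ ur (fun v vr => (rx v vr).1)) mulr_sumr.
  under eq_bigr => c _.
    rewrite (@dotE _ _ r) => [||v /rx[x0 _]]; [|by []|by rewrite /window x0 mulr0].
    over.
  rewrite exchange_big /=; apply: eq_big_seq => v vr.
  rewrite -(mass v vr) mulr_suml; apply: eq_bigr => c _.
  by rewrite /window; ring.
have dAW : \sum_(c < K) dot (A (window D c x)) (A (window D c x)) <=
    2 * S * dot (A x) (A x) + 2 * ((d * d) * (2 * D).+1)%:R * dot x x.
  under eq_bigr => c _.
    rewrite (@dotE _ _ r) => [||v /rW]; [|by []|exact].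
    under eq_bigr do rewrite -expr2.
    over.
  rewrite exchange_big /=.
  rewrite (dotE _ ur (fun v vr => (rx v vr).2)).
  under [X in _ <= 2 * S * X + _]eq_bigr do rewrite -expr2.
  have pt v : v \in r -> \sum_(c < K) A (window D c x) v ^+ 2 <=
      2 * (S * A x v ^+ 2) +
      2 * (d%:R * ((2 * D).+1%:R * \sum_(u <- nbs v) x u ^+ 2)).
    move=> vr; rewrite -(mass v vr).
    apply: (@le_trans _ _ (\sum_(c < K)
      (2 * (tent R D (dist o v + 2 * D - c) ^+ 2 * A x v ^+ 2) +
       2 * (d%:R * \sum_(u <- nbs v) (tent R D (dist o u + 2 * D - c) -
          tent R D (dist o v + 2 * D - c)) ^+ 2 * x u ^+ 2)))).
      apply: ler_sum => c _; rewrite window_commutator.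
      set p := tent R D _ * _; set q := \sum_(u <- nbs v) _.
      have hq : q ^+ 2 <= d%:R * \sum_(u <- nbs v) (tent R D (dist o u + 2 * D - c) -
          tent R D (dist o v + 2 * D - c)) ^+ 2 * x u ^+ 2.
        apply: le_trans (sqr_sum_le _ _) _; rewrite (size_nbs hT).
        by under eq_bigr do rewrite exprMn.
      have hp : p ^+ 2 = tent R D (dist o v + 2 * D - c) ^+ 2 * A x v ^+ 2.
        by rewrite exprMn.
      rewrite -hp; apply: (@le_trans _ _ (2 * p ^+ 2 + 2 * q ^+ 2)).
        rewrite -subr_ge0 (_ : _ - _ = (p - q) ^+ 2) ?sqr_ge0//; ring.
      by rewrite lerD2l ler_wpM2l.
    rewrite big_split /= -!mulr_sumr -mulr_suml lerD2l ler_wpM2l// ler_wpM2l//.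
    rewrite exchange_big /= mulr_sumr big_seq [leRHS]big_seq; apply: ler_sum => u uv.
    rewrite -mulr_suml ler_wpM2r ?sqr_ge0//; apply: tent_adjacent => //.
    by rewrite -mem_nbs.
  rewrite big_seq; apply: le_trans (ler_sum _ pt) _.
  rewrite -big_seq big_split /= -!mulr_sumr mulrA lerD2l -mulrA ler_wpM2l//.
  rewrite natrM natrM -!mulrA ler_wpM2l// [leRHS]mulrCA ler_wpM2l//.
  rewrite (dotE _ us sx) mulr_sumr; under [leRHS]eq_bigr do rewrite -expr2.
  have nbE v : \sum_(u <- nbs v) x u ^+ 2 = \sum_(u <- s | u \in nbs v) x u ^+ 2.
    apply: (@sum_nb_supp _ _ (@nbs T) _ (fun u => x u ^+ 2)) => //.
      exact: nbs_uniq.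
    by move=> u /sx ->; rewrite expr0n.
  rewrite [leLHS](eq_bigr _ (fun v _ => nbE v)).
  rewrite (exchange_big_dep xpredT) //=; apply: ler_sum => u _.
  rewrite -big_filter big_const_seq count_predT iter_addr_0 -[leLHS]mulr_natl.
  rewrite ler_wpM2r ?sqr_ge0// ler_nat -(size_nbs hT u).
  apply: uniq_leq_size; first by rewrite filter_uniq.
  by move=> v; rewrite mem_filter nbs_sym// => /andP[].
have dx0 : 0 <= dot x x by exact: dot_ge0.
have bS : 4 * ((d * d) * (2 * D).+1)%:R <= b * S.
  apply: (@le_trans _ _ (b * (D * D)%:R)); last by rewrite ler_wpM2l// ltW.
  rewrite !natrM mulrA -natrM.
  have D1 : 1 <= D%:R :> R by rewrite ler1n.
  have D3 : (2 * D).+1%:R <= 3 * D%:R :> R by rewrite -natr1 natrM; lra.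
  apply: (@le_trans _ _ (4 * (d * d)%:R * (3 * D%:R))).
    by rewrite ler_wpM2l// mulr_ge0.
  rewrite (_ : 4 * _ * _ = 12 * (d * d)%:R * D%:R); last by ring.
  by rewrite mulrA ler_wpM2r.
have : \sum_(c < K) dot (A (window D c x)) (A (window D c x)) <
    \sum_(c < K) b * dot (window D c x) (window D c x).
  rewrite -mulr_sumr dW; apply: le_lt_trans dAW _.
  have h1 : S * (4 * dot (A x) (A x)) < S * (b * dot x x) by rewrite ltr_pM2l.
  have h2 := ler_wpM2r dx0 bS.
  lra.
rewrite -!(big_mkord xpredT (fun c => dot (A (window D c x)) (A (window D c x))))
  -(big_mkord xpredT (fun c => b * dot (window D c x) (window D c x))).
by move=> /pigeonhole_ltr[c _ hc]; exists c.
Qed.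

Lemma dist_ancestor n v : (dist v (iter n (parent o) v) <= n)%N.
Proof.
elim: n => [|n IH]; first by rewrite distxx.
rewrite iterS; set p := iter n _ v in IH *.
have [po|po] := eqVneq p o; first by rewrite po parent_id// -po leqW.
have [a _] := parentP hT po.
by apply: leq_trans (dist_adj v a) _; rewrite ltnS.
Qed.

(** The diameter bound depends on [b] only, not on [x]; this uniformity allows all radii to be fixed
    before any function is chosen. *)
Lemma localise (b : R) : 0 < b -> exists D, forall x, fsupp x ->
  4 * dot (A x) (A x) < b * dot x x ->
  exists y, [/\ fsupp y, dot (A y) (A y) < b * dot y y,
    forall v, y v != 0 -> x v != 0 &
    forall u v, y u != 0 -> y v != 0 -> (dist u v <= D)%N].
Proof.
move=> b0; have [D D0 hD] := exists_window b0.
exists (4 * D)%N => x fx lt; have [c hc] := hD x fx lt.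
set x' := window D c x in hc; pose s := (c - 2 * D)%N.
have fx' : fsupp x' by exact: window_fsupp.
have supp v : x' v != 0 -> (c < dist o v + 2 * D)%N && (dist o v < c)%N.
  move=> xv; apply/negPn/negP; rewrite negb_and -!leqNgt => h.
  move/eqP: xv; apply; rewrite /x' /window.
  case/orP: h => h.
    by move: h; rewrite -subn_eq0 => /eqP ->; rewrite tent0 mul0r.
  by rewrite tent_big ?mul0r//; lia.
(* The ancestor at distance [s] from the root. An edge that changes it has both ends at distance at
   most [s] with [s > 0], where the window vanishes. If [c <= 2 D] then [s = 0] and the only
   ancestor is the root. *)
pose kappa v := iter (dist o v - s) (parent o) v.
have kadj u v : adj v u -> dist o u = (dist o v).+1 -> kappa u != kappa v ->
    x' u = 0 /\ x' v = 0.
  move=> vu du kuv.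
  have vpar : v = parent o u.
    by apply: (parent_unique hT); rewrite ?du// adj_sym.
  have vs : (dist o v < s)%N.
    rewrite ltnNge; apply/negP => sv; move/eqP: kuv; apply.
    rewrite /kappa du subSn// iterSr -vpar //.
  split; apply/eqP; apply: contrapT => /negP /supp; rewrite /s in vs; lia.
have sep u v : u \in nbs v -> kappa u != kappa v -> x' u = 0 /\ x' v = 0.
  rewrite mem_nbs// => vu kuv.
  have /orP[/eqP e|/eqP e] := adj_dist hT o vu; first exact: kadj.
  have [] := kadj v u; rewrite 1?adj_sym// eq_sym; by [].
have [z hz] := decouple hA AE fx' sep hc.
exists (fun v => if kappa v == z then x' v else 0); split => //.
- by have [t tx] := fx'; exists t => v /tx ->; rewrite if_same.
- move=> v; case: ifP => _; rewrite ?eqxx// /x' /window.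
  by rewrite mulf_eq0 negb_or => /andP[].
- have near v : (if kappa v == z then x' v else 0) != 0 -> (dist v z <= 2 * D)%N.
    case: ifP => [/eqP <- /supp h|]; last by rewrite eqxx.
    apply: leq_trans (dist_ancestor _ _) _; rewrite /s; lia.
  move=> u v /near uz /near vz; apply: leq_trans (dist_triangle u z v) _.
  by rewrite (distC z); lia.
Qed.

(** Start from accuracy [4 ^- n.+1] off a large ball and localise for [k = n], then [n - 1], down to
    0. Each step costs a factor 4 and takes place inside the previous support, so a point of the
    innermost support lies in all of them. *)
Lemma localise_nested : far_approx A -> exists D : nat -> nat, forall n N,
  exists2 p, (N <= dist o p)%N & forall k, (k <= n)%N ->
    exists y, [/\ fsupp y, dot (A y) (A y) < 4 ^- k * dot y y &
      forall u, y u != 0 -> (dist p u <= D k)%N].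
Proof.
move=> far.
have pos k : 0 < 4 ^- k :> R by rewrite invr_gt0 exprn_gt0.
have [D hD] := choice (fun k => localise (pos k)).
exists D => n N.
have step m x : fsupp x -> 4 * dot (A x) (A x) < 4 ^- m * dot x x ->
    exists2 p, x p != 0 & forall k, (k <= m)%N ->
    exists y, [/\ fsupp y, dot (A y) (A y) < 4 ^- k * dot y y &
      forall u, y u != 0 -> (dist p u <= D k)%N].
  elim: m x => [|m IH] x fx lt.
    have [y [fy ylt yx yD]] := hD 0%N x fx lt.
    have [p yp] : exists p, y p != 0.
      apply: contrapT => no; move: ylt; rewrite (_ : y = fun=> 0).
        by rewrite (sym_local0 hA) /dot fsbig1 ?mulr0 ?ltxx// => v _; rewrite mulr0.
      by apply/funext => v; apply/eqP; apply: contrapT => /negP yv; apply: no; exists v.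
    exists p; first exact: yx.
    move=> k; rewrite leqn0 => /eqP ->; exists y; split=> // u yu.
    exact: yD.
  have [y [fy ylt yx yD]] := hD m.+1 x fx lt.
  have [||p yp hp] := IH y => //.
    rewrite -(ltr_pM2l (_ : 0 < 4^-1 :> R)) ?invr_gt0//.
    rewrite !mulrA mulVf ?mul1r; last by rewrite pnatr_eq0.
    by rewrite -invfM -exprS.
  exists p; first exact: yx.
  move=> k; rewrite leq_eqVlt => /orP[/eqP ->|]; last exact: hp.
  by exists y; split=> // u yu; exact: yD.
pose F : seq T := ball_seq o N.
have q0 : 0 < 4^-1 * 4 ^- n :> R by rewrite mulr_gt0// invr_gt0.
have [x [fx xF xlt]] := far _ F q0.
have [|p xp hp] := step n x fx.
  rewrite -(ltr_pM2l (_ : 0 < 4^-1 :> R)) ?invr_gt0//.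
  by rewrite !mulrA mulVf ?mul1r ?pnatr_eq0.
exists p => //; rewrite leqNgt; apply/negP => pN; move/eqP: xp; apply.
by apply: xF; rewrite mem_ball_seq// distC ltnW.
Qed.

End Localise.

(** * Transport of functions and cluster points of potentials *)

Lemma dot_comp_bij (R : realType) (V W : choiceType) (f : W -> V) (g : V -> W)
    (x y : V -> R) : cancel f g -> cancel g f -> fsupp x ->
  fsupp (x \o f) /\ dot (x \o f) (y \o f) = dot x y.
Proof.
move=> fK gK fx; have [s us sx] := fsupp_uniq fx.
have ug : uniq (map g s) by rewrite map_inj_uniq//; exact: can_inj gK.
have gx w : w \notin map g s -> (x \o f) w = 0.
  move=> ws; apply: sx; apply: contra ws => fs.
  by rewrite -(fK w) map_f.
split; first by exists (map g s).
rewrite (dotE _ ug gx) (dotE _ us sx) big_map.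
by apply: eq_bigr => v _ /=; rewrite gK.
Qed.

Lemma nbhs_eval (R : realType) (W : choiceType)
    (Q : prod_topology (fun _ : W => R)) (w : W) (e : R) : 0 < e ->
  nbhs Q [set g : prod_topology (fun _ : W => R) | `|Q w - g w| < e].
Proof.
move=> e0; have pc := @proj_continuous W (fun _ => R) w Q.
exact: (pc _ (@nbhsx_ballx _ R (Q w) e e0)).
Qed.

(** Tychonoff's theorem for a product of segments. Closeness on a finite set at one large index at a
    time is all that is retained; the subsequence is built later, under further constraints. *)
Lemma pointwise_cluster (R : realType) (W : choiceType) (f : nat -> W -> R) (M : R) :
  (forall n w, `|f n w| <= M) ->
  exists Q : W -> R, (forall w, `|Q w| <= M) /\
    forall (s : seq W) (e : R) m, 0 < e ->
      exists2 n, (m <= n)%N & forall w, w \in s -> `|Q w - f n w| < e.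
Proof.
move=> fM; pose A (_ : W) : set R := `[- M, M]%classic.
have cA : compact [set g : prod_topology (fun _ : W => R) | forall w, A w (g w)].
  by apply: tychonoff => w; exact: segment_compact.
have Af n : [set g | forall w, A w (g w)] (f n : prod_topology (fun _ : W => R)).
  by move=> w; rewrite /A /= in_itv /= -ler_norml fM.
pose F := (fun n => f n : prod_topology (fun _ : W => R)) @ \oo.
have [] := cA F _; first by exists 0%N => // n _; exact: Af.
move=> Q [QA Qcl]; exists Q; split.
  by move=> w; have := QA w; rewrite /A /= in_itv /= -ler_norml.
move=> s e m e0.
have FA : F (f @` [set n | (m <= n)%N]) by exists m => // n mn; exists n.
have QB : nbhs Q [set g : prod_topology (fun _ : W => R) |
    forall w, w \in s -> `|Q w - g w| < e].
  elim: s => [|w s IH]; first by apply: filterS filterT => g _ w; rewrite in_nil.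
  apply: filterS2 IH (nbhs_eval Q w e0) => g gs gw u; rewrite inE => /predU1P[->//|]; exact: gs.
have [_ [[n mn <-] close]] := Qcl _ _ FA QB.
by exists n.
Unshelve. all: by end_near. Qed.

(** * The R-limit along a ray *)

Section LimitOperator.
Variables (R : realType) (d : nat) (hd : (2 < d)%N) (T : graph) (hT : regular_tree d T).
Variables (H : schrodinger_operator R T) (o : T) (q : nat -> R).
Hypothesis Hq : forall v, potential H v = q (dist v o + 1)%N.

Let hG : bounded_degree T := regular_tree_bounded hT.

Definition ray m : T := addr o o (nseq m 0%N).

Lemma valid_ray m : valid d (nseq m 0%N).
Proof. by elim: m => //= m ->; rewrite andbT; case: (nseq m 0%N); lia. Qed.

Lemma dist_ray m : dist o (ray m) = m.
Proof. by rewrite (dist_addr hT)// ?size_nseq// valid_ray. Qed.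

Lemma ray_path : path_to_infinity ray.
Proof.
split=> [n|].
  by rewrite adj_sym; exact: (adj_addr hT o o (valid_ray n.+1)).
have -> : (fun n => dist (ray n) (ray 0)) = id.
  by apply/funext => n; rewrite distC -[ray 0]/o dist_ray.
exact: cvg_id.
Qed.

(** Up to radius [dist o p], the potential seen from [p] through addresses depends on [p] only by
    its distance to [o]; so [p] may be replaced by the point of the ray at the same level. *)
Lemma potential_level p (w : seq nat) : valid d w -> (size w <= dist o p)%N ->
  potential H (addr o p w) = q (level (dist o p) w + 1)%N.
Proof. by move=> vw sw; rewrite Hq distC (dist_addr_level hT vw sw). Qed.

Definition nil_word : word d := exist _ [::] isT.

Lemma R_limit_of_far_approx (a : R) : far_approx (shiftr (real_op H) a) ->
  exists (G' : graph) (H' : schrodinger_operator R G') (v0' : G'),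
    R_limit H H' v0' /\ spectrum H' (a%:C)%C.
Proof.
move=> far; have hA := sym_local_shiftr a (sym_local_real_op hG H).
have AE : shiftr (real_op H) a = hop (@nbs T) (fun v => weight H v - a).
  exact: shiftr_hop.
have [D hD] := localise_nested hT o hA AE far.
have [p hp] := choice (fun n => (exists2P _ _).1 (hD n n)).
have [M HM] := potential_bounded H.
pose f n (w : word d) : R := potential H (word_addr o (p n) w).
have [Q [QM Qcl]] := @pointwise_cluster R (word d) f M (fun n w => HM _).
pose W : graph := word_graph hT o.
have QM' : exists M0 : R, forall w : W, `|(Q : W -> R) w| <= M0 by exists M.
pose H' := @SchrodingerOperator R W Q QM'.
have hW : bounded_degree W := word_graph_bounded hT o.
pose B j : seq (word d) := ball_seq (nil_word : W) j.
have [pick hpick] : exists pick : nat -> nat -> nat, forall m j, (m <= pick m j)%N /\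
    forall w, w \in B j -> `|Q w - f (pick m j) w| < j.+1%:R^-1.
  have ex (mj : nat * nat) : exists n, (mj.1 <= n)%N /\
      forall w, w \in B mj.2 -> `|Q w - f n w| < mj.2.+1%:R^-1.
    have e0 : 0 < mj.2.+1%:R^-1 :> R by rewrite invr_gt0.
    by have [n mn cl] := Qcl (B mj.2) _ mj.1 e0; exists n.
  by have [pick hpick] := choice ex; exists (fun m j => pick (m, j)) => m j; exact: (hpick (m, j)).
(* The next index is taken beyond the current level; as [p n] has level at least [n], the levels
   [L j] increase strictly, as an R-limit along the ray demands. *)
pose fix N j := if j is j'.+1 then pick (maxn j (dist o (p (N j'))).+1) j else pick 0%N 0%N.
have Nclose j w : w \in B j -> `|Q w - f (N j) w| < j.+1%:R^-1.
  by case: j => [|j]; exact: (hpick _ _).2.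
have Nge j : (j <= N j)%N.
  case: j => [//|j]; apply: leq_trans (hpick _ _).1; exact: leq_maxl.
pose L j := dist o (p (N j)).
have Lmono : {homo L : i j / (i < j)%N}.
  apply: (homo_ltn ltn_trans) => j; apply: leq_trans (hp (N j.+1)).1.
  apply: leq_trans (hpick _ _).1; exact: leq_maxr.
have Lge j : (j <= L j)%N := leq_trans (Nge j) (hp (N j)).1.
have inB j (w : word d) : (w \in B j) = (size (sval w) <= j)%N.
  transitivity (dist (w : W) nil_word <= j)%N; first exact: (mem_ball_seq hW).
  have [g [fK gK]] := word_addr_bij hT o o.
  have := dist_iso (G' := W) fK gK (word_addr_adj hT o o) nil_word w.
  by rewrite (dist_addr hT o o (valP w)) distC => ->.
have sinv (e : R) : 0 < e -> exists m, forall j, (m <= j)%N -> j.+1%:R^-1 < e.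
  move=> e0; exists (Num.truncn e^-1) => j mj.
  rewrite -[e]invrK ltf_pV2 ?posrE ?invr_gt0//.
  by apply: lt_le_trans (truncnS_gt _) _; rewrite ler_nat ltnS.
exists W, H', nil_word; split.
- have [g hg] := choice (fun j => word_addr_bij hT o (ray (L j))).
  apply: (@R_limit_of_iso _ _ W hG hW H H' ray L nil_word
           (fun j => word_addr o (ray (L j))) g ray_path Lmono).
  + by move=> j; have [] := hg j.
  + by move=> j; have [] := hg j.
  + by move=> j u w; exact: word_addr_adj.
  + by [].
  + move=> w; apply/cvgrPdist_lt => e e0; have [m hm] := sinv e e0.
    exists (maxn m (size (sval w))) => // j /=; rewrite geq_max => /andP[mj wj].
    have wL : (size (sval w) <= L j)%N := leq_trans wj (Lge j).
    have -> : potential H (word_addr o (ray (L j)) w) = f (N j) w.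
      by rewrite /f /word_addr !potential_level ?dist_ray//; exact: valP.
    by apply: lt_trans (hm j mj); apply: Nclose; rewrite inB.
- apply/(spectrumP hW); split=> //= -[kappa k0 hk].
  have k4 : 0 < kappa / 4 by rewrite divr_gt0.
  have [k hk4] := sinv _ k4.
  (* [j >= D k] puts the support of the function of accuracy [4 ^- k] inside the ball where the
     potentials are close; [j >= k] makes that function available and the closeness at most
     [1 / (k + 1)]. *)
  pose j := maxn k (D k).
  have kN : (k <= N j)%N by apply: leq_trans (Nge j); exact: leq_maxl.
  have [y [fy ylt yD]] := (hp (N j)).2 k kN.
  have [g [fK gK]] := word_addr_bij hT o (p (N j)).
  set al := word_addr o (p (N j)) in fK gK.
  have [fx dx] := dot_comp_bij y fK gK fy.
  have [fz dz] := dot_comp_bij (shiftr (real_op H) a y) fK gK (fsupp_of hA fy).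
  have al_adj : forall u w, adj (al u) (al w) = (@adj W) u w.
    by move=> u w; exact: word_addr_adj.
  have close w : y (al w) != 0 -> `|Q w - f (N j) w| < j.+1%:R^-1.
    move=> /yD; rewrite (dist_addr hT _ _ (valP w)) => h.
    by apply: Nclose; rewrite inB (leq_trans h)// leq_maxr.
  (* Both operators have the same adjacency, so they differ by the difference of potentials only.
     Its contribution and [4 ^- k] are each below [kappa / 4], and the factors 2 from squaring the
     sum bring the total below [kappa]. *)
  have Ax (w : W) : shiftr (real_op H') a (y \o al) w =
      shiftr (real_op H) a y (al w) + (Q w - f (N j) w) * y (al w).
    rewrite /shiftr /real_op /hop /= (perm_big _ (perm_nbs_iso hG hW fK gK al_adj w)).
    rewrite big_map /weight (size_nbs_iso hG hW fK gK al_adj) /f /=.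
    by rewrite -/al; ring.
  have := hk _ fx; apply/negP; rewrite -ltNge.
  pose e : R := j.+1%:R^-1; have e0 : 0 < e by rewrite invr_gt0.
  pose z (w : W) := (Q w - f (N j) w) * y (al w).
  have fzz : fsupp z.
    by have [s sx] := fx; exists s => w /sx /= yw; rewrite /z yw mulr0.
  have zle : dot z z <= e ^+ 2 * dot y y.
    rewrite -dx; have [s us sx] := fsupp_uniq fx.
    rewrite (dotE _ us sx) (@dotE _ _ s)//; last first.
      by move=> w /sx /= yw; rewrite /z yw mulr0.
    rewrite mulr_sumr; apply: ler_sum => w _.
    have [yw|yw] := eqVneq (y (al w)) 0; first by rewrite /z /= yw !mulr0.
    rewrite -!expr2 /z exprMn ler_wpM2r ?sqr_ge0// -real_normK ?num_real//.
    by rewrite ler_pXn2r ?nnegrE ?(ltW e0)//; exact/ltW/close.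
  have AxE : shiftr (real_op H') a (y \o al) = (shiftr (real_op H) a y \o al) \+ z.
    by apply/funext => w; exact: Ax.
  have y0 : 0 < dot y y.
    rewrite lt_neqAle dot_ge0 andbT; apply/eqP => y0.
    by move: ylt; rewrite -y0 mulr0 ltNge dot_ge0.
  have par : dot (shiftr (real_op H') a (y \o al)) (shiftr (real_op H') a (y \o al)) <=
      2 * dot (shiftr (real_op H) a y) (shiftr (real_op H) a y) + 2 * dot z z.
    rewrite AxE -dz dot_expand_add//.
    have := dot_ge0 ((shiftr (real_op H) a y \o al) \- z).
    rewrite dot_expand_sub//; lra.
  apply: le_lt_trans par _; rewrite dx.
  have ek : e <= k.+1%:R^-1 by rewrite lef_pV2 ?posrE// ler_nat ltnS leq_maxl.
  have e1 : e <= 1 by rewrite invf_le1// ler1n.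
  have e2 : e ^+ 2 <= k.+1%:R^-1.
    by apply: le_trans ek; rewrite expr2 ler_piMr// ltW.
  have pk : 4 ^- k <= k.+1%:R^-1 :> R.
    rewrite lef_pV2 ?posrE ?exprn_gt0//.
    by rewrite -natrX ler_nat ltn_expl.
  have hkk := hk4 k (leqnn k).
  have h1 : 4 ^- k * dot y y <= kappa / 4 * dot y y.
    by rewrite ler_wpM2r ?dot_ge0//; apply: le_trans pk _; exact: ltW.
  have h2 : e ^+ 2 * dot y y <= kappa / 4 * dot y y.
    by rewrite ler_wpM2r ?dot_ge0//; apply: le_trans e2 _; exact: ltW.
  lra.
Qed.

End LimitOperator.

Theorem theorem3p1 (R : realType) (d : nat) (hd : (2 < d)%N) (T : graph)
    (hT : regular_tree d T) (H : schrodinger_operator R T)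
    (hH : spherically_symmetric H) :
  essential_spectrum H =
  [set lam | exists (G' : graph) (H' : schrodinger_operator R G') (v0' : G'),
     R_limit H H' v0' /\ spectrum H' lam].
Proof.
have hG := regular_tree_bounded hT.
have realE (lam : R[i]) : complex.Im lam = 0 -> lam = ((complex.Re lam)%:C)%C.
  by case: lam => p q /= ->.
apply/seteqP; split=> lam.
  move=> /(far_approx_of_essential hG)[/realE -> far].
  have [v0 [q Hq]] := hH.
  exact: (R_limit_of_far_approx hd hT Hq far).
move=> [G' [H' [v0' [lim sp]]]].
have hG' : bounded_degree G' by case: lim.
have [li nb] := (spectrumP hG' H' lam).1 sp.
rewrite (realE _ li); apply: essential_of_far_approx => //.
exact: far_approx_of_R_limit lim nb.
Qed.
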